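(* Suppose there exists a constant $C>0$ such that for all sufficiently large $X$, \[ \widetilde E(X)\ \le\ \tfrac{5}{6}\,\widetilde E(X^{3/4})\;+\;C\,X^{1/2}\log X . \] Then every nontrivial zero of the Riemann zeta function $\zeta(s)$ lies on the critical line $\Re(s)=\tfrac12$.
   Context: Let $\pi(m)$ be the number of primes $\le m$, $\psi$ the Chebyshev function $\psi(x)=\sum_{n\le x}\Lambda(n)$, and $E_\psi(y):=\psi(y)-y$. Let $\mathbb{N}_{\mathrm{comp}}$ denote the set of composite positive integers. The integer map $\mathcal{M}$ is defined by: for composite $m$, $\mathcal{M}(m)=m+\pi(m)$ (composites advance by $\pi(m)$); for a prime $p\ge 3$, $\mathcal{M}(p)=p-(p-p^-)=p^-$, where $p^-$ is the largest prime less than $p$ (primes step backward by their preceding prime gap). The trajectory of $y$ is the sequence $y_0=y$, $y_{j+1}=\mathcal{M}(y_j)$. For $X\ge 2$ put $W_X=[X,(1+0.1/\log X)X]$ and $\widetilde W_X=[X,(1+2/\log X)X]$, and let $\mathcal{T}(y;\widetilde W_X)$ denote the segment of the trajectory of $y$ lying inside $\widetilde W_X$. For large $X$ define \[ \widetilde E(X):=\sup_{y\in \widetilde W_X\cap\mathbb{N}_{\mathrm{comp}}}\Bigl|\sum_{\substack{m\in\mathcal{T}(y;\widetilde W_X)\\ m\in\mathbb{N}_{\mathrm{comp}}}} E_\psi(m)\Bigr| . \] *)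

(* Defs.v *)
From Stdlib Require Import Reals ZArith Znumtheory List Arith.
From Coquelicot Require Import Coquelicot.
Open Scope R_scope.

Definition isprime (n : nat) : bool :=
  if prime_dec (Z.of_nat n) then true else false.

Definition composite (n : nat) : Prop := (2 <= n)%nat /\ isprime n = false.

Definition sumR (f : nat -> R) (l : list nat) : R :=
  fold_right (fun n acc => f n + acc) 0 l.

Definition prime_pi (m : nat) : nat := length (filter isprime (seq 0 (S m))).

(* von Mangoldt: Lambda(n) = log p if n = p^k (p prime, k >= 1), else 0.
   At most one pair (p,k) with 2 <= p <= n, 1 <= k <= n satisfies p^k = n. *)
Definition vonMangoldt (n : nat) : R :=
  sumR (fun p => sumR (fun k =>
          if (isprime p && Nat.eqb (p ^ k) n)%bool then ln (INR p) else 0)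
        (seq 1 n)) (seq 2 n).

Definition psi (m : nat) : R := sumR vonMangoldt (seq 1 m).

Definition Epsi (m : nat) : R := psi m - INR m.

(* largest prime < n (0 if none) *)
Fixpoint prevprime (n : nat) : nat :=
  match n with
  | O => O
  | S m => if isprime m then m else prevprime m
  end.

(* the map M; on 0, 1, 2 (where the paper leaves M undefined) we set M m = m *)
Definition Mmap (m : nat) : nat :=
  if isprime m then (if Nat.leb 3 m then prevprime m else m)
  else if Nat.leb 2 m then (m + prime_pi m)%nat else m.

Definition traj (y : nat) (j : nat) : nat := Nat.iter j Mmap y.

Definition inWt (X : R) (m : nat) : Prop :=
  X <= INR m <= (1 + 2 / ln X) * X.

(* J is the exit index: y_0..y_{J-1} lie in the window, y_J does not;
   the segment T(y; W~_X) is y_0, ..., y_{J-1}. *)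
Definition exit_index (X : R) (y J : nat) : Prop :=
  (forall j, (j < J)%nat -> inWt X (traj y j)) /\ ~ inWt X (traj y J).

Definition seg_sum (y J : nat) : R :=
  sumR (fun j => if isprime (traj y j) then 0
                 else if Nat.leb 2 (traj y j) then Epsi (traj y j) else 0)
       (seq 0 J).

Definition Etilde (X : R) : Rbar :=
  Lub_Rbar (fun r => exists y : nat, composite y /\ inWt X y /\
             exists J : nat, exit_index X y J /\ r = Rabs (seg_sum y J)).

(* complex powers with positive real base: x^s = exp(s log x) *)
Definition cpow (x : R) (s : C) : C :=
  (exp (Re s * ln x) * cos (Im s * ln x), exp (Re s * ln x) * sin (Im s * ln x)).

(* zeta on Re s > 0, s <> 1, via the Dirichlet eta series:
   zeta(s) = eta(s) / (1 - 2^(1-s)),  eta(s) = sum_{n>=1} (-1)^(n-1) n^(-s).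
   is_zeta s z : z is the value zeta(s). *)
Definition is_zeta (s z : C) : Prop :=
  0 < Re s /\ s <> RtoC 1 /\
  exists eta : C,
    is_series (K := C_AbsRing) (V := C_NormedModule)
      (fun n : nat => Cmult (RtoC ((-1) ^ n)) (cpow (INR (S n)) (Copp s))) eta /\
    z = Cdiv eta (Cminus (RtoC 1) (cpow 2 (Cminus (RtoC 1) s))).

Definition nontrivial_zeta_zero (s : C) : Prop :=
  0 < Re s < 1 /\ is_zeta s (RtoC 0).

(* Main.v *)
Require Import Defs.
From Stdlib Require Import Reals ZArith Znumtheory List Arith Lra Lia Psatz.
From Coquelicot Require Import Coquelicot.
Open Scope R_scope.

(** For composite [y] the window with right end [y] contains only one point of the
    trajectory of [y], so [|Epsi y|] is at most some [Etilde X] with [X <= y]; iterating the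
    recursion gives [Etilde X = O(sqrt X * ln X)], hence [psi(n) - n = O(n^theta)] for every
    [theta > 1/2].

    Zeros to the right of the critical line.  On the horizontal line [s = 6 - t + i g], the
    functions [xi(s) = (s - 1) zeta(s)] and
    [D(s) = sum_n (psi(n) - n) (n^(-s) - (n+1)^(-s))] are power series in [t] which converge as
    long as [Re s > theta].  The identity [zeta' / zeta = - (D + zeta)], valid near [t = 0],
    becomes a linear differential equation for [|xi|^2]; by uniqueness of power series it holds
    up to [Re s > theta], and there it prevents [xi] from vanishing.

    Zeros to the left.  With [w = 1 - s] and [U(x)] the integral of the fractional part over
    [[0, x]], [zeta(w)] is a multiple of the integral of [U(x) x^(-w-2)] over the half-line.
    The Fourier expansion [U(x) = x/2 - sum_n (sin (pi n x) / (pi n))^2] turns that integral into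
    a regularised multiple of [sum_n n^(-s)], so [zeta(s) = 0] implies [zeta(1 - s) = 0].  This
    needs neither the Gamma function nor an explicit functional equation. *)

(** * Finite sums and the von Mangoldt function *)

(** Every continuation is a power series in one real variable about one centre, so an identity
    checked where the Dirichlet series converge absolutely spreads to the whole interval by
    comparing coefficients, without a chain of discs. The centre [6] is merely comfortable: trivial
    coefficient bounds suffice near it. The radii come from exponents: weighting the [k]-th
    coefficient by [rho^k] costs a factor [n^rho], which gives [D] the radius [6 - theta] and [xi]
    the radius [6].

    Zeros are excluded without logarithms and without dividing: [|xi|^2] solves a linear first-order
    equation whose leading coefficient [|s - 1|^2] vanishes only at the pole. Hence the ordinate [g]
    has to be nonzero, and real zeros are treated apart by the alternating eta series.

    The bound on [psi] says nothing to the left of [1/2], which is what forces the reflection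
    argument. There [U] is expanded rather than the fractional part itself, because the Fourier
    series of [U] has terms of one sign and size [n^(-2)]; all exchanges of sum and integral are
    then elementary. *)

Fixpoint rsum (f : nat -> R) (N : nat) : R :=
  match N with O => 0 | S n => rsum f n + f (S n) end.

Lemma rsum_ext f g N : (forall n, (1 <= n <= N)%nat -> f n = g n) -> rsum f N = rsum g N.
Proof.
  induction N as [|N IH]; intros H; simpl; [easy|].
  rewrite IH, H; [easy|lia|]. intros; apply H; lia.
Qed.

Lemma rsum_le f g N : (forall n, (1 <= n <= N)%nat -> f n <= g n) -> rsum f N <= rsum g N.
Proof.
  induction N as [|N IH]; intros H; simpl; [lra|].
  apply Rplus_le_compat; [apply IH; intros; apply H; lia|apply H; lia].
Qed.

Lemma rsum_zero f N : (forall n, (1 <= n <= N)%nat -> f n = 0) -> rsum f N = 0.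
Proof.
  induction N as [|N IH]; intros H; simpl; [easy|].
  rewrite IH, H; [lra|lia|]. intros; apply H; lia.
Qed.

Lemma rsum_ge0 f N : (forall n, (1 <= n <= N)%nat -> 0 <= f n) -> 0 <= rsum f N.
Proof.
  induction N as [|N IH]; intros H; simpl; [lra|].
  apply Rplus_le_le_0_compat; [apply IH; intros; apply H; lia|apply H; lia].
Qed.

Lemma rsum_plus f g N : rsum (fun n => f n + g n) N = rsum f N + rsum g N.
Proof. induction N as [|N IH]; simpl; [lra|rewrite IH; lra]. Qed.

Lemma rsum_scal c f N : rsum (fun n => c * f n) N = c * rsum f N.
Proof. induction N as [|N IH]; simpl; [lra|rewrite IH; lra]. Qed.

Lemma rsum_swap (f : nat -> nat -> R) N M :
  rsum (fun n => rsum (f n) M) N = rsum (fun m => rsum (fun n => f n m) N) M.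
Proof.
  induction N as [|N IH]; simpl.
  - symmetry; apply rsum_zero; easy.
  - rewrite IH, <- rsum_plus. easy.
Qed.

Lemma rsum_extend f N M : (N <= M)%nat -> (forall n, (N < n <= M)%nat -> f n = 0) ->
  rsum f M = rsum f N.
Proof.
  intros HNM; induction HNM as [|M HM IH]; intros H; [easy|].
  simpl; rewrite IH, H; [lra|lia|]. intros; apply H; lia.
Qed.

Lemma rsum_single f N a : (1 <= a <= N)%nat ->
  (forall n, (1 <= n <= N)%nat -> n <> a -> f n = 0) -> rsum f N = f a.
Proof.
  intros Ha H.
  induction N as [|N IH]; [lia|].
  simpl. destruct (Nat.eq_dec a (S N)) as [->|Hne].
  - rewrite rsum_zero; [lra|]. intros; apply H; lia.
  - rewrite IH; [rewrite (H (S N)) by lia; lra|lia|]. intros; apply H; lia.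
Qed.

Lemma rsum_shift f N : rsum f (S N) = f 1%nat + rsum (fun n => f (S n)) N.
Proof. induction N as [|N IH]; [simpl; lra|]. simpl in *. rewrite IH. lra. Qed.

Lemma rsum_term_le f N a : (1 <= a <= N)%nat ->
  (forall n, (1 <= n <= N)%nat -> 0 <= f n) -> f a <= rsum f N.
Proof.
  intros Ha H. induction N as [|N IH]; [lia|]. simpl.
  destruct (Nat.eq_dec a (S N)) as [->|Hne].
  - assert (0 <= rsum f N) by (apply rsum_ge0; intros; apply H; lia). lra.
  - assert (f a <= rsum f N) by (apply IH; [lia|intros; apply H; lia]).
    assert (0 <= f (S N)) by (apply H; lia). lra.
Qed.

Lemma sumR_app f l l' : sumR f (l ++ l') = sumR f l + sumR f l'.
Proof. induction l as [|a l IH]; simpl; [lra|]. unfold sumR in *; simpl. rewrite IH; lra. Qed.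

Lemma sumR_seq1 f N : sumR f (seq 1 N) = rsum f N.
Proof.
  induction N as [|N IH]; [easy|].
  rewrite seq_S, sumR_app, IH. simpl. unfold sumR; simpl. lra.
Qed.

Lemma sumR_seq2 f N : sumR f (seq 2 N) = rsum (fun n => f (S n)) N.
Proof.
  induction N as [|N IH]; [easy|].
  rewrite seq_S, sumR_app, IH. simpl. unfold sumR; simpl. lra.
Qed.

Lemma INR_ge1 n : (1 <= n)%nat -> 1 <= INR n.
Proof. exact (le_INR 1 n). Qed.

(** * Prime divisors, and [ln n] as the sum of [Lambda(d)] over the divisors [d] of [n] *)

Lemma isprime_prime n : isprime n = true <-> prime (Z.of_nat n).
Proof. unfold isprime; destruct (prime_dec (Z.of_nat n)); split; easy. Qed.

Lemma isprime_ge2 n : isprime n = true -> (2 <= n)%nat.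
Proof. intros H%isprime_prime. apply prime_ge_2 in H. lia. Qed.

Lemma isprime_divide_mul p a b : isprime p = true ->
  Nat.divide p (a * b) -> Nat.divide p a \/ Nat.divide p b.
Proof.
  intros Hp%isprime_prime [c Hc].
  destruct (prime_mult _ Hp (Z.of_nat a) (Z.of_nat b)) as [[x Hx]|[x Hx]].
  - exists (Z.of_nat c). lia.
  - left. exists (Z.to_nat x). pose proof (prime_ge_2 _ Hp). nia.
  - right. exists (Z.to_nat x). pose proof (prime_ge_2 _ Hp). nia.
Qed.

Lemma isprime_divide_prime p q : isprime p = true -> isprime q = true ->
  Nat.divide p q -> p = q.
Proof.
  intros Hp%isprime_prime Hq%isprime_prime [c Hc].
  assert (H : (Z.of_nat p | Z.of_nat q)%Z) by (exists (Z.of_nat c); lia).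
  apply prime_div_prime in H; [lia|easy..].
Qed.

Lemma pow_gt_exponent p k : (2 <= p)%nat -> (k < p ^ k)%nat.
Proof. intros Hp. apply Nat.pow_gt_lin_r. lia. Qed.

Lemma pow_ge_base p k : (2 <= p)%nat -> (1 <= k)%nat -> (p <= p ^ k)%nat.
Proof.
  intros Hp Hk. rewrite <- (Nat.pow_1_r p) at 1. apply Nat.pow_le_mono_r; lia.
Qed.

(** The ranges of [p] and [k] in [vonMangoldt n] depend on [n]. Since [p^k] exceeds both [p - 1] and
    [k], a square of common side [B] adds only zero terms, and sums over [n], [p], [k] can then be
    exchanged. *)
Lemma vonMangoldt_rsum B n : (1 <= n)%nat -> (n < B)%nat ->
  vonMangoldt n = rsum (fun p => rsum (fun k =>
    if (isprime p && Nat.eqb (p ^ k) n)%bool then ln (INR p) else 0) B) B.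
Proof.
  intros Hn HB. unfold vonMangoldt. rewrite sumR_seq2.
  set (g := fun p k => if (isprime p && Nat.eqb (p ^ k) n)%bool then ln (INR p) else 0).
  assert (Hk : forall p, rsum (g p) B = rsum (g p) n).
  { intros p. apply rsum_extend; [lia|]. intros k Hk. unfold g.
    destruct (isprime p) eqn:Hp; [|easy]. apply isprime_ge2 in Hp.
    pose proof (pow_gt_exponent p k Hp).
    replace (Nat.eqb (p ^ k) n) with false by (symmetry; apply Nat.eqb_neq; lia). easy. }
  transitivity (rsum (fun p => rsum (g p) n) (S n)).
  - rewrite rsum_shift. rewrite (rsum_zero (g 1%nat)).
    + rewrite Rplus_0_l. apply rsum_ext. intros p Hp. rewrite sumR_seq1. easy.
    + intros k Hk'. unfold g. replace (isprime 1) with false; [easy|].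
      destruct (isprime 1) eqn:H1; [apply isprime_ge2 in H1; lia|easy].
  - rewrite <- (rsum_extend _ (S n) B); [apply rsum_ext; intros; symmetry; apply Hk|lia|].
    intros p Hp. apply rsum_zero. intros k Hk'. unfold g.
    destruct (isprime p) eqn:Hpp; [|easy]. apply isprime_ge2 in Hpp.
    pose proof (pow_ge_base p k Hpp).
    replace (Nat.eqb (p ^ k) n) with false by (symmetry; apply Nat.eqb_neq; lia). easy.
Qed.

Definition dvdb (d n : nat) : bool := Nat.eqb (n mod d) 0.

Lemma dvdb_divide d n : (1 <= d)%nat -> dvdb d n = true <-> Nat.divide d n.
Proof.
  intros Hd. unfold dvdb. rewrite Nat.eqb_eq. apply Nat.Lcm0.mod_divide.
Qed.

(** For [1 <= n < B] each prime [p] contributes [ln p] once for every [k] up to its multiplicity in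
    [n]: this is the logarithm of the prime factorization, written without naming multiplicities. *)
Definition ln_prime_powers (B n : nat) : R :=
  rsum (fun p => rsum (fun k =>
    if (isprime p && dvdb (p ^ k) n)%bool then ln (INR p) else 0) B) B.

Lemma dvdb_ext d n d' n' : (1 <= d)%nat -> (1 <= d')%nat ->
  (Nat.divide d n <-> Nat.divide d' n') -> dvdb d n = dvdb d' n'.
Proof.
  intros Hd Hd' H. rewrite <- !dvdb_divide in H by assumption.
  destruct (dvdb d n), (dvdb d' n'); try easy; destruct H as [H1 H2];
    [symmetry|]; auto.
Qed.

(** Induction on [k]: Euclid's lemma puts one factor [p] into [m], because [p] cannot divide the
    other prime [q], and that factor is cancelled. *)
Lemma prime_pow_divide_mul p q k m : isprime p = true -> isprime q = true -> p <> q ->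
  Nat.divide (p ^ k) (q * m) -> Nat.divide (p ^ k) m.
Proof.
  intros Hp Hq Hne H.
  revert m H. induction k as [|k IH]; intros m H; [exists m; simpl; lia|].
  assert (Hd : Nat.divide p (q * m)).
  { eapply Nat.divide_trans; [|exact H]. exists (p ^ k)%nat. simpl; lia. }
  apply isprime_divide_mul in Hd; [|easy].
  destruct Hd as [Hd|[c Hc]].
  - exfalso. apply Hne. apply isprime_divide_prime; easy.
  - subst m. destruct H as [e He].
    destruct (IH c) as [f Hf].
    + exists e. simpl in He. apply isprime_ge2 in Hp. nia.
    + exists f. subst c. simpl. lia.
Qed.

(** For the prime [q] the exponents shift by one, since [q^(k+1)] divides [q m] exactly when [q^k]
    divides [m]; the new exponent [1] supplies [ln q]. For other primes nothing changes. *)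
Lemma ln_prime_powers_mul B q m : isprime q = true -> (1 <= m)%nat -> (q * m < B)%nat ->
  ln_prime_powers B (q * m) = ln (INR q) + ln_prime_powers B m.
Proof.
  intros Hq Hm HB. pose proof (isprime_ge2 _ Hq) as Hq2.
  set (h := fun p => if Nat.eqb p q then ln (INR q) else 0).
  assert (Hh : rsum h B = ln (INR q)).
  { rewrite (rsum_single h B q); unfold h.
    - now rewrite Nat.eqb_refl.
    - nia.
    - intros n _ Hn. apply Nat.eqb_neq in Hn. now rewrite Hn. }
  rewrite <- Hh. unfold ln_prime_powers. rewrite <- rsum_plus.
  apply rsum_ext. intros p Hp. unfold h.
  destruct (isprime p) eqn:Hpp; simpl.
  2:{ destruct (Nat.eqb_spec p q); [congruence|]. lra. }
  pose proof (isprime_ge2 _ Hpp).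
  destruct (Nat.eqb_spec p q) as [->|Hne].
  - destruct B as [|B]; [lia|].
    rewrite rsum_shift. replace (dvdb (q ^ 1) (q * m)) with true.
    2:{ symmetry. apply dvdb_divide; [simpl; lia|]. exists m. simpl. lia. }
    f_equal. simpl (rsum _ (S B)).
    (* The shift leaves one surplus exponent at the top of the range; that power of [q] exceeds [m]
       and cannot divide it. *)
    replace (dvdb (q * q ^ B) m) with false.
    2:{ symmetry. apply Bool.not_true_is_false. intros H'.
        pose proof (pow_gt_exponent q (S B) Hq2) as Hgt. simpl in Hgt.
        apply dvdb_divide in H'; [|lia]. apply Nat.divide_pos_le in H'; [|lia]. nia. }
    rewrite Rplus_0_r. apply rsum_ext. intros k Hk.
    rewrite (dvdb_ext (q ^ S k) (q * m) (q ^ k) m); [easy| | |].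
    + apply Nat.neq_0_lt_0, Nat.pow_nonzero; lia.
    + apply Nat.neq_0_lt_0, Nat.pow_nonzero; lia.
    + simpl. apply Nat.mul_divide_cancel_l. lia.
  - rewrite Rplus_0_l. apply rsum_ext. intros k Hk.
    assert (1 <= p ^ k)%nat by (apply Nat.neq_0_lt_0, Nat.pow_nonzero; lia).
    rewrite (dvdb_ext (p ^ k) (q * m) (p ^ k) m); [easy..|].
    split; [apply prime_pow_divide_mul; easy|].
    intros Hd. apply Nat.divide_mul_r. easy.
Qed.

Lemma exists_prime_divisor n : (2 <= n)%nat -> exists q m, isprime q = true /\ n = (q * m)%nat.
Proof.
  induction n as [n IH] using (well_founded_induction lt_wf). intros Hn.
  destruct (isprime n) eqn:Hp; [exists n, 1%nat; split; [easy|lia]|].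
  assert (Hnp : ~ prime (Z.of_nat n)) by (rewrite <- isprime_prime, Hp; easy).
  apply not_prime_divide in Hnp; [|lia].
  destruct Hnp as (d & Hd & [e He]).
  destruct (IH (Z.to_nat d)) as (q & m & Hq & Hm); [lia|lia|].
  exists q, (m * Z.to_nat e)%nat. split; [easy|].
  assert (0 < e)%Z by nia. nia.
Qed.

Lemma ln_prime_powers_eq B n : (1 <= n < B)%nat -> ln_prime_powers B n = ln (INR n).
Proof.
  induction n as [n IH] using (well_founded_induction lt_wf). intros Hn.
  destruct (Nat.eq_dec n 1) as [->|Hn1].
  - simpl INR. rewrite ln_1. apply rsum_zero. intros p Hp. apply rsum_zero. intros k Hk.
    destruct (isprime p) eqn:Hpp; [|easy]. apply isprime_ge2 in Hpp.
    replace (dvdb (p ^ k) 1) with false; [easy|].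
    symmetry. apply Bool.not_true_is_false. intros H'.
    pose proof (pow_ge_base p k Hpp).
    apply dvdb_divide in H'; [|lia]. apply Nat.divide_pos_le in H'; lia.
  - destruct (exists_prime_divisor n) as (q & m & Hq & ->); [lia|].
    pose proof (isprime_ge2 _ Hq).
    assert (1 <= m)%nat by nia.
    rewrite ln_prime_powers_mul by (try easy; lia).
    rewrite IH by nia. rewrite mult_INR, ln_mult; [easy| |]; apply lt_0_INR; lia.
Qed.

(** After the sums are exchanged, each pair [(p, k)] meets the single divisor [d = p^k], so what is
    counted is the prime powers dividing [n]. Powers beyond [N] are too large to divide [n]. *)
Lemma sum_divisors_vonMangoldt N n : (1 <= n <= N)%nat ->
  rsum (fun d => if dvdb d n then vonMangoldt d else 0) N = ln (INR n).
Proof.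
  intros Hn. rewrite <- (ln_prime_powers_eq (S N) n) by lia.
  transitivity (rsum (fun d => rsum (fun p => rsum (fun k =>
    if (dvdb d n && (isprime p && Nat.eqb (p ^ k) d))%bool then ln (INR p) else 0) (S N)) (S N)) N).
  { apply rsum_ext. intros d Hd. rewrite (vonMangoldt_rsum (S N) d) by lia.
    destruct (dvdb d n); [easy|]. symmetry. apply rsum_zero; intros; apply rsum_zero; easy. }
  rewrite rsum_swap. apply rsum_ext. intros p Hp.
  rewrite rsum_swap. apply rsum_ext. intros k Hk.
  destruct (isprime p) eqn:Hpp; simpl.
  2:{ apply rsum_zero. intros. now rewrite Bool.andb_false_r. }
  pose proof (isprime_ge2 _ Hpp) as Hp2.
  pose proof (pow_gt_exponent p k Hp2).
  destruct (le_lt_dec (p ^ k) N) as [Hle|Hlt].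
  - rewrite (rsum_single _ N (p ^ k)); [|lia|].
    + now rewrite Nat.eqb_refl, Bool.andb_true_r.
    + intros m _ Hm. replace (Nat.eqb (p ^ k) m) with false by (symmetry; apply Nat.eqb_neq; lia).
      now rewrite Bool.andb_false_r.
  - rewrite rsum_zero.
    + replace (dvdb (p ^ k) n) with false; [easy|].
      symmetry. apply Bool.not_true_is_false. intros H'.
      apply dvdb_divide in H'; [|lia]. apply Nat.divide_pos_le in H'; lia.
    + intros m Hm. replace (Nat.eqb (p ^ k) m) with false by (symmetry; apply Nat.eqb_neq; lia).
      now rewrite Bool.andb_false_r.
Qed.

Lemma vonMangoldt_ge0 n : 0 <= vonMangoldt n.
Proof.
  unfold vonMangoldt. rewrite sumR_seq2. apply rsum_ge0. intros p Hp.
  rewrite sumR_seq1. apply rsum_ge0. intros k Hk.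
  destruct (isprime (S p) && _)%bool; [|lra].
  rewrite <- ln_1. apply ln_le; [lra|]. change 1 with (INR 1). apply le_INR. lia.
Qed.

Lemma vonMangoldt_le_ln n : (1 <= n)%nat -> vonMangoldt n <= ln (INR n).
Proof.
  intros Hn. rewrite <- (sum_divisors_vonMangoldt n n) by lia.
  set (f := fun d => if dvdb d n then vonMangoldt d else 0).
  replace (vonMangoldt n) with (f n).
  - apply rsum_term_le; [lia|]. intros d _. unfold f. destruct (dvdb d n); [apply vonMangoldt_ge0|lra].
  - unfold f. replace (dvdb n n) with true; [easy|]. symmetry. apply dvdb_divide; [lia|apply Nat.divide_refl].
Qed.

Lemma psi_rsum n : psi n = rsum vonMangoldt n.
Proof. apply sumR_seq1. Qed.

(** * From the recursion to a bound on psi(n) - n *)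

Lemma exp_le_compat x y : x <= y -> exp x <= exp y.
Proof. intros [H| ->]; [left; now apply exp_increasing|lra]. Qed.

Lemma isprime_2 : isprime 2 = true.
Proof. apply isprime_prime. exact prime_2. Qed.

Lemma prime_pi_pos m : (2 <= m)%nat -> (1 <= prime_pi m)%nat.
Proof.
  intros Hm. unfold prime_pi.
  assert (H : In 2%nat (filter isprime (seq 0 (S m)))).
  { apply filter_In. split; [apply in_seq; lia|exact isprime_2]. }
  destruct (filter isprime (seq 0 (S m))); [easy|simpl; lia].
Qed.

Lemma prevprime_prime n : (3 <= n)%nat -> isprime (prevprime n) = true.
Proof.
  induction n as [|n IH]; intros Hn; [lia|]. simpl.
  destruct (isprime n) eqn:Hp; [easy|].
  apply IH. destruct (Nat.eq_dec n 2) as [->|]; [|lia].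
  rewrite isprime_2 in Hp; easy.
Qed.

Lemma traj_S y j : traj y (S j) = Mmap (traj y j).
Proof. reflexivity. Qed.

(* Once a trajectory reaches a prime it never leaves the primes, and before that it
   strictly increases. *)
Lemma traj_prime_or_large y j : (2 <= y)%nat ->
  isprime (traj y j) = true \/ (j + 2 <= traj y j)%nat.
Proof.
  intros Hy. induction j as [|j IH]; [right; simpl; lia|].
  rewrite traj_S. unfold Mmap.
  destruct (isprime (traj y j)) eqn:Hp.
  - left. destruct (Nat.leb_spec 3 (traj y j)); [now apply prevprime_prime|easy].
  - destruct IH as [IH|IH]; [easy|].
    replace (Nat.leb 2 (traj y j)) with true by (symmetry; apply Nat.leb_le; lia).
    pose proof (prime_pi_pos (traj y j) ltac:(lia)).
    right. lia.
Qed.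

Definition max_Epsi (M : nat) : R := rsum (fun n => Rabs (Epsi n)) M.

Lemma Epsi_le_max M n : (1 <= n <= M)%nat -> Rabs (Epsi n) <= max_Epsi M.
Proof.
  intros Hn. apply (rsum_term_le (fun n => Rabs (Epsi n))); [easy|].
  intros; apply Rabs_pos.
Qed.

(** The bound does not involve [J]: a composite value at step [j] is at least [j + 2], so inside a
    window below [M] only indices [j < M] contribute, and prime values contribute zero. *)
Lemma seg_sum_bound X y J M : (2 <= y)%nat -> exit_index X y J ->
  (1 + 2 / ln X) * X <= INR M -> Rabs (seg_sum y J) <= INR M * max_Epsi M.
Proof.
  intros Hy [HJ _] HM. unfold seg_sum.
  set (g := fun j => if isprime (traj y j) then 0
     else if Nat.leb 2 (traj y j) then Epsi (traj y j) else 0).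
  assert (HE : 0 <= max_Epsi M) by (apply rsum_ge0; intros; apply Rabs_pos).
  assert (Hb : forall j, (j < J)%nat -> Rabs (g j) <= if Nat.ltb j M then max_Epsi M else 0).
  { intros j Hj. unfold g. specialize (HJ j Hj). destruct HJ as [_ HJ].
    assert (HjM : (traj y j <= M)%nat) by (apply INR_le; lra).
    destruct (isprime (traj y j)) eqn:Hp.
    - rewrite Rabs_R0. destruct (Nat.ltb j M); lra.
    - destruct (traj_prime_or_large y j Hy) as [H|H]; [congruence|].
      replace (Nat.leb 2 (traj y j)) with true by (symmetry; apply Nat.leb_le; lia).
      replace (Nat.ltb j M) with true by (symmetry; apply Nat.ltb_lt; lia).
      apply Epsi_le_max. lia. }
  assert (Hind : forall n, (n <= J)%nat ->
    Rabs (sumR g (seq 0 n)) <= INR (Nat.min n M) * max_Epsi M).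
  { induction n as [|n IH]; intros Hn.
    - simpl. rewrite Rabs_R0. unfold INR; simpl. lra.
    - rewrite seq_S, sumR_app. replace (sumR g ((0 + n)%nat :: nil)) with (g n) by (unfold sumR; simpl; lra).
      eapply Rle_trans; [apply Rabs_triang|].
      specialize (IH ltac:(lia)). specialize (Hb n ltac:(lia)).
      destruct (Nat.ltb_spec n M).
      + replace (Nat.min (S n) M) with (S n) by lia.
        replace (Nat.min n M) with n in IH by lia.
        rewrite S_INR. lra.
      + replace (Nat.min (S n) M) with M by lia.
        replace (Nat.min n M) with M in IH by lia. lra. }
  eapply Rle_trans; [apply (Hind J); lia|].
  apply Rmult_le_compat_r; [easy|]. apply le_INR. lia.
Qed.

(** Finiteness is what starts the iteration: a supremum equal to [p_infty] at every scale would be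
    compatible with the recursion. *)
Lemma Etilde_bounded X M : (1 + 2 / ln X) * X <= INR M ->
  Rbar_le (Etilde X) (INR M * max_Epsi M).
Proof.
  intros HM. unfold Etilde.
  destruct (Lub_Rbar_correct (fun r => exists y : nat, composite y /\ inWt X y /\
             exists J : nat, exit_index X y J /\ r = Rabs (seg_sum y J))) as [_ H].
  apply H. intros r (y & Hy & _ & J & HJ & ->). simpl.
  eapply seg_sum_bound; eauto. apply Hy.
Qed.

(* The window whose right end is exactly [y] is left by [y] after one step. *)
Lemma Epsi_le_Etilde y : composite y -> (16 <= ln (INR y)) ->
  exists X, INR y / 2 <= X <= INR y /\ Rbar_le (Rabs (Epsi y)) (Etilde X).
Proof.
  intros [Hy2 Hyp] Hln.
  assert (Hy0 : 0 < INR y) by (apply lt_0_INR; lia).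
  assert (Hln2 : ln 2 < 1).
  { rewrite <- (ln_exp 1). apply ln_increasing; [lra|]. pose proof (exp_ineq1 1 ltac:(lra)). lra. }
  assert (Hlow : forall x, INR y / 2 <= x -> 15 <= ln x).
  { intros x Hx. apply Rle_trans with (ln (INR y / 2)).
    - unfold Rdiv. rewrite ln_mult by lra. rewrite ln_Rinv by lra. lra.
    - apply ln_le; lra. }
  (* Intermediate values: on [[y/2, y]] the logarithm is at least [15], so the right end of the
     window is at most [y] for [x = y/2] and at least [y] for [x = y]. *)
  destruct (Ranalysis5.f_interv_is_interv (fun x => (1 + 2 / ln x) * x) (INR y / 2) (INR y) (INR y))
    as (X & HX & HXe); [lra| | |].
  - pose proof (Hlow (INR y / 2) ltac:(lra)) as H1. split.
    + assert (2 / ln (INR y / 2) <= 1) by (apply Rle_div_l; lra). nra.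
    + assert (0 <= 2 / ln (INR y)) by (apply Rdiv_le_0_compat; lra). nra.
  - intros x Hx. pose proof (Hlow x ltac:(lra)) as H1.
    apply derivable_continuous_pt. exists ((1 + 2 / ln x) + (- 2 / (x * (ln x)^2)) * x).
    apply is_derive_Reals. auto_derive; [split; [lra|split; [lra|easy]]|]. field. lra.
  - exists X. split; [lra|].
    pose proof (Hlow X ltac:(lra)) as H1.
    unfold Etilde.
    set (E := fun r => exists y : nat, composite y /\ inWt X y /\
             exists J : nat, exit_index X y J /\ r = Rabs (seg_sum y J)).
    destruct (Lub_Rbar_correct E) as [H _]. apply H.
    exists y. split; [split; easy|]. split; [unfold inWt; lra|].
    exists 1%nat. split.
    + split.
      * intros j Hj. replace j with 0%nat by lia. unfold inWt. simpl. lra.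
      * unfold inWt. simpl traj. unfold traj; simpl. unfold Mmap.
        rewrite Hyp. replace (Nat.leb 2 y) with true by (symmetry; apply Nat.leb_le; lia).
        rewrite plus_INR. pose proof (prime_pi_pos y Hy2) as Hpi.
        apply le_INR in Hpi. simpl in Hpi. lra.
    + unfold seg_sum, sumR. cbn [seq fold_right]. change (traj y 0) with y. rewrite Hyp.
      replace (Nat.leb 2 y) with true by (symmetry; apply Nat.leb_le; lia).
      f_equal. ring.
Qed.

Definition Etilde_recursion (C X0 : R) : Prop :=
  forall X : R, X0 <= X ->
     Rbar_le (Etilde X)
       (Rbar_plus (Rbar_mult (Finite (5 / 6)) (Etilde (Rpower X (3 / 4))))
                  (Finite (C * sqrt X * ln X))).

(** The logarithm of [X^(3/4)] brings a factor [3/4], so the recursion multiplies [K] by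
    [5/6 * 3/4 = 5/8]. The remaining [3/8 * K] absorbs the error term because [4 * C <= K]. *)
Lemma Etilde_recursion_step (C K X : R) : 0 < C -> 4 * C <= K -> 1 <= X ->
  Rbar_le (Etilde (Rpower X (3/4)))
          (K * sqrt (Rpower X (3/4)) * ln (Rpower X (3/4))) ->
  Rbar_le (Etilde X) (Rbar_plus (Rbar_mult (Finite (5 / 6)) (Etilde (Rpower X (3 / 4))))
                  (Finite (C * sqrt X * ln X))) ->
  Rbar_le (Etilde X) (K * sqrt X * ln X).
Proof.
  intros HC HK HX H1 H2.
  assert (Hln : 0 <= ln X) by (rewrite <- ln_1; apply ln_le; lra).
  assert (Hl : ln (Rpower X (3/4)) = 3/4 * ln X) by (unfold Rpower; apply ln_exp).
  assert (Hs : sqrt (Rpower X (3/4)) <= sqrt X).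
  { apply sqrt_le_1_alt. rewrite <- (Rpower_1 X) at 2 by lra.
    unfold Rpower. apply exp_le_compat. nra. }
  assert (Hs0 : 0 <= sqrt (Rpower X (3/4))) by apply sqrt_pos.
  rewrite Hl in H1.
  assert (Hmain : K * sqrt (Rpower X (3/4)) * (3/4 * ln X) * (5/6) + C * sqrt X * ln X
            <= K * sqrt X * ln X).
  { assert (sqrt (Rpower X (3/4)) * ln X <= sqrt X * ln X) by (apply Rmult_le_compat_r; easy).
    assert (0 <= sqrt (Rpower X (3/4)) * ln X) by (apply Rmult_le_pos; easy).
    set (p := sqrt (Rpower X (3/4)) * ln X) in *. set (q := sqrt X * ln X) in *.
    replace (K * sqrt (Rpower X (3 / 4)) * (3 / 4 * ln X) * (5 / 6)) with (K * p * (5/8)) by (unfold p; field).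
    replace (C * sqrt X * ln X) with (C * q) by (unfold q; ring).
    replace (K * sqrt X * ln X) with (K * q) by (unfold q; ring).
    assert (K * p <= K * q) by (apply Rmult_le_compat_l; lra).
    assert (4 * C * q <= K * q) by (apply Rmult_le_compat_r; lra).
    assert (0 <= C * q) by (apply Rmult_le_pos; lra).
    lra. }
  eapply Rbar_le_trans; [exact H2|].
  destruct (Etilde (Rpower X (3/4))) as [e| |]; simpl in H1.
  - simpl. lra.
  - easy.
  (* [m_infty] is the supremum over an empty set of starting points; the positive factor [5/6]
     preserves it. *)
  - unfold Rbar_mult, Rbar_mult'. destruct (Rle_dec 0 (5/6)) as [h|h]; [|lra].
    destruct (Rle_lt_or_eq_dec 0 (5/6) h); [|lra]. simpl. easy.
Qed.

(** One use of the recursion multiplies [ln X] by [3/4]. The induction therefore runs over [k] with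
    [ln X <= (4/3)^k * ln A]; the base range [A <= X <= A^(4/3)] is covered by the crude bound, and
    above it [X^(3/4)] is still at least [A]. *)
Lemma Etilde_growth (C X0 : R) : 0 < C ->
  Etilde_recursion C X0 ->
  exists K A, 0 < K /\ 1 <= A /\ forall X, A <= X -> Rbar_le (Etilde X) (K * sqrt X * ln X).
Proof.
  intros HC H.
  set (A := Rmax X0 (exp 2)).
  assert (HA0 : X0 <= A) by apply Rmax_l.
  assert (HA2 : exp 2 <= A) by apply Rmax_r.
  assert (He2 : 3 <= exp 2) by (pose proof (exp_ineq1_le 2); lra).
  assert (HlA : 2 <= ln A) by (rewrite <- (ln_exp 2) at 1; apply ln_le; lra).
  (* For [X >= A] one has [2 / ln X <= 1], so every window of the base range ends below
     [2 * A^(4/3)], hence below [M]. *)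
  destruct (nfloor_ex (2 * Rpower A (4/3))) as [M0 [_ HM0]].
  { apply Rmult_le_pos; [lra|]. left; apply exp_pos. }
  set (M := S M0). assert (HM : 2 * Rpower A (4/3) <= INR M) by (unfold M; rewrite S_INR; lra).
  assert (HE : 0 <= max_Epsi M) by (apply rsum_ge0; intros; apply Rabs_pos).
  set (K := INR M * max_Epsi M + 4 * C).
  assert (HM1 : 0 <= INR M * max_Epsi M) by (apply Rmult_le_pos; [apply pos_INR|easy]).
  exists K, A. split; [unfold K; lra|]. split; [lra|].
  assert (HKz : forall z, 1 <= z -> INR M * max_Epsi M <= K * z).
  { intros z Hz. unfold K.
    pose proof (Rmult_le_compat_l _ 1 z HM1 Hz). assert (0 <= C * z) by (apply Rmult_le_pos; lra).
    rewrite Rmult_plus_distr_r. lra. }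
  assert (Hbase : forall X, A <= X -> ln X <= 4/3 * ln A -> Rbar_le (Etilde X) (K * sqrt X * ln X)).
  { intros X HX Hs.
    assert (HlX : 2 <= ln X) by (apply Rle_trans with (ln A); [easy|apply ln_le; lra]).
    apply Rbar_le_trans with (INR M * max_Epsi M).
    - apply Etilde_bounded. eapply Rle_trans; [|exact HM].
      assert (2 / ln X <= 1) by (apply Rle_div_l; lra).
      assert (X <= Rpower A (4/3)).
      { unfold Rpower. rewrite <- (exp_ln X) at 1 by lra. apply exp_le_compat. lra. }
      nra.
    - simpl. assert (1 <= sqrt X) by (rewrite <- sqrt_1; apply sqrt_le_1_alt; lra).
      rewrite Rmult_assoc. apply HKz. nra. }
  assert (Hind : forall k X, A <= X -> ln X <= (4/3)^k * ln A ->
    Rbar_le (Etilde X) (K * sqrt X * ln X)).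
  { induction k as [|k IH]; intros X HX Hk; [apply Hbase; [easy|simpl in Hk; lra]|].
    destruct (Rle_dec (ln X) (4/3 * ln A)) as [Hs|Hs]; [now apply Hbase|].
    apply (Etilde_recursion_step C); [easy|unfold K; lra| | |apply H; lra].
      { lra. }
      apply IH.
      + unfold Rpower. rewrite <- (exp_ln A) at 1 by lra. apply exp_le_compat. lra.
      + unfold Rpower. rewrite ln_exp. simpl in Hk. lra. }
  intros X HX.
  assert (HlX : 2 <= ln X) by (apply Rle_trans with (ln A); [easy|apply ln_le; lra]).
  (* Bernoulli's inequality for [(1 + 1/3)^(k+1)] turns [k + 1 > 3 * ln X] into
     [ln X <= (4/3)^(k+1)]. *)
  destruct (nfloor_ex (3 * ln X)) as [k [_ Hk]]; [lra|].
  apply (Hind (S k)); [easy|].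
  pose proof (poly (S k) (1/3) ltac:(lra)) as Hp.
  rewrite S_INR in Hp. replace (1 + 1/3) with (4/3) in Hp by lra.
  assert (ln X <= (4/3)^(S k)) by lra.
  assert (0 <= (4/3)^(S k)) by (apply pow_le; lra). nra.
Qed.

Lemma even_not_isprime n : (2 < n)%nat -> Nat.even n = true -> isprime n = false.
Proof.
  intros Hn He. destruct (isprime n) eqn:Hp; [|easy].
  apply Nat.even_spec in He. destruct He as [m Hm].
  assert (2%nat = n) by (apply isprime_divide_prime; [apply isprime_2|easy|exists m; lia]). lia.
Qed.

Lemma psi_S n : psi (S n) = psi n + vonMangoldt (S n).
Proof. rewrite !psi_rsum. reflexivity. Qed.

Lemma ln_le_Rpower e x : 0 < e -> 0 < x -> ln x <= / e * Rpower x e.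
Proof.
  intros He Hx. unfold Rpower. pose proof (exp_ineq1_le (e * ln x)).
  apply Rmult_le_reg_l with e; [easy|]. rewrite <- Rmult_assoc, Rinv_r, Rmult_1_l by lra. lra.
Qed.

Definition Epsi_bounded (K theta : R) : Prop :=
  forall n, (1 <= n)%nat -> Rabs (Epsi n) <= K * Rpower (INR n) theta.

(** The windows control composite arguments only. A large prime [n] is odd, so [n - 1] is even and
    composite, and [Epsi] changes by at most [ln n + 1] from [n - 1] to [n]. *)
Lemma Epsi_bound (C X0 theta : R) : 0 < C ->
  Etilde_recursion C X0 ->
  1/2 < theta ->
  exists K, Epsi_bounded K theta.
Proof.
  intros HC H Ht.
  destruct (Etilde_growth C X0 HC H) as (K & A & HK & HA & HKA).
  assert (Hcomp : forall y, composite y -> 16 <= ln (INR y) -> 2 * A <= INR y ->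
     Rabs (Epsi y) <= K * sqrt (INR y) * ln (INR y)).
  { intros y Hy Hl Hy2. destruct (Epsi_le_Etilde y Hy Hl) as (X & HX & HE).
    assert (HX1 : Rbar_le (Rabs (Epsi y)) (K * sqrt X * ln X)).
    { eapply Rbar_le_trans; [exact HE|]. apply HKA. lra. }
    simpl in HX1. eapply Rle_trans; [exact HX1|].
    assert (sqrt X <= sqrt (INR y)) by (apply sqrt_le_1_alt; lra).
    assert (ln X <= ln (INR y)) by (apply ln_le; lra).
    assert (0 <= ln X) by (rewrite <- ln_1; apply ln_le; lra).
    pose proof (sqrt_pos X).
    rewrite !Rmult_assoc. apply Rmult_le_compat_l; [lra|]. apply Rmult_le_compat; lra. }
  set (e := theta - 1/2). assert (He : 0 < e) by (unfold e; lra).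
  destruct (nfloor_ex (exp 16 + 2 * A + 4)) as [M [_ HM]].
  { pose proof (exp_pos 16). lra. }
  assert (HE : 0 <= max_Epsi (S M)) by (apply rsum_ge0; intros; apply Rabs_pos).
  (* The four summands pay for small [n], for the composite bound (where [ln n <= n^e / e] absorbs
     the logarithm), and for the jump [ln n + 1] at a prime. *)
  set (K' := max_Epsi (S M) + K * / e + / e + 1).
  assert (Hie : 0 < / e) by (apply Rinv_0_lt_compat; easy).
  assert (HKe : 0 < K * / e) by (apply Rmult_lt_0_compat; easy).
  exists K'.
  intros n Hn.
  assert (Hn1 : 1 <= INR n) by (apply INR_ge1; lia).
  assert (HP1 : 1 <= Rpower (INR n) theta).
  { rewrite <- (Rpower_O (INR n)) by lra. apply Rle_Rpower; lra. }
  destruct (le_lt_dec n (S M)) as [Hle|Hlt].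
  - apply Rle_trans with (max_Epsi (S M)); [apply Epsi_le_max; lia|].
    unfold K'. nra.
  - assert (Hnb : exp 16 + 2 * A + 5 <= INR n).
    { apply Rle_trans with (INR (S (S M))); [rewrite !S_INR; lra|apply le_INR; lia]. }
    assert (Hlnn : ln (INR n) <= / e * Rpower (INR n) e) by (apply ln_le_Rpower; lra).
    assert (Hpw : sqrt (INR n) * Rpower (INR n) e = Rpower (INR n) theta).
    { rewrite <- Rpower_sqrt by lra. rewrite <- Rpower_plus. f_equal. unfold e. field. }
    assert (Hbig : forall y, composite y -> (y <= n)%nat -> (n <= S y)%nat ->
       Rabs (Epsi y) <= K * / e * Rpower (INR n) theta).
    { intros y Hy Hyn Hny. assert (HyR : INR y <= INR n) by (apply le_INR; easy).
      assert (HnyR : INR n <= INR y + 1) by (rewrite <- S_INR; apply le_INR; easy).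
      pose proof (exp_pos 16) as Hp16.
      assert (16 <= ln (INR y)) by (rewrite <- (ln_exp 16); apply ln_le; lra).
      eapply Rle_trans; [apply Hcomp; try easy; lra|].
      rewrite <- Hpw.
      assert (sqrt (INR y) <= sqrt (INR n)) by (apply sqrt_le_1_alt; lra).
      assert (ln (INR y) <= ln (INR n)) by (apply ln_le; lra).
      pose proof (sqrt_pos (INR y)).
      replace (K * / e * (sqrt (INR n) * Rpower (INR n) e))
        with (K * (sqrt (INR n) * (/ e * Rpower (INR n) e))) by ring.
      rewrite Rmult_assoc. apply Rmult_le_compat_l; [lra|]. apply Rmult_le_compat; lra. }
    assert (Hn4 : (4 < n)%nat).
    { apply INR_lt. pose proof (exp_pos 16). simpl. lra. }
    assert (HPe : 0 < Rpower (INR n) e) by apply exp_pos.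
    destruct (isprime n) eqn:Hp.
    + destruct n as [|m]; [lia|].
      (* If [m] were odd, [S m] would be even and larger than [2], contradicting its primality. *)
      assert (Hm : composite m).
      { split; [lia|]. apply even_not_isprime; [lia|].
        destruct (Nat.even m) eqn:Ev; [easy|].
        rewrite (even_not_isprime (S m)) in Hp; [easy|lia|].
        rewrite Nat.even_succ. rewrite <- Nat.negb_even, Ev. easy. }
      pose proof (Hbig m Hm ltac:(lia) ltac:(lia)) as Hb.
      pose proof (vonMangoldt_ge0 (S m)) as Hv0.
      pose proof (vonMangoldt_le_ln (S m) ltac:(lia)) as Hv1.
      assert (HPe2 : Rpower (INR (S m)) e <= Rpower (INR (S m)) theta).
      { apply Rle_Rpower; [lra|unfold e; lra]. }
      assert (Hx : Rabs (Epsi (S m)) <= Rabs (Epsi m) + ln (INR (S m)) + 1).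
      { unfold Epsi. rewrite psi_S. assert (HS1 : INR (S m) = INR m + 1) by apply S_INR.
        set (S1 := INR (S m)) in *.
        replace (psi m + vonMangoldt (S m) - S1) with ((psi m - INR m) + (vonMangoldt (S m) - 1))
          by (rewrite HS1; ring).
        eapply Rle_trans; [apply Rabs_triang|].
        assert (Rabs (vonMangoldt (S m) - 1) <= ln S1 + 1); [|lra].
        apply Rabs_le. split; lra. }
      assert (/ e * Rpower (INR (S m)) e <= / e * Rpower (INR (S m)) theta)
        by (apply Rmult_le_compat_l; lra).
      unfold K'. rewrite !Rmult_plus_distr_r.
      assert (0 <= max_Epsi (S M) * Rpower (INR (S m)) theta) by (apply Rmult_le_pos; lra).
      lra.
    + pose proof (Hbig n ltac:(split; [lia|easy]) ltac:(lia) ltac:(lia)).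
      unfold K'. rewrite !Rmult_plus_distr_r.
      assert (0 <= max_Epsi (S M) * Rpower (INR n) theta) by (apply Rmult_le_pos; lra).
      assert (0 <= / e * Rpower (INR n) theta) by (apply Rmult_le_pos; lra).
      lra.
Qed.

(** * Real power series *)

Lemma locally_Rabs_lt (r t : R) (P : R -> Prop) : Rabs t < r ->
  (forall y, Rabs y < r -> P y) -> locally t P.
Proof.
  intros Ht H. assert (Hp : 0 < r - Rabs t) by lra.
  exists (mkposreal _ Hp). intros y Hy. change R in y. apply H.
  unfold ball in Hy; simpl in Hy; unfold AbsRing_ball, abs, minus, plus, opp in Hy; simpl in Hy.
  pose proof (Rabs_triang (y + - t) t) as Htr. replace (y + - t + t) with y in Htr by ring. lra.
Qed.

Lemma MVT_is_derive (f df : R -> R) (a b : R) : a <= b ->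
  (forall t, a <= t <= b -> is_derive f t (df t)) ->
  exists c, a <= c <= b /\ f b - f a = df c * (b - a).
Proof.
  intros Hab H. destruct (MVT_gen f a b df) as (c & Hc & He).
  - intros y Hy. rewrite Rmin_left, Rmax_right in Hy by lra. apply H; lra.
  - intros y Hy. rewrite Rmin_left, Rmax_right in Hy by lra.
    apply derivable_continuous_pt. eexists. apply is_derive_Reals, H; lra.
  - rewrite Rmin_left, Rmax_right in Hc by lra. now exists c.
Qed.

Lemma Rpower_pos x e : 0 < Rpower x e.
Proof. apply exp_pos. Qed.

(** A single expansion at [0] must serve the whole interval, which is stronger than being locally a
    power series. This makes the identity principle a comparison of coefficients at [0]. *)
Definition analytic_on (r : R) (f : R -> R) : Prop :=
  exists a, Rbar_le r (CV_radius a) /\ forall t, Rabs t < r -> f t = PSeries a t.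

Lemma CV_radius_ge (a : nat -> R) (r : R) :
  (forall x, 0 < x < r -> exists M, forall n, Rabs (a n * x ^ n) <= M) ->
  Rbar_le r (CV_radius a).
Proof.
  intros H. destruct (Rbar_le_dec r (CV_radius a)) as [h|h]; [easy|exfalso].
  apply Rbar_not_le_lt in h.
  pose proof (CV_radius_ge_0 a) as H0.
  destruct (CV_radius_bounded a) as [Hub _].
  destruct (CV_radius a) as [c| |] eqn:Hc; simpl in h, H0; try easy.
  destruct (H ((c + r) / 2)) as [M HM]; [lra|].
  specialize (Hub ((c + r) / 2) (ex_intro _ M HM)). simpl in Hub. lra.
Qed.

Lemma PSeries_geom_bound (c : nat -> R) (B rho t : R) : Rabs t < rho ->
  (forall k, Rabs (c k) * rho ^ k <= B) ->
  ex_pseries c t /\ Rabs (PSeries c t) <= B * / (1 - Rabs t / rho).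
Proof.
  intros Ht Hc. pose proof (Rabs_pos t) as Ht0.
  assert (Hrho : 0 < rho) by lra.
  assert (Hq : Rabs (Rabs t / rho) < 1).
  { rewrite Rabs_pos_eq; [apply Rlt_div_l; lra|apply Rdiv_le_0_compat; lra]. }
  assert (Hterm : forall k, Rabs (c k * t ^ k) <= B * (Rabs t / rho) ^ k).
  { intros k. rewrite Rabs_mult, <- RPow_abs. unfold Rdiv. rewrite Rpow_mult_distr, pow_inv.
    replace (Rabs (c k) * Rabs t ^ k) with ((Rabs (c k) * rho ^ k) * (Rabs t ^ k * / rho ^ k)).
    - apply Rmult_le_compat_r; [|apply Hc].
      apply Rmult_le_pos; [apply pow_le; lra|]. left. apply Rinv_0_lt_compat, pow_lt; lra.
    - field. apply pow_nonzero; lra. }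
  assert (Hg : is_series (fun k => B * (Rabs t / rho) ^ k) (B * / (1 - Rabs t / rho)))
    by exact (is_series_scal_l B _ _ (is_series_geom _ Hq)).
  assert (Hex : ex_series (fun k => Rabs (c k * t ^ k))).
  { apply (ex_series_le (fun k => Rabs (c k * t ^ k)) (fun k => B * (Rabs t / rho) ^ k)).
    - intros k. unfold norm; simpl; unfold abs; simpl. rewrite Rabs_Rabsolu. apply Hterm.
    - eexists. exact Hg. }
  split.
  - apply ex_pseries_R. apply ex_series_Rabs. exact Hex.
  - unfold PSeries. eapply Rle_trans; [apply Series_Rabs; exact Hex|].
    rewrite <- (is_series_unique _ _ Hg). apply Series_le.
    + intros k. split; [apply Rabs_pos|apply Hterm].
    + eexists. exact Hg.
Qed.

Lemma ex_pseries_of_radius (a : nat -> R) (r t : R) : Rbar_le r (CV_radius a) -> Rabs t < r -> ex_pseries a t.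
Proof.
  intros H Ht. apply CV_radius_inside. eapply Rbar_lt_le_trans; [|exact H]. exact Ht.
Qed.

Lemma CV_radius_ge_ex_pseries (a : nat -> R) (r : R) :
  (forall x, Rabs x < r -> ex_pseries a x) -> Rbar_le r (CV_radius a).
Proof.
  intros H. apply CV_radius_ge. intros x Hx.
  assert (Hex : ex_pseries a x) by (apply H; rewrite Rabs_pos_eq; lra).
  apply ex_pseries_R in Hex. apply ex_series_lim_0 in Hex.
  destruct (filterlim_bounded (fun n => a n * x ^ n)) as [M HM].
  { exists 0. exact Hex. }
  exists M. exact HM.
Qed.

Lemma analytic_ext r f g : (forall t, Rabs t < r -> f t = g t) -> analytic_on r f -> analytic_on r g.
Proof. intros H (a & Ha & Hf). exists a. split; [easy|]. intros t Ht. rewrite <- H; auto. Qed.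

Lemma analytic_const r c : analytic_on r (fun _ => c).
Proof.
  exists (fun n => match n with O => c | _ => 0 end). split.
  - apply CV_radius_ge. intros x Hx. exists (Rabs c). intros [|n].
    + simpl. rewrite Rmult_1_r. lra.
    + rewrite Rmult_0_l, Rabs_R0. apply Rabs_pos.
  - intros t _. symmetry. apply is_pseries_unique. apply is_pseries_R.
    apply is_series_decr_1.
    match goal with |- is_series _ ?l => replace l with 0 by (unfold plus, opp; simpl; ring) end.
    apply is_series_ext with (fun _ => 0); [intros n; change (0 = 0 * t ^ S n); ring|].
    apply filterlim_ext with (fun _ => 0); [|apply filterlim_const].
    intros n. rewrite sum_n_const. ring.
Qed.

Lemma analytic_id r : analytic_on r (fun t => t).
Proof.
  destruct (analytic_const r 1) as (a & Ha & H1).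
  exists (PS_incr_1 a). split.
  - rewrite CV_radius_incr_1. easy.
  - intros t Ht. rewrite PSeries_incr_1, <- H1 by easy. ring.
Qed.

Lemma analytic_plus r f g : analytic_on r f -> analytic_on r g -> analytic_on r (fun t => f t + g t).
Proof.
  intros (a & Ha & Hf) (b & Hb & Hg). exists (PS_plus a b). split.
  - apply CV_radius_ge_ex_pseries. intros x Hx.
    apply ex_pseries_plus; eapply ex_pseries_of_radius; eauto.
  - intros t Ht. rewrite PSeries_plus, Hf, Hg by (eauto using ex_pseries_of_radius). easy.
Qed.

Lemma analytic_mult r f g : analytic_on r f -> analytic_on r g -> analytic_on r (fun t => f t * g t).
Proof.
  intros (a & Ha & Hf) (b & Hb & Hg).
  assert (H1 : forall c x, Rbar_le r (CV_radius c) -> Rabs x < r -> Rbar_lt (Rabs x) (CV_radius c)).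
  { intros c x Hc Hx. eapply Rbar_lt_le_trans; [|exact Hc]. exact Hx. }
  exists (PS_mult a b). split.
  - apply CV_radius_ge_ex_pseries. intros x Hx. apply ex_pseries_mult; auto.
  - intros t Ht. rewrite PSeries_mult, Hf, Hg by auto. easy.
Qed.

Lemma analytic_derive r f : analytic_on r f ->
  analytic_on r (Derive f) /\ forall t, Rabs t < r -> is_derive f t (Derive f t).
Proof.
  intros (a & Ha & Hf).
  assert (HD : forall t, Rabs t < r -> is_derive f t (PSeries (PS_derive a) t)).
  { intros t Ht. apply (is_derive_ext_loc (PSeries a)).
    - apply (locally_Rabs_lt r); [easy|]. intros y Hy. symmetry. now apply Hf.
    - apply is_derive_PSeries. eapply Rbar_lt_le_trans; [|exact Ha]. exact Ht. }
  split.
  - exists (PS_derive a). split; [now rewrite CV_radius_derive|].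
    intros t Ht. apply is_derive_unique. auto.
  - intros t Ht. rewrite (is_derive_unique _ _ _ (HD t Ht)). auto.
Qed.

Lemma analytic_identity r d f g : analytic_on r f -> analytic_on r g -> 0 < d <= r ->
  (forall t, Rabs t < d -> f t = g t) -> forall t, Rabs t < r -> f t = g t.
Proof.
  intros (a & Ha & Hf) (b & Hb & Hg) Hd H t Ht.
  rewrite Hf, Hg by easy. apply PSeries_ext. intros n.
  assert (Hr : forall c, Rbar_le r (CV_radius c) -> Rbar_lt 0 (CV_radius c)).
  { intros c Hc. eapply Rbar_lt_le_trans; [|exact Hc]. simpl; lra. }
  apply PSeries_ext_recip; auto.
  apply (locally_Rabs_lt d); [rewrite Rabs_R0; lra|]. intros y Hy.
  rewrite <- Hf, <- Hg by lra. auto.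
Qed.

Lemma PSeries_sum_n (b : nat -> nat -> R) (t : R) N : (forall n, ex_pseries (b n) t) ->
  ex_pseries (fun k => sum_n (fun n => b n k) N) t /\
  PSeries (fun k => sum_n (fun n => b n k) N) t = sum_n (fun n => PSeries (b n) t) N.
Proof.
  intros Hb. induction N as [|N [IH1 IH2]].
  - split.
    + apply ex_pseries_ext with (b 0%nat); [intros; now rewrite sum_O|apply Hb].
    + rewrite sum_O. apply PSeries_ext. intros; now rewrite sum_O.
  - split.
    + apply ex_pseries_ext with (PS_plus (fun k => sum_n (fun n => b n k) N) (b (S N))).
      * intros; rewrite sum_Sn; reflexivity.
      * apply ex_pseries_plus; auto.
    + rewrite sum_Sn, <- IH2. unfold plus; simpl. rewrite <- PSeries_plus by auto.
      apply PSeries_ext. intros; rewrite sum_Sn; reflexivity.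
Qed.

Lemma series_tail_bound (u M : nat -> R) N : ex_series M -> (forall n, Rabs (u n) <= M n) ->
  Rabs (Series u - sum_n u N) <= Series M - sum_n M N.
Proof.
  intros HM Hu.
  assert (Hua : ex_series (fun n => Rabs (u n))).
  { apply (ex_series_le (fun n => Rabs (u n)) M); [|easy].
    intros n. unfold norm; simpl; unfold abs; simpl. rewrite Rabs_Rabsolu. auto. }
  pose proof (ex_series_Rabs _ Hua) as Hus.
  rewrite !sum_n_Reals.
  rewrite (Series_incr_n u (S N)) by (easy || lia).
  rewrite (Series_incr_n M (S N)) by (easy || lia). simpl.
  match goal with |- Rabs ?x <= ?y =>
    replace x with (Series (fun k => u (S (N + k)))) by ring;
    replace y with (Series (fun k => M (S (N + k)))) by ring end.
  assert (HM' : ex_series (fun k => M (S (N + k)))) by (apply (ex_series_incr_n M (S N)); easy).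
  eapply Rle_trans; [apply Series_Rabs|].
  - apply (ex_series_incr_n (fun n => Rabs (u n)) (S N)). easy.
  - apply Series_le; [|easy]. intros n. split; [apply Rabs_pos|auto].
Qed.

(** Weierstrass double series theorem: a majorant [M n] uniform in [k], for each smaller radius
    [rho], allows the sum over [n] to be taken coefficientwise. All later radii of convergence are
    read off from such majorants. *)
Lemma analytic_series (r : R) (b : nat -> nat -> R) : 0 < r ->
  (forall rho, 0 < rho < r -> exists M : nat -> R, ex_series M /\
     forall n k, Rabs (b n k) * rho ^ k <= M n) ->
  analytic_on r (fun t => Series (fun n => PSeries (b n) t)) /\
  (forall t, Rabs t < r -> is_series (fun n => PSeries (b n) t) (PSeries (fun k => Series (fun n => b n k)) t)) /\
  Rbar_le r (CV_radius (fun k => Series (fun n => b n k))).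
Proof.
  intros Hr H.
  set (a := fun k => Series (fun n => b n k)).
  assert (Hrad : Rbar_le r (CV_radius a)).
  { apply CV_radius_ge. intros x Hx. destruct (H x Hx) as (M & HM & Hb).
    exists (Series M). intros k. unfold a. rewrite Rabs_mult.
    rewrite <- Rabs_mult, <- Series_scal_r.
    assert (Hle : forall n, Rabs (b n k * x ^ k) <= M n).
    { intros n. rewrite Rabs_mult, (Rabs_pos_eq (x ^ k)) by (apply pow_le; lra). apply Hb. }
    eapply Rle_trans; [apply Series_Rabs|].
    - apply (ex_series_le (fun n => Rabs (b n k * x ^ k)) M); [|easy].
      intros n. unfold norm; simpl; unfold abs; simpl. rewrite Rabs_Rabsolu. auto.
    - apply Series_le; [|easy]. intros n; split; [apply Rabs_pos|auto]. }
  assert (Hser : forall t, Rabs t < r -> is_series (fun n => PSeries (b n) t) (PSeries a t)).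
  { intros t Ht. pose proof (Rabs_pos t).
    set (rho := (Rabs t + r) / 2).
    destruct (H rho) as (M & HM & Hb); [unfold rho; lra|].
    assert (Htr : Rabs t < rho) by (unfold rho; lra).
    assert (Hrho : 0 < rho) by lra.
    assert (Hexb : forall n, ex_pseries (b n) t).
    { intros n. apply (PSeries_geom_bound (b n) (M n) rho t); auto. }
    assert (Hbk : forall n k, Rabs (b n k) <= M n * / rho ^ k).
    { intros n k. apply Rle_div_r; [apply pow_lt; lra|auto]. }
    assert (HMk : forall k, ex_series (fun n => M n * / rho ^ k)).
    { intros k. now apply ex_series_scal_r. }
    set (q := / (1 - Rabs t / rho)).
    (* The difference is itself a power series, with coefficients the tails over [n]; these are
       bounded by the tail of [M] divided by [rho^k], and a geometric series in [Rabs t / rho]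
       finishes. *)
    assert (Hdiff : forall N, Rabs (PSeries a t - sum_n (fun n => PSeries (b n) t) N)
              <= (Series M - sum_n M N) * q).
    { intros N. destruct (PSeries_sum_n b t N Hexb) as [He1 He2].
      rewrite <- He2, <- PSeries_minus; [|eapply ex_pseries_of_radius; eauto|easy].
      apply PSeries_geom_bound; [easy|]. intros k.
      unfold PS_minus, PS_plus, PS_opp, plus, opp; simpl.
      apply Rle_div_r; [apply pow_lt; lra|].
      pose proof (series_tail_bound (fun n => b n k) (fun n => M n * / rho ^ k) N (HMk k) (fun n => Hbk n k)) as Ht1.
      unfold Rminus in Ht1. unfold a. eapply Rle_trans; [exact Ht1|].
      rewrite Series_scal_r.
      replace (sum_n (fun n => M n * / rho ^ k) N) with (sum_n M N * / rho ^ k)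
        by (symmetry; exact (sum_n_mult_r (K := R_Ring) (/ rho ^ k) M N)).
      right. unfold Rdiv. ring. }
    assert (Hlim : is_lim_seq (fun N => (Series M - sum_n M N) * q) 0).
    { replace (Finite 0) with (Finite ((Series M - Series M) * q)) by (f_equal; ring).
      apply is_lim_seq_mult'; [|apply is_lim_seq_const].
      apply is_lim_seq_minus'; [apply is_lim_seq_const|].
      apply (Series_correct M). easy. }
    change (is_lim_seq (sum_n (fun n => PSeries (b n) t)) (PSeries a t)).
    apply (is_lim_seq_ext (fun N => PSeries a t - (PSeries a t - sum_n (fun n => PSeries (b n) t) N))); [intros; ring|].
    replace (Finite (PSeries a t)) with (Finite (PSeries a t - 0)) by (f_equal; ring).
    apply is_lim_seq_minus'; [apply is_lim_seq_const|].
    apply is_lim_seq_abs_0.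
    apply is_lim_seq_le_le with (fun _ => 0) (fun N => (Series M - sum_n M N) * q);
      [|apply is_lim_seq_const|easy].
    intros N; split; [apply Rabs_pos|apply Hdiff]. }
  split; [|split; [exact Hser|exact Hrad]].
  exists a. split; [easy|]. intros t Ht. apply is_series_unique. auto.
Qed.

(** * Dirichlet series on horizontal lines *)

Lemma sum_n_rsum (f : nat -> R) N : sum_n (fun n => f (S n)) N = rsum f (S N).
Proof.
  induction N as [|N IH]; [rewrite sum_O; simpl; ring|].
  rewrite sum_Sn, IH. reflexivity.
Qed.

Lemma is_series_rsum (f : nat -> R) (l : R) :
  is_series (fun n => f (S n)) l <-> is_lim_seq (rsum f) l.
Proof.
  rewrite is_lim_seq_incr_1. split; intros H.
  - apply (is_lim_seq_ext (sum_n (fun n => f (S n)))); [intros; apply sum_n_rsum|exact H].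
  - change (is_lim_seq (sum_n (fun n => f (S n))) l).
    apply (is_lim_seq_ext (fun n => rsum f (S n))); [intros; symmetry; apply sum_n_rsum|exact H].
Qed.

Lemma is_lim_seq_scal_0 c u : is_lim_seq u 0 -> is_lim_seq (fun n => c * u n) 0.
Proof.
  intros H. replace (Finite 0) with (Finite (c * 0)) by (f_equal; ring).
  apply is_lim_seq_mult'; [apply is_lim_seq_const|easy].
Qed.

Lemma is_lim_seq_upper u (l B : R) : is_lim_seq u l -> eventually (fun n => u n <= B) -> l <= B.
Proof. intros H HB. exact (is_lim_seq_le_loc u (fun _ => B) l B HB H (is_lim_seq_const B)). Qed.

Lemma INR_S_pos n : 0 < INR (S n).
Proof. apply lt_0_INR; lia. Qed.

Lemma INR_S_ge1 n : 1 <= INR (S n).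
Proof. rewrite S_INR. pose proof (pos_INR n). lra. Qed.

Lemma is_derive_Rpower x a : 0 < x -> is_derive (fun y => Rpower y a) x (a * Rpower x (a - 1)).
Proof.
  intros Hx. unfold Rpower. auto_derive; [lra|].
  replace ((a - 1) * ln x) with (a * ln x + - ln x) by ring.
  rewrite exp_plus, exp_Ropp, exp_ln by easy. field. lra.
Qed.

Lemma Rpower_base_1 a : Rpower 1 a = 1.
Proof. unfold Rpower. rewrite ln_1, Rmult_0_r. apply exp_0. Qed.

Lemma Rpower_step x d : 0 < x -> 0 < d ->
  d * Rpower (x + 1) (- d - 1) <= Rpower x (- d) - Rpower (x + 1) (- d).
Proof.
  intros Hx Hd.
  destruct (MVT_is_derive (fun y => Rpower y (- d)) (fun y => - d * Rpower y (- d - 1)) x (x + 1))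
    as (c & Hc & He); [lra| |].
  - intros y Hy. apply is_derive_Rpower. lra.
  - assert (Rpower (x + 1) (- d - 1) <= Rpower c (- d - 1)).
    { unfold Rpower. apply exp_le_compat.
      assert (ln c <= ln (x + 1)) by (apply ln_le; lra). nra. }
    nra.
Qed.

(** Comparison with the integral of [x^(-d-1)] over [[N, M]]: [Rpower_step] bounds each term by a
    telescoping difference. *)
Lemma rsum_Rpower_bound d N M : 0 < d -> (1 <= N <= M)%nat ->
  rsum (fun n => Rpower (INR n) (- d - 1)) M - rsum (fun n => Rpower (INR n) (- d - 1)) N
    <= / d * (Rpower (INR N) (- d) - Rpower (INR M) (- d)).
Proof.
  intros Hd [HN HM]. induction HM as [|M HM IH]; [lra|].
  cbn [rsum]. pose proof (Rpower_step (INR M) d ltac:(apply lt_0_INR; lia) Hd) as Hs.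
  rewrite <- S_INR in Hs.
  assert (Rpower (INR (S M)) (- d - 1) <= / d * (Rpower (INR M) (- d) - Rpower (INR (S M)) (- d))).
  { apply Rmult_le_reg_l with d; [easy|]. rewrite <- Rmult_assoc, Rinv_r, Rmult_1_l by lra. lra. }
  rewrite Rmult_minus_distr_l in *. lra.
Qed.

Lemma rsum_Rpower_le d N : 0 < d -> rsum (fun n => Rpower (INR n) (- d - 1)) N <= 1 + / d.
Proof.
  intros Hd. assert (Hid : 0 < / d) by (apply Rinv_0_lt_compat; easy).
  destruct N as [|N]; [simpl; lra|].
  pose proof (rsum_Rpower_bound d 1 (S N) Hd ltac:(lia)) as H.
  change (rsum (fun n => Rpower (INR n) (- d - 1)) 1) with (0 + Rpower 1 (- d - 1)) in H.
  change (INR 1) with 1 in H. rewrite !Rpower_base_1 in H.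
  pose proof (Rmult_lt_0_compat _ _ Hid (Rpower_pos (INR (S N)) (- d))).
  rewrite Rmult_minus_distr_l in H. lra.
Qed.

Lemma ex_lim_seq_rsum_bounded f B : (forall n, (1 <= n)%nat -> 0 <= f n) -> (forall N, rsum f N <= B) ->
  exists l : R, is_lim_seq (rsum f) l /\ l <= B /\ forall N, rsum f N <= l.
Proof.
  intros Hf HB.
  assert (Hinc : forall n, rsum f n <= rsum f (S n)).
  { intros n. simpl. pose proof (Hf (S n) ltac:(lia)). lra. }
  destruct (ex_finite_lim_seq_incr (rsum f) B Hinc HB) as [l Hl].
  exists l. split; [easy|]. split.
  - apply (is_lim_seq_le (rsum f) (fun _ => B) l B); [easy|easy|apply is_lim_seq_const].
  - intros N. apply (is_lim_seq_incr_compare (rsum f) l); easy.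
Qed.

Lemma ex_series_Rpower e : e < -1 -> ex_series (fun n => Rpower (INR (S n)) e).
Proof.
  intros He. set (d := - e - 1). replace e with (- d - 1) by (unfold d; ring).
  assert (Hd : 0 < d) by (unfold d; lra).
  destruct (ex_lim_seq_rsum_bounded (fun n => Rpower (INR n) (- d - 1)) (1 + / d)) as (l & Hl & _).
  - intros; left; apply exp_pos.
  - intros N. now apply rsum_Rpower_le.
  - exists l. apply is_series_rsum in Hl. exact Hl.
Qed.

(** * The functions [n^(-s)] as power series in [t], with bounds uniform in the index *)

Lemma pow_fact_le_exp x k : 0 <= x -> x ^ k * / INR (fact k) <= exp x.
Proof.
  intros Hx. pose proof (is_exp_Reals x) as H. apply is_pseries_R in H.
  assert (Hpos : forall n, 0 <= / INR (fact n) * x ^ n).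
  { intros n. apply Rmult_le_pos; [left; apply Rinv_0_lt_compat, INR_fact_lt_0|now apply pow_le]. }
  apply Rle_trans with (sum_n (fun n => / INR (fact n) * x ^ n) k).
  - destruct k as [|k].
    + rewrite sum_O. simpl. lra.
    + rewrite sum_Sn. unfold plus; simpl.
      assert (0 <= sum_n (fun n => / INR (fact n) * x ^ n) k).
      { rewrite sum_n_Reals. apply cond_pos_sum. exact Hpos. }
      simpl in *. lra.
  - apply (is_lim_seq_incr_compare (sum_n (fun n => / INR (fact n) * x ^ n)) (exp x)).
    + exact H.
    + intros n. rewrite sum_Sn. unfold plus; simpl. pose proof (Hpos (S n)) as Hn. simpl in Hn. lra.
Qed.

Lemma PSeries_exp v t : PSeries (fun k => v ^ k * / INR (fact k)) t = exp (t * v) /\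
  ex_pseries (fun k => v ^ k * / INR (fact k)) t.
Proof.
  pose proof (is_exp_Reals (t * v)) as H. apply is_pseries_R in H.
  assert (H' : is_pseries (fun k => v ^ k * / INR (fact k)) t (exp (t * v))).
  { apply is_pseries_R. apply is_series_ext with (2 := H). intros n.
    change (/ INR (fact n) * (t * v) ^ n = v ^ n * / INR (fact n) * t ^ n).
    rewrite Rpow_mult_distr. ring. }
  split; [now apply is_pseries_unique|]. eexists; exact H'.
Qed.

(* At [v = ln n] the phases [0] and [PI / 2] give the real and imaginary parts of [n^(-a - i g)];
   adding [PI / 2] to the phase multiplies by [- i]. *)
Definition wave (a g phi v : R) : R := exp (- a * v) * cos (g * v + phi).

(* Coefficient of [t^k] in [wave (a - t) g phi v]. *)
Definition wterm (a g phi : R) (k : nat) (v : R) : R :=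
  wave a g phi v * (v ^ k * / INR (fact k)).

(** The index drops because the derivative of [v^k / k!] is [v^(k-1) / (k-1)!]. On generating
    functions the shift is multiplication by [t]; it turns the factor [- a] of the derivative into
    [- (a - t)]. *)
Definition wterm_pred (a g phi : R) (k : nat) (v : R) : R :=
  match k with O => 0 | S j => wterm a g phi j v end.

Definition dwterm (a g phi : R) (k : nat) (v : R) : R :=
  - a * wterm a g phi k v + g * wterm a g (phi + PI / 2) k v + wterm_pred a g phi k v.

Definition dwterm_pred (a g phi : R) (k : nat) (v : R) : R :=
  match k with O => 0 | S j => dwterm a g phi j v end.

Definition ddwterm (a g phi : R) (k : nat) (v : R) : R :=
  - a * dwterm a g phi k v + g * dwterm a g (phi + PI / 2) k v + dwterm_pred a g phi k v.

Lemma cos_quarter_turn x : cos (x + PI / 2) = - sin x.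
Proof. rewrite cos_plus, cos_PI2, sin_PI2. ring. Qed.

Lemma is_derive_wave a g phi v :
  is_derive (wave a g phi) v (- a * wave a g phi v + g * wave a g (phi + PI / 2) v).
Proof.
  unfold wave. auto_derive; [easy|].
  rewrite <- Rplus_assoc, cos_quarter_turn. ring.
Qed.

Lemma is_derive_wterm a g phi k v : is_derive (wterm a g phi k) v (dwterm a g phi k v).
Proof.
  unfold dwterm, wterm_pred, wterm.
  assert (Hk : is_derive (fun v => v ^ k * / INR (fact k)) v
    (match k with O => 0 | S j => v ^ j * / INR (fact j) end)).
  { destruct k as [|j].
    - simpl. auto_derive; [easy|ring].
    - replace (v ^ j * / INR (fact j)) with (/ INR (fact (S j)) * (INR (S j) * v ^ j)).
      + apply (is_derive_ext (fun v => / INR (fact (S j)) * v ^ S j)); [intros; apply Rmult_comm|].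
        apply (is_derive_scal (fun v => v ^ S j)). apply is_derive_Reals. apply derivable_pt_lim_pow.
      + rewrite fact_simpl, mult_INR.
        field. split; [apply INR_fact_neq_0|apply not_0_INR; lia]. }
  pose proof (is_derive_mult _ _ v _ _ (is_derive_wave a g phi v) Hk Rmult_comm) as H.
  eapply is_derive_ext; [intros; reflexivity|].
  match goal with |- is_derive _ _ ?r => match type of H with is_derive _ _ ?l => replace r with l end end; [exact H|].
  unfold plus, mult; simpl. destruct k; ring.
Qed.

Lemma is_derive_dwterm a g phi k v : is_derive (dwterm a g phi k) v (ddwterm a g phi k v).
Proof.
  unfold ddwterm.
  apply (is_derive_plus (fun v => - a * wterm a g phi k v + g * wterm a g (phi + PI / 2) k v)
           (wterm_pred a g phi k)).
  - apply (is_derive_plus (fun v => - a * wterm a g phi k v) (fun v => g * wterm a g (phi + PI / 2) k v)).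
    + apply (is_derive_scal (wterm a g phi k)). apply is_derive_wterm.
    + apply (is_derive_scal (wterm a g (phi + PI / 2) k)). apply is_derive_wterm.
  - destruct k; [exact (is_derive_const (K := R_AbsRing) (V := R_NormedModule) 0 v)|apply is_derive_wterm].
Qed.

(** [(rho * v)^k / k!] is one term of [exp (rho * v)]. At [v = ln n] the weight [rho^k] thus costs
    only a factor [n^rho], uniformly in [k]. *)
Lemma wterm_bound a g phi k v rho : 0 <= v -> 0 < rho ->
  Rabs (wterm a g phi k v) * rho ^ k <= exp ((rho - a) * v).
Proof.
  intros Hv Hr. unfold wterm, wave.
  rewrite !Rabs_mult, (Rabs_pos_eq (exp _)) by (left; apply exp_pos).
  rewrite <- Rabs_mult. rewrite (Rabs_pos_eq (v ^ k * _)).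
  2:{ apply Rmult_le_pos; [now apply pow_le|left; apply Rinv_0_lt_compat, INR_fact_lt_0]. }
  pose proof (pow_fact_le_exp (rho * v) k ltac:(nra)) as H. rewrite Rpow_mult_distr in H.
  replace ((rho - a) * v) with (- a * v + rho * v) by ring. rewrite exp_plus.
  assert (Hc : Rabs (cos (g * v + phi)) <= 1) by (apply Rabs_le, COS_bound).
  pose proof (exp_pos (- a * v)).
  assert (0 <= v ^ k * / INR (fact k) * rho ^ k).
  { apply Rmult_le_pos; [apply Rmult_le_pos; [now apply pow_le|left; apply Rinv_0_lt_compat, INR_fact_lt_0]|].
    apply pow_le; lra. }
  pose proof (Rabs_pos (cos (g * v + phi))).
  replace (exp (- a * v) * Rabs (cos (g * v + phi)) * (v ^ k * / INR (fact k)) * rho ^ k)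
    with (exp (- a * v) * (Rabs (cos (g * v + phi)) * (v ^ k * / INR (fact k) * rho ^ k))) by ring.
  apply Rmult_le_compat_l; [lra|]. nra.
Qed.

Lemma wterm_pred_bound a g phi k v rho : 0 <= v -> 0 < rho ->
  Rabs (wterm_pred a g phi k v) * rho ^ k <= rho * exp ((rho - a) * v).
Proof.
  intros Hv Hr. pose proof (exp_pos ((rho - a) * v)). destruct k as [|k]; simpl.
  - rewrite Rabs_R0. nra.
  - pose proof (wterm_bound a g phi k v rho Hv Hr). nra.
Qed.

Lemma three_term_bound a g x y z B C p : 0 <= p -> Rabs x * p <= B -> Rabs y * p <= B -> Rabs z * p <= C ->
  Rabs (- a * x + g * y + z) * p <= (Rabs a + Rabs g) * B + C.
Proof.
  intros Hp Hx Hy Hz.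
  apply Rle_trans with ((Rabs a * Rabs x + Rabs g * Rabs y + Rabs z) * p).
  - apply Rmult_le_compat_r; [easy|].
    eapply Rle_trans; [apply Rabs_triang|]. apply Rplus_le_compat_r.
    eapply Rle_trans; [apply Rabs_triang|]. rewrite !Rabs_mult, Rabs_Ropp. lra.
  - pose proof (Rabs_pos a). pose proof (Rabs_pos g). nra.
Qed.

Lemma dwterm_bound a g phi k v rho : 0 <= v -> 0 < rho ->
  Rabs (dwterm a g phi k v) * rho ^ k <= (Rabs a + Rabs g + rho) * exp ((rho - a) * v).
Proof.
  intros Hv Hr. unfold dwterm. eapply Rle_trans; [apply three_term_bound|].
  - apply pow_le; lra.
  - now apply wterm_bound.
  - now apply wterm_bound.
  - now apply wterm_pred_bound.
  - right; ring.
Qed.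

Lemma ddwterm_bound a g phi k v rho : 0 <= v -> 0 < rho ->
  Rabs (ddwterm a g phi k v) * rho ^ k <= (Rabs a + Rabs g + rho) ^ 2 * exp ((rho - a) * v).
Proof.
  intros Hv Hr. unfold ddwterm. eapply Rle_trans; [apply three_term_bound|].
  - apply pow_le; lra.
  - now apply dwterm_bound.
  - now apply dwterm_bound.
  - instantiate (1 := rho * ((Rabs a + Rabs g + rho) * exp ((rho - a) * v))).
    pose proof (exp_pos ((rho - a) * v)). pose proof (Rabs_pos a). pose proof (Rabs_pos g).
    destruct k as [|k]; simpl.
    + rewrite Rabs_R0, Rmult_0_l. apply Rmult_le_pos; [lra|]. apply Rmult_le_pos; lra.
    + pose proof (dwterm_bound a g phi k v rho Hv Hr). nra.
  - right; ring.
Qed.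

Lemma PSeries_wterm a g phi v t :
  PSeries (fun k => wterm a g phi k v) t = wave (a - t) g phi v /\
  ex_pseries (fun k => wterm a g phi k v) t.
Proof.
  destruct (PSeries_exp v t) as [H1 H2]. split.
  - change (PSeries (PS_scal (wave a g phi v) (fun k => v ^ k * / INR (fact k))) t = wave (a - t) g phi v).
    rewrite PSeries_scal, H1.
    unfold wave. replace (- (a - t) * v) with (- a * v + t * v) by ring. rewrite exp_plus. ring.
  - change (ex_pseries (PS_scal (wave a g phi v) (fun k => v ^ k * / INR (fact k))) t).
    apply ex_pseries_scal; [apply Rmult_comm|easy].
Qed.

Lemma PSeries_dwterm a g phi v t :
  PSeries (fun k => dwterm a g phi k v) t =
    - (a - t) * wave (a - t) g phi v + g * wave (a - t) g (phi + PI / 2) v /\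
  ex_pseries (fun k => dwterm a g phi k v) t.
Proof.
  destruct (PSeries_wterm a g phi v t) as [H1 H2].
  destruct (PSeries_wterm a g (phi + PI / 2) v t) as [H3 H4].
  assert (H5 : ex_pseries (PS_incr_1 (fun k => wterm a g phi k v)) t) by now apply ex_pseries_incr_1.
  assert (H6 : ex_pseries (PS_scal (- a) (fun k => wterm a g phi k v)) t)
    by (apply ex_pseries_scal; [apply Rmult_comm|easy]).
  assert (H7 : ex_pseries (PS_scal g (fun k => wterm a g (phi + PI/2) k v)) t)
    by (apply ex_pseries_scal; [apply Rmult_comm|easy]).
  assert (Heq : forall k, PS_plus (PS_plus (PS_scal (- a) (fun k => wterm a g phi k v))
     (PS_scal g (fun k => wterm a g (phi + PI/2) k v))) (PS_incr_1 (fun k => wterm a g phi k v)) k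
     = dwterm a g phi k v).
  { intros [|k]; reflexivity. }
  split.
  - rewrite <- (PSeries_ext _ _ t Heq).
    rewrite PSeries_plus, PSeries_plus, !PSeries_scal, PSeries_incr_1, H1, H3;
      [ring|easy|easy|now apply ex_pseries_plus|easy].
  - eapply ex_pseries_ext; [exact Heq|]. apply ex_pseries_plus; [now apply ex_pseries_plus|easy].
Qed.

Lemma ln_INR_S_ge0 n : 0 <= ln (INR (S n)).
Proof. rewrite <- ln_1. apply ln_le; [lra|apply INR_S_ge1]. Qed.

Lemma ln_le_self n : ln (INR (S n)) <= INR (S n).
Proof.
  pose proof (exp_ineq1_le (ln (INR (S n)))). rewrite exp_ln in H by apply INR_S_pos. lra.
Qed.

Lemma PSeries_scal_wterm c a g phi v t :
  PSeries (fun k => c * wterm a g phi k v) t = c * wave (a - t) g phi v.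
Proof.
  rewrite <- (proj1 (PSeries_wterm a g phi v t)).
  exact (PSeries_scal c (fun k => wterm a g phi k v) t).
Qed.

(** Component of [sum c(n) n^(-s)] at [s = 6 - t + i g]. With [Rabs (c n) <= INR n] and [Rabs t < 2]
    the terms are [O(n^(-3))]. *)
Definition dirichlet (c : nat -> R) (g phi t : R) : R :=
  Series (fun n => c (S n) * wave (6 - t) g phi (ln (INR (S n)))).

Lemma dirichlet_coef_bound c g phi rho : (forall n, (1 <= n)%nat -> Rabs (c n) <= INR n) -> 0 < rho < 2 ->
  exists M : nat -> R, ex_series M /\ forall n k,
    Rabs (c (S n) * wterm 6 g phi k (ln (INR (S n)))) * rho ^ k <= M n.
Proof.
  intros Hc Hr. exists (fun n => Rpower (INR (S n)) (1 + (rho - 6))). split.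
  - apply ex_series_Rpower. lra.
  - intros n k. rewrite Rabs_mult, Rmult_assoc, Rpower_plus, Rpower_1 by apply INR_S_pos.
    pose proof (wterm_bound 6 g phi k (ln (INR (S n))) rho (ln_INR_S_ge0 n) ltac:(lra)) as H.
    apply Rmult_le_compat; [apply Rabs_pos| |apply Hc; lia|exact H].
    apply Rmult_le_pos; [apply Rabs_pos|apply pow_le; lra].
Qed.

Lemma dirichlet_is_series c g phi t : (forall n, (1 <= n)%nat -> Rabs (c n) <= INR n) -> Rabs t < 2 ->
  is_lim_seq (rsum (fun n => c n * wave (6 - t) g phi (ln (INR n)))) (dirichlet c g phi t).
Proof.
  intros Hc Ht.
  destruct (analytic_series 2 (fun n k => c (S n) * wterm 6 g phi k (ln (INR (S n)))) ltac:(lra))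
    as (_ & H & _).
  { intros rho Hr. now apply dirichlet_coef_bound. }
  apply is_series_rsum. unfold dirichlet. apply Series_correct.
  eexists. eapply is_series_ext; [|exact (H t Ht)].
  intros n. simpl. apply PSeries_scal_wterm.
Qed.

(** As [t] enters through [n^t], differentiation multiplies the [n]-th term by [ln n]. On
    coefficients this is the identity [(k+1) v^(k+1) / (k+1)! = v * v^k / k!]. *)
Lemma is_derive_dirichlet g phi t : Rabs t < 2 ->
  is_derive (dirichlet (fun _ => 1) g phi) t (dirichlet (fun n => ln (INR n)) g phi t).
Proof.
  intros Ht.
  set (b1 := fun n k => 1 * wterm 6 g phi k (ln (INR (S n)))).
  set (b2 := fun n k => ln (INR (S n)) * wterm 6 g phi k (ln (INR (S n)))).
  assert (Hb1 : forall rho, 0 < rho < 2 -> exists M : nat -> R, ex_series M /\ forall n k, Rabs (b1 n k) * rho ^ k <= M n).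
  { intros rho Hr. apply (dirichlet_coef_bound (fun _ => 1)); [|easy].
    intros [|n] Hn; [lia|]. rewrite Rabs_R1. apply INR_S_ge1. }
  assert (Hb2 : forall rho, 0 < rho < 2 -> exists M : nat -> R, ex_series M /\ forall n k, Rabs (b2 n k) * rho ^ k <= M n).
  { intros rho Hr. apply (dirichlet_coef_bound (fun n => ln (INR n))); [|easy].
    intros [|n] Hn; [lia|]. rewrite Rabs_pos_eq by apply ln_INR_S_ge0. apply ln_le_self. }
  destruct (analytic_series 2 b1 ltac:(lra) Hb1) as (_ & H1 & Hrad).
  destruct (analytic_series 2 b2 ltac:(lra) Hb2) as (_ & H2 & _).
  set (a1 := fun k => Series (fun n => b1 n k)) in H1, Hrad.
  set (a2 := fun k => Series (fun n => b2 n k)) in H2.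
  assert (E1 : forall t, Rabs t < 2 -> dirichlet (fun _ => 1) g phi t = PSeries a1 t).
  { intros u Hu. rewrite <- (is_series_unique _ _ (H1 u Hu)). apply Series_ext. intros n.
    symmetry. apply PSeries_scal_wterm. }
  assert (E2 : dirichlet (fun n => ln (INR n)) g phi t = PSeries a2 t).
  { rewrite <- (is_series_unique _ _ (H2 t Ht)). apply Series_ext. intros n.
    symmetry. apply PSeries_scal_wterm. }
  apply (is_derive_ext_loc (PSeries a1)).
  - apply (locally_Rabs_lt 2); [easy|]. intros y Hy. symmetry. now apply E1.
  - rewrite E2. rewrite (PSeries_ext a2 (PS_derive a1)).
    + apply is_derive_PSeries. eapply Rbar_lt_le_trans; [|exact Hrad]. exact Ht.
    + intros k. unfold PS_derive, a1, a2. rewrite <- Series_scal_l. apply Series_ext.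
      intros n. unfold b1, b2, wterm. rewrite fact_simpl, mult_INR, <- tech_pow_Rmult.
      assert (INR (S k) <> 0) by (apply not_0_INR; lia). pose proof (INR_fact_neq_0 k).
      field. easy.
Qed.

Lemma ln_step n : ln (INR (S (S n))) - ln (INR (S n)) <= / INR (S n) /\
  ln (INR (S n)) <= ln (INR (S (S n))).
Proof.
  pose proof (INR_S_pos n) as Hp. rewrite (S_INR (S n)). split.
  - replace (INR (S n) + 1) with (INR (S n) * (1 + / INR (S n))) by (field; lra).
    assert (Hi : 0 < / INR (S n)) by (apply Rinv_0_lt_compat; lra).
    rewrite ln_mult by lra.
    pose proof (exp_ineq1_le (/ INR (S n))).
    assert (ln (1 + / INR (S n)) <= / INR (S n)); [|lra].
    rewrite <- (ln_exp (/ INR (S n))) at 2. apply ln_le; lra.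
  - apply ln_le; lra.
Qed.

(** The mean value theorem over a step of length at most [1/n] in [v = ln x] gains one power of [n];
    summation by parts lives on this gain. *)
Lemma wterm_increment_bound a g phi k n rho : 0 < rho < a ->
  Rabs (wterm a g phi k (ln (INR (S n))) - wterm a g phi k (ln (INR (S (S n))))) * rho ^ k
   <= (Rabs a + Rabs g + rho) * Rpower (INR (S n)) (rho - a - 1).
Proof.
  intros Hr. destruct (ln_step n) as [Hs1 Hs2].
  set (v1 := ln (INR (S n))) in *. set (v2 := ln (INR (S (S n)))) in *.
  assert (Hv1 : 0 <= v1) by apply ln_INR_S_ge0.
  set (L := Rabs a + Rabs g + rho). pose proof (Rabs_pos a). pose proof (Rabs_pos g).
  assert (HL : 0 < L) by (unfold L; lra).
  assert (Hrk : 0 < rho ^ k) by (apply pow_lt; lra).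
  destruct (MVT_is_derive (wterm a g phi k) (dwterm a g phi k) v1 v2) as (c & Hc & He); [easy| |].
  - intros y Hy. apply is_derive_wterm.
  - rewrite Rabs_minus_sym, He, Rabs_mult, (Rabs_pos_eq (v2 - v1)) by lra.
    pose proof (dwterm_bound a g phi k c rho ltac:(lra) ltac:(lra)) as Hb. fold L in Hb.
    replace (Rpower (INR (S n)) (rho - a - 1)) with (exp ((rho - a) * v1) * / INR (S n)).
    2:{ replace (rho - a - 1) with (rho - a + - (1)) by ring.
        rewrite Rpower_plus, Rpower_Ropp, Rpower_1 by apply INR_S_pos. reflexivity. }
    assert (He2 : exp ((rho - a) * c) <= exp ((rho - a) * v1)) by (apply exp_le_compat; nra).
    pose proof (exp_pos ((rho - a) * c)).
    replace (Rabs (dwterm a g phi k c) * (v2 - v1) * rho ^ k)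
      with ((Rabs (dwterm a g phi k c) * rho ^ k) * (v2 - v1)) by ring.
    rewrite <- Rmult_assoc. apply Rmult_le_compat; try lra.
    + apply Rmult_le_pos; [apply Rabs_pos|lra].
    + nra.
Qed.

(** The majorant has exponent [theta + rho - 7], which is below [-1] exactly when [rho < 6 - theta],
    that is, up to [Re s > theta]. *)
Lemma analytic_abel F K theta g phi :
  (forall n, (1 <= n)%nat -> Rabs (F n) <= K * Rpower (INR n) theta) -> 0 < theta < 6 ->
  analytic_on (6 - theta) (fun t => Series (fun n => F (S n) *
     (wave (6 - t) g phi (ln (INR (S n))) - wave (6 - t) g phi (ln (INR (S (S n))))))).
Proof.
  intros HF Ht.
  destruct (analytic_series (6 - theta) (fun n k => F (S n) *
     (wterm 6 g phi k (ln (INR (S n))) - wterm 6 g phi k (ln (INR (S (S n)))))) ltac:(lra)) as (H & _).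
  - intros rho Hr. exists (fun n => K * (Rabs 6 + Rabs g + rho) * Rpower (INR (S n)) (theta + (rho - 6 - 1))).
    split.
    + apply (ex_series_scal_l (K * (Rabs 6 + Rabs g + rho)) (fun n => Rpower (INR (S n)) (theta + (rho - 6 - 1)))).
      apply ex_series_Rpower. lra.
    + intros n k. rewrite Rabs_mult, Rpower_plus.
      pose proof (wterm_increment_bound 6 g phi k n rho ltac:(lra)) as Hb.
      specialize (HF (S n) ltac:(lia)).
      rewrite Rmult_assoc.
      replace (K * (Rabs 6 + Rabs g + rho) * (Rpower (INR (S n)) theta * Rpower (INR (S n)) (rho - 6 - 1)))
        with ((K * Rpower (INR (S n)) theta) * ((Rabs 6 + Rabs g + rho) * Rpower (INR (S n)) (rho - 6 - 1))) by ring.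
      apply Rmult_le_compat; [apply Rabs_pos| |easy|easy].
      apply Rmult_le_pos; [apply Rabs_pos|apply pow_le; lra].
  - eapply analytic_ext; [|exact H]. intros t Htt. apply Series_ext. intros n.
    destruct (PSeries_wterm 6 g phi (ln (INR (S n))) t) as [E1 X1].
    destruct (PSeries_wterm 6 g phi (ln (INR (S (S n)))) t) as [E2 X2].
    rewrite <- E1, <- E2, <- PSeries_minus by easy.
    exact (PSeries_scal (F (S n)) _ t).
Qed.

(* Component of [(s-1) n^(-s) - n^(1-s) + (n+1)^(1-s)], whose sum over [n] is [(s-1) zeta(s) - 1]. *)
Definition zeta_term (a g phi : R) (n : nat) : R :=
  wave a g phi (ln (INR (S n))) - wave a g phi (ln (INR n))
  - / INR n * (- a * wave a g phi (ln (INR n)) + g * wave a g (phi + PI / 2) (ln (INR n))).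

Lemma taylor2_bound (p dp ddp : R -> R) x B : 
  (forall y, x <= y <= x + 1 -> is_derive p y (dp y)) ->
  (forall y, x <= y <= x + 1 -> is_derive dp y (ddp y)) ->
  (forall y, x <= y <= x + 1 -> Rabs (ddp y) <= B) ->
  Rabs (p (x + 1) - p x - dp x) <= B.
Proof.
  intros H1 H2 HB.
  destruct (MVT_is_derive p dp x (x + 1)) as (c & Hc & Hce); [lra|easy|].
  destruct (MVT_is_derive dp ddp x c) as (d & Hd & Hde); [lra|intros; apply H2; lra|].
  replace (p (x + 1) - p x - dp x) with (ddp d * (c - x)) by nra.
  rewrite Rabs_mult, (Rabs_pos_eq (c - x)) by lra.
  specialize (HB d ltac:(lra)). pose proof (Rabs_pos (ddp d)). nra.
Qed.

(** A first-order Taylor remainder gains two powers of [n]. For [a = 5] the exponent [rho - 7] is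
    summable for every [rho < 6], which carries [(s - 1) zeta(s)] to all of [Re s > 0]. *)
Lemma wterm_second_difference_bound a g phi k n rho : 0 < a -> 0 < rho < a + 1 ->
  Rabs (wterm a g phi k (ln (INR (S (S n)))) - wterm a g phi k (ln (INR (S n)))
    - / INR (S n) * dwterm a g phi k (ln (INR (S n)))) * rho ^ k
   <= 2 * (Rabs a + Rabs g + rho + 1) ^ 2 * Rpower (INR (S n)) (rho - a - 2).
Proof.
  intros Ha Hr. set (x := INR (S n)). assert (Hx : 1 <= x) by apply INR_S_ge1.
  set (L := Rabs a + Rabs g + rho). pose proof (Rabs_pos a) as Pa. pose proof (Rabs_pos g) as Pg.
  assert (HL : 0 < L) by (unfold L; lra).
  assert (Hrk : 0 < rho ^ k) by (apply pow_lt; lra).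
  rewrite (S_INR (S n)). fold x.
  assert (HLn : forall y, x <= y <= x + 1 -> is_derive ln y (/ y)).
  { intros y Hy. apply is_derive_Reals, derivable_pt_lim_ln. lra. }
  apply Rle_div_r; [easy|].
  apply (taylor2_bound (fun y => wterm a g phi k (ln y)) (fun y => / y * dwterm a g phi k (ln y))
    (fun y => / y ^ 2 * (ddwterm a g phi k (ln y) - dwterm a g phi k (ln y)))).
  - intros y Hy. apply (is_derive_comp (wterm a g phi k) ln); [apply is_derive_wterm|apply HLn; easy].
  - intros y Hy.
    replace (/ y ^ 2 * (ddwterm a g phi k (ln y) - dwterm a g phi k (ln y)))
      with ((- / y ^ 2) * dwterm a g phi k (ln y) + / y * (/ y * ddwterm a g phi k (ln y))).
    2:{ field. lra. }
    apply (is_derive_mult (fun y => / y) (fun y => dwterm a g phi k (ln y))).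
    + auto_derive; [lra|]. field. lra.
    + apply (is_derive_comp (dwterm a g phi k) ln); [apply is_derive_dwterm|apply HLn; easy].
    + apply Rmult_comm.
  - intros y Hy. apply Rle_div_r; [easy|].
    assert (Hv : 0 <= ln y) by (rewrite <- ln_1; apply ln_le; lra).
    pose proof (dwterm_bound a g phi k (ln y) rho Hv ltac:(lra)) as B1.
    pose proof (ddwterm_bound a g phi k (ln y) rho Hv ltac:(lra)) as B2. fold L in B1, B2.
    assert (Hy2 : 0 < / y ^ 2) by (apply Rinv_0_lt_compat, pow_lt; lra).
    rewrite Rabs_mult, (Rabs_pos_eq (/ y ^ 2)) by lra.
    pose proof (Rabs_triang (ddwterm a g phi k (ln y)) (- dwterm a g phi k (ln y))) as HT.
    rewrite Rabs_Ropp in HT. fold (Rminus (ddwterm a g phi k (ln y)) (dwterm a g phi k (ln y))) in HT.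
    assert (HE : / y ^ 2 * exp ((rho - a) * ln y) <= Rpower x (rho - a - 2)).
    { replace (/ y ^ 2 * exp ((rho - a) * ln y)) with (Rpower y (rho - a - 2)).
      - unfold Rpower. apply exp_le_compat. assert (ln x <= ln y) by (apply ln_le; lra). nra.
      - replace (rho - a - 2) with (- INR 2 + (rho - a)) by (simpl; ring).
        rewrite Rpower_plus, Rpower_Ropp, Rpower_pow by lra. reflexivity. }
    assert (HE0 : 0 <= / y ^ 2 * exp ((rho - a) * ln y)).
    { apply Rmult_le_pos; [lra|left; apply exp_pos]. }
    apply Rle_trans with ((L ^ 2 + L) * (/ y ^ 2 * exp ((rho - a) * ln y))).
    + replace ((L ^ 2 + L) * (/ y ^ 2 * exp ((rho - a) * ln y)))
        with (/ y ^ 2 * (L ^ 2 * exp ((rho - a) * ln y) + L * exp ((rho - a) * ln y))) by ring.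
      rewrite Rmult_assoc. apply Rmult_le_compat_l; [lra|]. nra.
    + apply Rmult_le_compat; [nra|easy|nra|easy].
Qed.

Lemma analytic_zeta_term r g phi : 0 < r < 6 ->
  analytic_on r (fun t => Series (fun n => zeta_term (5 - t) g phi (S n))) /\
  forall t, Rabs t < r -> ex_series (fun n => zeta_term (5 - t) g phi (S n)).
Proof.
  intros Hr0.
  set (b := fun n k => wterm 5 g phi k (ln (INR (S (S n)))) - wterm 5 g phi k (ln (INR (S n)))
    - / INR (S n) * dwterm 5 g phi k (ln (INR (S n)))).
  assert (Hb : forall n t, PSeries (b n) t = zeta_term (5 - t) g phi (S n)).
  { intros n t. unfold zeta_term.
    destruct (PSeries_wterm 5 g phi (ln (INR (S n))) t) as [E1 X1].
    destruct (PSeries_wterm 5 g phi (ln (INR (S (S n)))) t) as [E2 X2].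
    destruct (PSeries_dwterm 5 g phi (ln (INR (S n))) t) as [E3 X3].
    rewrite <- E1, <- E2. rewrite <- (PSeries_scal _ (fun k => wterm 5 g phi k (ln (INR (S n))))).
    rewrite PSeries_scal. rewrite E1, <- E3. rewrite <- E1.
    rewrite <- PSeries_minus by easy. rewrite <- PSeries_scal. rewrite <- PSeries_minus.
    - reflexivity.
    - now apply ex_pseries_minus.
    - apply ex_pseries_scal; [apply Rmult_comm|easy]. }
  destruct (analytic_series r b ltac:(lra)) as (H1 & H2 & _).
  - intros rho Hr. exists (fun n => 2 * (Rabs 5 + Rabs g + rho + 1) ^ 2 * Rpower (INR (S n)) (rho - 5 - 2)).
    split.
    + apply (ex_series_scal_l (2 * (Rabs 5 + Rabs g + rho + 1) ^ 2) (fun n => Rpower (INR (S n)) (rho - 5 - 2))).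
      apply ex_series_Rpower. lra.
    + intros n k. apply wterm_second_difference_bound; lra.
  - split.
    + eapply analytic_ext; [|exact H1]. intros t _. apply Series_ext. intros n. apply Hb.
    + intros t Ht. exists (PSeries (fun k => Series (fun n => b n k)) t).
      apply (is_series_ext (fun n => PSeries (b n) t)); [intros n; exact (Hb n t)|exact (H2 t Ht)].
Qed.

(** * The convolution identity and summation by parts near the centre *)

Lemma rsum_multiples f d N : (1 <= d)%nat ->
  rsum (fun n => if dvdb d n then f n else 0) N = rsum (fun m => f (d * m)%nat) (N / d).
Proof.
  intros Hd. induction N as [|N IH].
  - rewrite Nat.Div0.div_0_l. reflexivity.
  - cbn [rsum]. rewrite IH. destruct (dvdb d (S N)) eqn:Hdv.
    + apply dvdb_divide in Hdv; [|easy]. destruct Hdv as [q Hq].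
      destruct q as [|q]; [lia|].
      replace (S N / d)%nat with (S q) by (apply Nat.div_unique with 0%nat; lia).
      replace (N / d)%nat with q by (apply Nat.div_unique with (d - 1)%nat; lia).
      cbn [rsum]. do 2 f_equal. lia.
    + rewrite Rplus_0_r. f_equal.
      pose proof (Nat.div_mod (S N) d ltac:(lia)) as E1.
      pose proof (Nat.mod_upper_bound (S N) d ltac:(lia)) as E2.
      unfold dvdb in Hdv. apply Nat.eqb_neq in Hdv.
      symmetry. apply Nat.div_unique with (S N mod d - 1)%nat; lia.
Qed.

Lemma rsum_abel f w N :
  rsum (fun n => f n * w n) N =
  rsum f N * w (S N) + rsum (fun n => rsum f n * (w n - w (S n))) N.
Proof. induction N as [|N IH]; cbn [rsum]; [ring|]. rewrite IH. ring. Qed.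

Lemma rsum_Rabs f N : Rabs (rsum f N) <= rsum (fun n => Rabs (f n)) N.
Proof.
  induction N as [|N IH]; cbn [rsum]; [rewrite Rabs_R0; lra|].
  eapply Rle_trans; [apply Rabs_triang|]. lra.
Qed.

Lemma rsum_minus f g N : rsum (fun n => f n - g n) N = rsum f N - rsum g N.
Proof. induction N as [|N IH]; cbn [rsum]; [ring|]. rewrite IH. ring. Qed.

Lemma rsum_diff_Rabs f g N M : (N <= M)%nat -> (forall n, (N < n <= M)%nat -> Rabs (f n) <= g n) ->
  Rabs (rsum f M - rsum f N) <= rsum g M - rsum g N.
Proof.
  intros H. induction H as [|M HM IH]; intros Hf.
  - replace (rsum f N - rsum f N) with 0 by ring. rewrite Rabs_R0. lra.
  - cbn [rsum]. replace (rsum f M + f (S M) - rsum f N) with ((rsum f M - rsum f N) + f (S M)) by ring.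
    eapply Rle_trans; [apply Rabs_triang|].
    assert (Rabs (rsum f M - rsum f N) <= rsum g M - rsum g N) by (apply IH; intros; apply Hf; lia).
    pose proof (Hf (S M) ltac:(lia)). lra.
Qed.

Lemma wave_bound a g phi n e : - a <= e -> Rabs (wave a g phi (ln (INR (S n)))) <= Rpower (INR (S n)) e.
Proof.
  intros He. unfold wave. rewrite Rabs_mult, (Rabs_pos_eq (exp _)) by (left; apply exp_pos).
  assert (Hc : Rabs (cos (g * ln (INR (S n)) + phi)) <= 1) by (apply Rabs_le, COS_bound).
  apply Rle_trans with (exp (- a * ln (INR (S n))) * 1).
  - apply Rmult_le_compat_l; [left; apply exp_pos|easy].
  - rewrite Rmult_1_r. unfold Rpower. apply exp_le_compat.
    apply Rmult_le_compat_r; [apply ln_INR_S_ge0|easy].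
Qed.

Lemma wave_mul a g phi x y : 0 < x -> 0 < y ->
  wave a g phi (ln (x * y)) = wave a g 0 (ln x) * wave a g phi (ln y)
   - wave a g (PI / 2) (ln x) * wave a g (phi + PI / 2) (ln y).
Proof.
  intros Hx Hy. rewrite ln_mult by easy. unfold wave.
  rewrite <- (Rplus_assoc _ phi), !cos_quarter_turn, Rplus_0_r.
  replace (- a * (ln x + ln y)) with (- a * ln x + - a * ln y) by ring.
  replace (g * (ln x + ln y) + phi) with (g * ln x + (g * ln y + phi)) by ring.
  rewrite exp_plus, cos_plus. ring.
Qed.

Lemma one_le_INR n : (1 <= n)%nat -> Rabs 1 <= INR n.
Proof. intros H. rewrite Rabs_R1. change 1 with (INR 1). now apply le_INR. Qed.

Definition zeta_c (g phi t : R) : R := dirichlet (fun _ => 1) g phi t.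
Definition mangoldt_c (g phi t : R) : R := dirichlet vonMangoldt g phi t.

Lemma vonMangoldt_bound n : (1 <= n)%nat -> Rabs (vonMangoldt n) <= INR n.
Proof.
  intros Hn. rewrite Rabs_pos_eq by apply vonMangoldt_ge0.
  destruct n as [|n]; [lia|].
  eapply Rle_trans; [now apply vonMangoldt_le_ln|apply ln_le_self].
Qed.

Lemma ln_bound n : (1 <= n)%nat -> Rabs (ln (INR n)) <= INR n.
Proof.
  intros Hn. destruct n as [|n]; [lia|].
  rewrite Rabs_pos_eq by apply ln_INR_S_ge0. apply ln_le_self.
Qed.

Lemma zeta_c_tail g phi t M : Rabs t < 1 -> (1 <= M)%nat ->
  Rabs (zeta_c g phi t - rsum (fun n => wave (6 - t) g phi (ln (INR n))) M) <= / 2 * / INR M.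
Proof.
  intros Ht HM. apply Rabs_lt_between in Ht.
  assert (Hl : is_lim_seq (fun N => Rabs (rsum (fun n => 1 * wave (6 - t) g phi (ln (INR n))) N
      - rsum (fun n => wave (6 - t) g phi (ln (INR n))) M))
      (Rabs (zeta_c g phi t - rsum (fun n => wave (6 - t) g phi (ln (INR n))) M))).
  { apply (is_lim_seq_abs _ (Finite _)). apply is_lim_seq_minus'; [|apply is_lim_seq_const].
    apply dirichlet_is_series; [exact one_le_INR|apply Rabs_lt_between; lra]. }
  apply (is_lim_seq_upper _ _ _ Hl).
  exists M. intros N HN.
  rewrite (rsum_ext (fun n => 1 * wave (6 - t) g phi (ln (INR n))) (fun n => wave (6 - t) g phi (ln (INR n))))
    by (intros; ring).
  eapply Rle_trans.
  - apply (rsum_diff_Rabs _ (fun n => Rpower (INR n) (- (2) - 1)) M N HN).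
    intros [|n] Hn; [lia|]. apply wave_bound. lra.
  - eapply Rle_trans; [apply rsum_Rpower_bound; [lra|lia]|].
    assert (HM1 : 1 <= INR M) by now apply INR_ge1.
    apply Rmult_le_compat_l; [lra|].
    assert (0 < Rpower (INR N) (- (2))) by apply exp_pos.
    assert (Hp : Rpower (INR M) (- (2)) <= Rpower (INR M) (- (1))) by (apply Rle_Rpower; lra).
    rewrite (Rpower_Ropp _ 1), (Rpower_1 (INR M)) in Hp by lra. lra.
Qed.

Lemma is_lim_seq_inv_INR c : is_lim_seq (fun n => c * / INR n) 0.
Proof.
  replace (Finite 0) with (Rbar_mult c (Rbar_inv p_infty)) by (simpl; f_equal; ring).
  apply is_lim_seq_scal_l. apply is_lim_seq_inv; [apply is_lim_seq_INR|easy].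
Qed.

(* [-zeta' = zeta * sum Lambda(n) n^(-s)], read off componentwise. *)
Lemma dirichlet_ln_product g phi t : Rabs t < 1 ->
  dirichlet (fun n => ln (INR n)) g phi t =
  mangoldt_c g 0 t * zeta_c g phi t - mangoldt_c g (PI / 2) t * zeta_c g (phi + PI / 2) t.
Proof.
  intros Ht. assert (Ht2 : Rabs t < 2) by lra.
  set (w := fun p n => wave (6 - t) g p (ln (INR n))).
  set (S := fun p M => rsum (w p) M).
  (* Write [n = d * m]: for fixed [d] the cofactor [m] runs up to [N / d], and [wave_mul] is complex
     multiplication of [d^(-s)] and [m^(-s)]. *)
  assert (Hfin : forall N, rsum (fun n => ln (INR n) * w phi n) N =
    rsum (fun d => vonMangoldt d * (w 0 d * S phi (N / d)%nat - w (PI / 2) d * S (phi + PI / 2) (N / d)%nat)) N).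
  { intros N.
    transitivity (rsum (fun n => rsum (fun d => if dvdb d n then vonMangoldt d * w phi n else 0) N) N).
    { apply rsum_ext. intros n Hn. rewrite <- (sum_divisors_vonMangoldt N n Hn).
      rewrite Rmult_comm, <- rsum_scal. apply rsum_ext. intros d _. destruct (dvdb d n); ring. }
    rewrite rsum_swap. apply rsum_ext. intros d Hd.
    rewrite (rsum_multiples (fun n => vonMangoldt d * w phi n)) by lia.
    unfold S. rewrite <- !rsum_scal, <- rsum_minus, <- rsum_scal. apply rsum_ext.
    intros m Hm. f_equal. unfold w. rewrite mult_INR. apply wave_mul; apply lt_0_INR; lia. }
  set (B := fun N => rsum (fun d => vonMangoldt d * w 0 d) N * zeta_c g phi t
      - rsum (fun d => vonMangoldt d * w (PI / 2) d) N * zeta_c g (phi + PI / 2) t).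
  assert (Hlim1 : is_lim_seq (rsum (fun n => ln (INR n) * w phi n)) (dirichlet (fun n => ln (INR n)) g phi t)).
  { apply dirichlet_is_series; [exact ln_bound|easy]. }
  assert (Hlim2 : is_lim_seq B
    (mangoldt_c g 0 t * zeta_c g phi t - mangoldt_c g (PI / 2) t * zeta_c g (phi + PI / 2) t)).
  { apply is_lim_seq_minus'; (apply is_lim_seq_mult'; [|apply is_lim_seq_const]);
      apply dirichlet_is_series; (exact vonMangoldt_bound || easy). }
  (* Completing the inner sum beyond [N / d] costs [O(d / N)]. With [Lambda(d) <= d] and
     [|d^(-s)| <= d^(-5)] the total is at most [2/N] times [sum d^(-3)], and that sum is at most
     [3/2]. *)
  assert (Herr : forall N, (1 <= N)%nat -> Rabs (rsum (fun n => ln (INR n) * w phi n) N -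
    B N) <= 3 * / INR N).
  { intros N HN. rewrite Hfin. unfold B.
    rewrite (Rmult_comm _ (zeta_c g phi t)), (Rmult_comm _ (zeta_c g (phi + PI / 2) t)).
    rewrite <- !rsum_scal, <- !rsum_minus.
    assert (HNp : 1 <= INR N) by now apply INR_ge1.
    assert (HiN : 0 < / INR N) by (apply Rinv_0_lt_compat; lra).
    eapply Rle_trans; [apply rsum_Rabs|].
    apply Rle_trans with (rsum (fun d => 2 * / INR N * Rpower (INR d) (- (2) - 1)) N).
    - apply rsum_le. intros d Hd.
      assert (HM : (1 <= N / d)%nat) by (apply Nat.div_le_lower_bound; lia).
      set (M := (N / d)%nat) in *.
      pose proof (zeta_c_tail g phi t M Ht HM) as T1.
      pose proof (zeta_c_tail g (phi + PI / 2) t M Ht HM) as T2.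
      fold (w phi) in T1. fold (w (phi + PI / 2)) in T2. fold (S phi M) in T1. fold (S (phi + PI / 2) M) in T2.
      assert (HMR : 1 <= INR M) by now apply INR_ge1.
      assert (HdR : 1 <= INR d) by (apply INR_ge1; lia).
      (* [N < d * (M + 1)], and [M + 1 <= 2 * M] because [d <= N] makes the quotient positive. *)
      assert (HdM : INR N <= 2 * INR d * INR M).
      { rewrite <- mult_INR || idtac. change 2 with (INR 2). rewrite <- !mult_INR. apply le_INR.
        pose proof (Nat.div_mod N d ltac:(lia)) as E1. fold M in E1.
        pose proof (Nat.mod_upper_bound N d ltac:(lia)) as E2. nia. }
      assert (HiM : / 2 * / INR M <= INR d * / INR N).
      { apply Rmult_le_reg_r with (INR N * (2 * INR M)); [apply Rmult_lt_0_compat; lra|].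
        replace (/ 2 * / INR M * (INR N * (2 * INR M))) with (INR N) by (field; lra).
        replace (INR d * / INR N * (INR N * (2 * INR M))) with (2 * INR d * INR M) by (field; lra). easy. }
      assert (Hw : forall p, Rabs (w p d) <= Rpower (INR d) (- 5)).
      { intros p. destruct d as [|d]; [lia|]. apply wave_bound. apply Rabs_lt_between in Ht. lra. }
      pose proof (vonMangoldt_bound d ltac:(lia)) as HL.
      match goal with |- Rabs ?e <= _ => replace e with
        (vonMangoldt d * (w 0%R d * - (zeta_c g phi t - S phi M) + w (PI / 2) d * (zeta_c g (phi + PI / 2) t - S (phi + PI / 2) M))) by ring end.
      rewrite Rabs_mult.
      apply Rle_trans with (INR d * (Rpower (INR d) (- 5) * (INR d * / INR N) + Rpower (INR d) (- 5) * (INR d * / INR N))).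
      + apply Rmult_le_compat; [apply Rabs_pos|apply Rabs_pos|easy|].
        eapply Rle_trans; [apply Rabs_triang|]. rewrite !Rabs_mult, Rabs_Ropp.
        apply Rplus_le_compat; (apply Rmult_le_compat; [apply Rabs_pos|apply Rabs_pos|apply Hw|lra]).
      + replace (- (2) - 1) with (1 + (1 + - 5)) by ring. rewrite !Rpower_plus, !Rpower_1 by lra.
        right; ring.
    - rewrite rsum_scal.
      pose proof (rsum_Rpower_bound 2 1 N ltac:(lra) ltac:(lia)) as HB.
      change (rsum (fun n => Rpower (INR n) (- (2) - 1)) 1) with (0 + Rpower 1 (- (2) - 1)) in HB.
      change (INR 1) with 1 in HB. rewrite !Rpower_base_1 in HB.
      assert (0 < Rpower (INR N) (- (2))) by apply exp_pos.
      assert (rsum (fun n => Rpower (INR n) (- (2) - 1)) N <= 3 / 2) by lra.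
      replace (3 * / INR N) with (2 * / INR N * (3 / 2)) by (field; lra).
      apply Rmult_le_compat_l; lra. }
  assert (Hz : is_lim_seq (fun N => rsum (fun n => ln (INR n) * w phi n) N -
    B N) 0).
  { apply is_lim_seq_abs_0.
    apply (is_lim_seq_le_le_loc (fun _ => 0) _ (fun N => 3 * / INR N));
      [|apply is_lim_seq_const|apply is_lim_seq_inv_INR].
    exists 1%nat. intros N HN. split; [apply Rabs_pos|now apply Herr]. }
  pose proof (is_lim_seq_minus' _ _ _ _ Hlim1 Hlim2) as H1.
  pose proof (is_lim_seq_unique _ _ H1) as U1. pose proof (is_lim_seq_unique _ _ Hz) as U2.
  rewrite U1 in U2. injection U2. lra.
Qed.

(* Components of [(s - 1) zeta(s)] at [s = 6 - t + i g]. *)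
Definition xi_c (g phi t : R) : R := cos phi + Series (fun n => zeta_term (5 - t) g phi (S n)).

Lemma wave_succ a g phi n : (1 <= n)%nat ->
  / INR n * wave a g phi (ln (INR n)) = wave (a + 1) g phi (ln (INR n)).
Proof.
  intros Hn. unfold wave. replace (- (a + 1) * ln (INR n)) with (- ln (INR n) + - a * ln (INR n)) by ring.
  rewrite exp_plus, exp_Ropp, exp_ln by (apply lt_0_INR; lia). ring.
Qed.

(** The differences of [n^(1-s)] telescope to [(N+1)^(1-s) - 1]; what remains is [s - 1] times a
    partial sum of [n^(-s)]. *)
Lemma rsum_zeta_term a g phi N : rsum (zeta_term a g phi) N =
  wave a g phi (ln (INR (S N))) - cos phi
  + a * rsum (fun n => wave (a + 1) g phi (ln (INR n))) N
  - g * rsum (fun n => wave (a + 1) g (phi + PI / 2) (ln (INR n))) N.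
Proof.
  induction N as [|N IH].
  - cbn [rsum]. change (INR 1) with 1. rewrite ln_1. unfold wave.
    rewrite !Rmult_0_r, exp_0, Rplus_0_l. ring.
  - cbn [rsum]. rewrite IH. unfold zeta_term.
    rewrite <- !(wave_succ a) by lia. ring.
Qed.

Lemma is_lim_seq_Rpower_neg e : 0 < e -> is_lim_seq (fun n => Rpower (INR (S n)) (- e)) 0.
Proof.
  intros He. apply (is_lim_seq_ext (fun n => / Rpower (INR (S n)) e)); [intros; now rewrite Rpower_Ropp|].
  apply (is_lim_seq_inv _ p_infty); [|easy].
  apply (is_lim_seq_le_p_loc (fun n => e * ln (INR (S n)))).
  - exists 0%nat. intros n _. unfold Rpower. pose proof (exp_ineq1_le (e * ln (INR (S n)))). lra.
  - apply (is_lim_seq_scal_l _ e p_infty) || idtac.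
    replace p_infty with (Rbar_mult e p_infty).
    2:{ simpl. destruct (Rle_dec 0 e) as [h|h]; [|lra]. destruct (Rle_lt_or_eq_dec 0 e h); [easy|lra]. }
    apply is_lim_seq_scal_l.
    apply (is_lim_comp_seq ln (fun n => INR (S n)) p_infty p_infty).
    + exact is_lim_ln_p.
    + exists 0%nat. easy.
    + apply (is_lim_seq_incr_1 INR). apply is_lim_seq_INR.
Qed.

Lemma is_lim_seq_wave a g phi : 0 < a -> is_lim_seq (fun n => wave a g phi (ln (INR (S n)))) 0.
Proof.
  intros Ha. apply is_lim_seq_abs_0.
  apply (is_lim_seq_le_le (fun _ => 0) _ (fun n => Rpower (INR (S n)) (- a)));
    [|apply is_lim_seq_const|now apply is_lim_seq_Rpower_neg].
  intros n. split; [apply Rabs_pos|apply wave_bound; lra].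
Qed.

Lemma xi_c_zeta_c g phi t : Rabs t < 1 ->
  xi_c g phi t = (5 - t) * zeta_c g phi t - g * zeta_c g (phi + PI / 2) t.
Proof.
  intros Ht. assert (Htb := Ht). apply Rabs_lt_between in Htb.
  unfold xi_c. destruct (analytic_zeta_term 1 g phi ltac:(lra)) as [_ Hex].
  specialize (Hex t Ht). apply Series_correct in Hex. apply is_series_rsum in Hex.
  assert (H : is_lim_seq (rsum (zeta_term (5 - t) g phi))
     (0 - cos phi + (5 - t) * zeta_c g phi t - g * zeta_c g (phi + PI / 2) t)).
  { eapply is_lim_seq_ext; [intros N; symmetry; apply rsum_zeta_term|].
    assert (Hd : forall p, is_lim_seq (rsum (fun n => wave (5 - t + 1) g p (ln (INR n)))) (zeta_c g p t)).
    { intros p. apply (is_lim_seq_ext (rsum (fun n => 1 * wave (6 - t) g p (ln (INR n))))).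
      - intros N. apply rsum_ext. intros n _. rewrite Rmult_1_l. f_equal. ring.
      - apply dirichlet_is_series; [exact one_le_INR|lra]. }
    apply is_lim_seq_minus'; [apply is_lim_seq_plus'; [apply is_lim_seq_minus'|]|].
    - apply is_lim_seq_wave. lra.
    - apply is_lim_seq_const.
    - apply is_lim_seq_mult'; [apply is_lim_seq_const|apply Hd].
    - apply is_lim_seq_mult'; [apply is_lim_seq_const|apply Hd]. }
  apply is_lim_seq_unique in H. apply is_lim_seq_unique in Hex.
  rewrite H in Hex. injection Hex. lra.
Qed.

Definition abel_c (g phi t : R) : R := Series (fun n => Epsi (S n) *
     (wave (6 - t) g phi (ln (INR (S n))) - wave (6 - t) g phi (ln (INR (S (S n)))))).

Lemma Epsi_rsum n : Epsi n = rsum (fun m => vonMangoldt m - 1) n.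
Proof.
  unfold Epsi. rewrite psi_rsum. induction n as [|n IH]; [simpl; ring|].
  cbn [rsum]. rewrite <- IH, S_INR. ring.
Qed.

(** Summation by parts of [sum (Lambda(n) - 1) n^(-s)]. The boundary term [Epsi N * (N+1)^(-s)] is
    [O(N^(theta-2))] and disappears. *)
Lemma abel_c_eq g phi t K theta : Rabs t < 1 -> 0 < theta < 1 ->
  Epsi_bounded K theta ->
  abel_c g phi t = mangoldt_c g phi t - zeta_c g phi t.
Proof.
  intros Ht Hth HE. assert (Htb := Ht). apply Rabs_lt_between in Htb.
  set (w := fun n => wave (6 - t) g phi (ln (INR n))).
  assert (H1 : is_lim_seq (rsum (fun n => (vonMangoldt n - 1) * w n)) (mangoldt_c g phi t - zeta_c g phi t)).
  { apply (is_lim_seq_ext (fun N => rsum (fun n => vonMangoldt n * w n) N - rsum (fun n => 1 * w n) N)).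
    - intros N. rewrite <- rsum_minus. apply rsum_ext. intros; ring.
    - apply is_lim_seq_minus'; apply dirichlet_is_series; (exact vonMangoldt_bound || exact one_le_INR || lra). }
  assert (H2 : is_lim_seq (fun N => Epsi N * w (S N)) 0).
  { apply is_lim_seq_incr_1. apply is_lim_seq_abs_0.
    apply (is_lim_seq_le_le (fun _ => 0) _ (fun n => K * Rpower (INR (S n)) (- (1)))).
    - intros n. split; [apply Rabs_pos|]. rewrite Rabs_mult.
      specialize (HE (S n) ltac:(lia)).
      assert (Hw : Rabs (w (S (S n))) <= Rpower (INR (S n)) (- (2))).
      { eapply Rle_trans; [apply (wave_bound _ _ _ _ (- (2))); lra|].
        unfold Rpower. apply exp_le_compat.
        assert (ln (INR (S n)) <= ln (INR (S (S n)))) by apply ln_step. lra. }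
      apply Rle_trans with (K * Rpower (INR (S n)) theta * Rpower (INR (S n)) (- (2))).
      + apply Rmult_le_compat; [apply Rabs_pos|apply Rabs_pos|easy|easy].
      + rewrite Rmult_assoc, <- Rpower_plus.
        assert (0 <= K).
        { pose proof (Rabs_pos (Epsi (S n))). pose proof (Rpower_pos (INR (S n)) theta) as Hp. nra. }
        apply Rmult_le_compat_l; [easy|]. apply Rle_Rpower; [apply INR_S_ge1|lra].
    - apply is_lim_seq_const.
    - apply is_lim_seq_scal_0. apply is_lim_seq_Rpower_neg. lra. }
  assert (H3 : is_lim_seq (rsum (fun n => Epsi n * (w n - w (S n)))) (mangoldt_c g phi t - zeta_c g phi t - 0)).
  { eapply is_lim_seq_ext; [|exact (is_lim_seq_minus' _ _ _ _ H1 H2)].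
    intros N. cbv beta. rewrite (rsum_abel (fun m => vonMangoldt m - 1) w), <- Epsi_rsum.
    rewrite (rsum_ext (fun n => rsum (fun m => vonMangoldt m - 1) n * (w n - w (S n)))
      (fun n => Epsi n * (w n - w (S n)))); [ring|].
    intros n _. now rewrite <- Epsi_rsum. }
  apply is_series_rsum in H3. apply is_series_unique in H3. unfold abel_c.
  fold w. rewrite Rminus_0_r in H3. rewrite <- H3. apply Series_ext. intros n. reflexivity.
Qed.

(** * The differential equation for the squared modulus of [xi] *)

Lemma analytic_xi_c r g phi : 0 < r < 6 -> analytic_on r (xi_c g phi).
Proof.
  intros Hr. apply (analytic_plus r (fun _ => cos phi)); [apply analytic_const|].
  now apply analytic_zeta_term.
Qed.

Lemma analytic_lin r c d : analytic_on r (fun t => c + d * t).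
Proof.
  apply (analytic_plus r (fun _ => c) (fun t => d * t)); [apply analytic_const|].
  apply (analytic_mult r (fun _ => d) (fun t => t)); [apply analytic_const|apply analytic_id].
Qed.

Lemma zeta_c_PI g t : zeta_c g (PI / 2 + PI / 2) t = - zeta_c g 0 t.
Proof.
  unfold zeta_c, dirichlet.
  rewrite <- Series_opp. apply Series_ext. intros n. unfold wave.
  replace (PI / 2 + PI / 2) with PI by field. rewrite neg_cos, Rplus_0_r. ring.
Qed.

(** At [s = 6 + i g] the first term is [1] and the tail from [n = 2] on is at most [1/2]. *)
Lemma zeta_c_nonzero g : 0 < zeta_c g 0 0.
Proof.
  pose proof (zeta_c_tail g 0 0 1 ltac:(rewrite Rabs_R0; lra) ltac:(lia)) as H.
  cbn [rsum] in H. change (INR 1) with 1 in H. rewrite ln_1 in H. unfold wave in H.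
  rewrite !Rmult_0_r, exp_0, !Rplus_0_l, cos_0 in H. apply Rabs_le_between in H. lra.
Qed.

Definition xi_sq (g t : R) : R := xi_c g 0 t * xi_c g 0 t + xi_c g (PI / 2) t * xi_c g (PI / 2) t.

(* [|s - 1|^2] at [s = 6 - t + i g]. *)
Definition pole_sq (g t : R) : R := (5 + -1 * t) * (5 + -1 * t) + g * g.

(* [|s - 1|^2 Re ((xi - 1) / (s - 1) + D)]; here [xi = (s - 1) zeta(s)] and
   [zeta' / zeta = - (D + zeta)], so this is [- |s - 1|^2 Re (xi' / xi)]. *)
Definition xi_rate (g t : R) : R :=
  (5 + -1 * t) * (xi_c g 0 t + -1) + (g * xi_c g (PI / 2) t + pole_sq g t * abel_c g 0 t).

Lemma analytic_xi_ode g K theta : 1/2 < theta < 1 ->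
  Epsi_bounded K theta ->
  analytic_on (6 - theta) (xi_sq g) /\ analytic_on (6 - theta) (pole_sq g) /\
  analytic_on (6 - theta) (xi_rate g).
Proof.
  intros Hth HE. set (r := 6 - theta). assert (Hr : 0 < r < 6) by (unfold r; lra).
  assert (A1 : analytic_on r (xi_c g 0)) by now apply analytic_xi_c.
  assert (A2 : analytic_on r (xi_c g (PI / 2))) by now apply analytic_xi_c.
  assert (A3 : analytic_on r (abel_c g 0)) by (apply (analytic_abel Epsi K theta); [easy|lra]).
  assert (Al : analytic_on r (fun t => 5 + -1 * t)) by apply analytic_lin.
  assert (Aq : analytic_on r (pole_sq g)).
  { apply (analytic_plus r (fun t => (5 + -1 * t) * (5 + -1 * t))); [now apply analytic_mult|apply analytic_const]. }
  split; [|split; [easy|]].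
  - apply (analytic_plus r (fun t => xi_c g 0 t * xi_c g 0 t)); now apply analytic_mult.
  - apply (analytic_plus r (fun t => (5 + -1 * t) * (xi_c g 0 t + -1))).
    + apply analytic_mult; [easy|]. apply analytic_plus; [easy|apply analytic_const].
    + apply (analytic_plus r (fun t => g * xi_c g (PI / 2) t)).
      * apply (analytic_mult r (fun _ => g)); [apply analytic_const|easy].
      * now apply analytic_mult.
Qed.

(** For [Rabs t < 1] one has [|xi|^2 = |s - 1|^2 |zeta|^2], and the derivative of [|zeta|^2] is
    [2 |zeta|^2] times the real part of [sum Lambda(n) n^(-s)]; the imaginary part cancels.
    Multiplying by [pole_sq] removes every denominator, so both sides are power series on the full
    interval. *)
Lemma xi_sq_ode g t K theta : 1/2 < theta < 1 ->
  Epsi_bounded K theta ->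
  Rabs t < 6 - theta ->
  pole_sq g t * Derive (xi_sq g) t = 2 * (xi_sq g t * xi_rate g t).
Proof.
  intros Hth HE Ht.
  destruct (analytic_xi_ode g K theta Hth HE) as (AN & Aq & Am).
  revert t Ht. apply (analytic_identity (6 - theta) 1).
  - apply analytic_mult; [easy|]. now apply analytic_derive.
  - apply (analytic_mult _ (fun _ => 2)); [apply analytic_const|]. now apply analytic_mult.
  - lra.
  - intros t Ht.
    set (X1 := zeta_c g 0 t). set (X2 := zeta_c g (PI / 2) t).
    set (L1 := mangoldt_c g 0 t). set (L2 := mangoldt_c g (PI / 2) t).
    assert (E1 : forall t, Rabs t < 1 -> xi_c g 0 t = (5 - t) * zeta_c g 0 t - g * zeta_c g (PI / 2) t).
    { intros u Hu. rewrite xi_c_zeta_c by easy. now rewrite Rplus_0_l. }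
    assert (E2 : forall t, Rabs t < 1 -> xi_c g (PI / 2) t = (5 - t) * zeta_c g (PI / 2) t + g * zeta_c g 0 t).
    { intros u Hu. rewrite xi_c_zeta_c by easy. rewrite zeta_c_PI. ring. }
    assert (D1 : is_derive (zeta_c g 0) t (L1 * X1 - L2 * X2)).
    { unfold L1, X1, L2, X2. replace (zeta_c g (PI / 2) t) with (zeta_c g (0 + PI / 2) t) by (f_equal; ring).
      rewrite <- dirichlet_ln_product by easy. apply is_derive_dirichlet. lra. }
    assert (D2 : is_derive (zeta_c g (PI / 2)) t (L1 * X2 + L2 * X1)).
    { unfold L1, X1, L2, X2. replace (zeta_c g 0 t) with (- zeta_c g (PI / 2 + PI / 2) t) by (rewrite zeta_c_PI; ring).
      replace (mangoldt_c g 0 t * zeta_c g (PI / 2) t + mangoldt_c g (PI / 2) t * - zeta_c g (PI / 2 + PI / 2) t)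
        with (mangoldt_c g 0 t * zeta_c g (PI / 2) t - mangoldt_c g (PI / 2) t * zeta_c g (PI / 2 + PI / 2) t) by ring.
      rewrite <- dirichlet_ln_product by easy. apply is_derive_dirichlet. lra. }
    assert (DN : is_derive (xi_sq g) t (-2 * (5 - t) * (X1 * X1 + X2 * X2)
        + ((5 - t) * (5 - t) + g * g) * (2 * L1 * (X1 * X1 + X2 * X2)))).
    { apply (is_derive_ext_loc (fun t => ((5 - t) * (5 - t) + g * g) *
         (zeta_c g 0 t * zeta_c g 0 t + zeta_c g (PI / 2) t * zeta_c g (PI / 2) t))).
      - apply (locally_Rabs_lt 1); [easy|]. intros y Hy.
        unfold xi_sq. rewrite E1, E2 by easy.
        match goal with |- ?a = ?b => change (@eq R a b) end. ring.
      - auto_derive.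
        + repeat split; try (eexists; eassumption).
        + change (fun x : R => zeta_c g 0 x) with (zeta_c g 0).
          change (fun x : R => zeta_c g (PI / 2) x) with (zeta_c g (PI / 2)).
          rewrite (is_derive_unique _ _ _ D1), (is_derive_unique _ _ _ D2).
          fold X1 X2. ring. }
    rewrite (is_derive_unique _ _ _ DN). unfold xi_rate, xi_sq, pole_sq.
    rewrite E1, E2 by easy. rewrite (abel_c_eq g 0 t K theta) by (easy || lra).
    fold X1 X2 L1. ring.
Qed.

(** A Gronwall argument. On [[0, t]] the function [xi_rate] is bounded and [pole_sq >= g^2 > 0], so
    [|xi|^2] decays at most exponentially from its positive value at the centre and cannot reach
    zero. *)
Lemma xi_c_nonvanishing g t K theta : 1/2 < theta < 1 -> g <> 0 ->
  Epsi_bounded K theta ->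
  0 <= t < 6 - theta -> xi_c g 0 t = 0 -> xi_c g (PI / 2) t = 0 -> False.
Proof.
  intros Hth Hg HE Ht Z1 Z2. set (r := 6 - theta) in *.
  assert (Hr : 0 < r < 6) by (unfold r; lra).
  destruct (analytic_xi_ode g K theta Hth HE) as (AN & Aq & Am).
  set (N := xi_sq g) in *. set (q := pole_sq g) in *. set (m := xi_rate g) in *. fold r in AN, Aq, Am.
  assert (Hode : forall u, Rabs u < r -> q u * Derive N u = 2 * (N u * m u)).
  { intros u Hu. exact (xi_sq_ode g u K theta Hth HE Hu). }
  assert (HNd : forall u, Rabs u < r -> is_derive N u (Derive N u)) by now apply analytic_derive.
  assert (Hmd : forall u, Rabs u < r -> is_derive m u (Derive m u)) by now apply analytic_derive.
  destruct (bounded_continuity m 0 t) as [B0 HB0].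
  { intros u Hu. apply (ex_derive_continuous m). eexists. apply Hmd. rewrite Rabs_pos_eq; lra. }
  assert (Hg2 : 0 < g * g) by nra.
  assert (HN0 : 0 < N 0).
  { unfold N, xi_sq. rewrite !xi_c_zeta_c by (rewrite Rabs_R0; lra). rewrite zeta_c_PI, Rplus_0_l.
    pose proof (zeta_c_nonzero g). set (x := zeta_c g 0 0) in *. set (y := zeta_c g (PI / 2) 0).
    replace (((5 - 0) * x - g * y) * ((5 - 0) * x - g * y) + ((5 - 0) * y - g * - x) * ((5 - 0) * y - g * - x))
      with ((25 + g * g) * (x * x + y * y)) by ring.
    apply Rmult_lt_0_compat; [lra|]. nra. }
  assert (Ht0 : 0 < t).
  { destruct (Rle_lt_or_eq_dec 0 t (proj1 Ht)) as [h|h]; [easy|].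
    subst t. unfold N, xi_sq in HN0. rewrite Z1, Z2 in HN0. lra. }
  set (B := 2 * B0 / (g * g)).
  (* [N exp (B t)] is nondecreasing, so a zero of [N] would propagate back to the centre. *)
  destruct (MVT_is_derive (fun u => N u * exp (B * u))
    (fun u => Derive N u * exp (B * u) + N u * (B * exp (B * u))) 0 t) as (c & Hc & Hce); [lra| |].
  - intros u Hu.
    apply (is_derive_mult N (fun u => exp (B * u))); [apply HNd; rewrite Rabs_pos_eq; lra| |apply Rmult_comm].
    auto_derive; [easy|ring].
  - assert (HNt : N t = 0) by (unfold N, xi_sq; rewrite Z1, Z2; ring).
    rewrite HNt, Rmult_0_r, exp_0 in Hce.
    specialize (HB0 c Hc). unfold norm in HB0; simpl in HB0; unfold abs in HB0; simpl in HB0.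
    specialize (Hode c ltac:(rewrite Rabs_pos_eq; lra)).
    assert (HNc : 0 <= N c) by (unfold N, xi_sq; nra).
    assert (Hqc : g * g <= q c) by (unfold q, pole_sq; pose proof (Rle_0_sqr (5 + -1 * c)) as Hs; unfold Rsqr in Hs; lra).
    apply Rabs_def2 in HB0.
    assert (HBq : 2 * B0 <= B * q c).
    { unfold B. assert (0 <= 2 * B0 / (g * g)) by (apply Rdiv_le_0_compat; lra).
      apply Rle_trans with (2 * B0 / (g * g) * (g * g)); [right; field; easy|].
      apply Rmult_le_compat_l; lra. }
    assert (Hpos : 0 <= q c * (Derive N c + N c * B)).
    { rewrite Rmult_plus_distr_l, Hode.
      replace (2 * (N c * m c) + q c * (N c * B)) with (N c * (2 * m c + B * q c)) by ring.
      apply Rmult_le_pos; lra. }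
    assert (Hpos2 : 0 <= Derive N c + N c * B).
    { apply Rmult_le_reg_l with (q c); [lra|]. lra. }
    pose proof (exp_pos (B * c)).
    assert (0 <= (Derive N c + N c * B) * exp (B * c)) by (apply Rmult_le_pos; lra).
    nra.
Qed.

(** * The Fourier series of the quadratic sawtooth *)

Lemma derive_bound (h dh : R -> R) (D a b : R) : a <= b ->
  (forall t, a <= t <= b -> is_derive h t (dh t) /\ Rabs (dh t) <= D) ->
  Rabs (h b - h a) <= D * (b - a).
Proof.
  intros Hab H. destruct (MVT_is_derive h dh a b Hab) as (c & Hc & He); [intros; now apply H|].
  rewrite He, Rabs_mult, (Rabs_pos_eq (b - a)) by lra.
  apply Rmult_le_compat_r; [lra|]. now apply H.
Qed.

Definition fejer_term (x : R) (n : nat) : R := (sin (PI * INR n * x)) ^ 2 / (PI * INR n) ^ 2.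

Lemma sin_PI_INR n : sin (PI * INR n) = 0.
Proof. apply sin_eq_0_1. exists (Z.of_nat n). rewrite INR_IZR_INZ. ring. Qed.

Lemma dirichlet_kernel N x :
  sin (PI * x) * (1 + 2 * rsum (fun n => cos (2 * (PI * INR n * x))) N) = sin ((2 * INR N + 1) * PI * x).
Proof.
  induction N as [|N IH].
  - simpl rsum. simpl INR. replace ((2 * 0 + 1) * PI * x) with (PI * x) by ring. ring.
  - cbn [rsum].
    replace (sin (PI * x) * (1 + 2 * (rsum (fun n => cos (2 * (PI * INR n * x))) N + cos (2 * (PI * INR (S N) * x)))))
      with (sin (PI * x) * (1 + 2 * rsum (fun n => cos (2 * (PI * INR n * x))) N) + 2 * sin (PI * x) * cos (2 * (PI * INR (S N) * x))) by ring.
    rewrite IH. rewrite S_INR.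
    replace ((2 * INR N + 1) * PI * x) with (2 * (PI * (INR N + 1) * x) - PI * x) by ring.
    replace ((2 * (INR N + 1) + 1) * PI * x) with (2 * (PI * (INR N + 1) * x) + PI * x) by ring.
    rewrite sin_minus, sin_plus. ring.
Qed.

Lemma is_derive_rsum (f df : nat -> R -> R) N x :
  (forall n, (1 <= n <= N)%nat -> is_derive (f n) x (df n x)) ->
  is_derive (fun x => rsum (fun n => f n x) N) x (rsum (fun n => df n x) N).
Proof.
  induction N as [|N IH]; intros H.
  - cbn [rsum]. exact (is_derive_const (K := R_AbsRing) (V := R_NormedModule) 0 x).
  - cbn [rsum]. apply (is_derive_plus (fun x => rsum (fun n => f n x) N) (f (S N))).
    + apply IH. intros; apply H; lia.
    + apply H. lia.
Qed.

(** Two derivatives lead to minus the Dirichlet kernel, whose closed form is known; [fourier_err1]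
    is the intermediate stage. *)
Definition fourier_err (N : nat) (x : R) : R := x / 2 - x ^ 2 / 2 - rsum (fejer_term x) N.
Definition fourier_err1 (N : nat) (x : R) : R :=
  1 / 2 - x - rsum (fun n => / (PI * INR n) * sin (2 * (PI * INR n * x))) N.

Lemma is_derive_fourier_err N x : is_derive (fourier_err N) x (fourier_err1 N x).
Proof.
  apply (is_derive_minus (fun x => x / 2 - x ^ 2 / 2) (fun x => rsum (fejer_term x) N)).
  - auto_derive; [easy|]. field.
  - apply (is_derive_rsum (fun n x => fejer_term x n) (fun n x => / (PI * INR n) * sin (2 * (PI * INR n * x)))).
    intros n Hn. unfold fejer_term.
    assert (0 < PI * INR n) by (apply Rmult_lt_0_compat; [apply PI_RGT_0|apply lt_0_INR; lia]).
    set (p := PI * INR n) in *.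
    auto_derive; [easy|]. rewrite sin_2a. field. lra.
Qed.

Lemma is_derive_fourier_err1 N x : is_derive (fourier_err1 N) x
  (- (1 + 2 * rsum (fun n => cos (2 * (PI * INR n * x))) N)).
Proof.
  replace (- (1 + 2 * rsum (fun n => cos (2 * (PI * INR n * x))) N))
    with (-1 - rsum (fun n => 2 * cos (2 * (PI * INR n * x))) N) by (rewrite rsum_scal; ring).
  apply (is_derive_minus (fun x => 1 / 2 - x)).
  - auto_derive; [easy|ring].
  - apply (is_derive_rsum (fun n x => / (PI * INR n) * sin (2 * (PI * INR n * x))) (fun n x => 2 * cos (2 * (PI * INR n * x)))).
    intros n Hn.
    assert (0 < PI * INR n) by (apply Rmult_lt_0_compat; [apply PI_RGT_0|apply lt_0_INR; lia]).
    set (p := PI * INR n) in *.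
    auto_derive; [easy|]. field. lra.
Qed.

Lemma sin_PI_lower d x : 0 < d <= 1 / 2 -> d <= x <= 1 - d -> sin (PI * d) <= sin (PI * x).
Proof.
  intros Hd Hx. pose proof PI_RGT_0 as HPI.
  destruct (Rle_dec x (1 / 2)) as [h|h].
  - apply sin_incr_1; nra.
  - replace (sin (PI * x)) with (sin (PI * (1 - x))).
    + apply sin_incr_1; nra.
    + replace (PI * (1 - x)) with (PI - PI * x) by ring. apply sin_PI_x.
Qed.

Lemma cos_odd_half N : cos ((2 * INR N + 1) * PI * (1 / 2)) = 0.
Proof.
  apply cos_eq_0_1. exists (Z.of_nat N). rewrite INR_IZR_INZ. field.
Qed.

(** The derivative of [fourier_err1] is [- sin (c x) / sin (PI x)], an oscillation of frequency [c].
    One integration by parts, started at the zero [x = 1/2], gains the factor [1 / (2 N + 1)] away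
    from the integers. *)
Lemma fourier_err1_bound N d x : 0 < d <= 1 / 2 -> d <= x <= 1 - d ->
  Rabs (fourier_err1 N x) <= (/ (sin (PI * d)) ^ 2 + / sin (PI * d)) * / (2 * INR N + 1).
Proof.
  intros Hd Hx. pose proof PI_RGT_0 as HPI. pose proof (pos_INR N) as HN.
  set (m := sin (PI * d)). assert (Hm : 0 < m) by (apply sin_gt_0; nra).
  set (c := (2 * INR N + 1) * PI). assert (Hc : 0 < c) by (unfold c; nra).
  set (k := 2 * INR N + 1) in *. assert (Hk : 0 < k) by (unfold k; lra).
  assert (Hms : forall y, d <= y <= 1 - d -> m <= sin (PI * y)) by (intros; now apply sin_PI_lower).
  (* The boundary term of that integration by parts: adding [b] cancels the oscillating derivative
     up to [O(1/k)], and [b] vanishes at [1/2] because [cos (c / 2) = 0]. *)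
  set (b := fun y => - cos (c * y) / (c * sin (PI * y))).
  assert (Hd1 : forall y, d <= y <= 1 - d ->
    is_derive (fun y => fourier_err1 N y + b y) y (cos (c * y) * cos (PI * y) / (k * (sin (PI * y)) ^ 2))).
  { intros y Hy. specialize (Hms y Hy).
    replace (cos (c * y) * cos (PI * y) / (k * (sin (PI * y)) ^ 2)) with
      (- (1 + 2 * rsum (fun n => cos (2 * (PI * INR n * y))) N) +
        (sin (c * y) / sin (PI * y) + cos (c * y) * (PI * cos (PI * y)) / (c * (sin (PI * y)) ^ 2))).
    - apply (is_derive_plus (fourier_err1 N) b); [apply is_derive_fourier_err1|].
      unfold b. auto_derive; [nra|]. field. split; lra.
    - pose proof (dirichlet_kernel N y) as HD. fold k c in HD.
      replace (sin (c * y) / sin (PI * y)) with (1 + 2 * rsum (fun n => cos (2 * (PI * INR n * y))) N).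
      + unfold c. field. repeat split; lra.
      + rewrite <- HD. field. lra. }
  assert (Hm2 : 0 < m ^ 2) by (apply pow_lt; lra).
  assert (Hbound : forall y, d <= y <= 1 - d ->
    Rabs (cos (c * y) * cos (PI * y) / (k * (sin (PI * y)) ^ 2)) <= / m ^ 2 * / k).
  { intros y Hy. specialize (Hms y Hy). unfold Rdiv. rewrite !Rabs_mult.
    assert (Rabs (cos (c * y)) <= 1) by (apply Rabs_le, COS_bound).
    assert (Rabs (cos (PI * y)) <= 1) by (apply Rabs_le, COS_bound).
    assert (Hs2 : m ^ 2 <= sin (PI * y) ^ 2) by (apply pow_incr; lra).
    rewrite (Rabs_pos_eq (/ (k * _))) by (left; apply Rinv_0_lt_compat; nra).
    replace (/ m ^ 2 * / k) with (1 * / (k * m ^ 2)) by (field; split; nra).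
    pose proof (Rabs_pos (cos (c * y))). pose proof (Rabs_pos (cos (PI * y))).
    apply Rmult_le_compat; [nra|left; apply Rinv_0_lt_compat; nra|nra|].
    apply Rinv_le_contravar; nra. }
  assert (Hhalf : fourier_err1 N (1 / 2) + b (1 / 2) = 0).
  { unfold fourier_err1, b, c, k. rewrite cos_odd_half.
    rewrite rsum_zero; [unfold Rdiv; ring|]. intros n Hn.
    replace (2 * (PI * INR n * (1 / 2))) with (PI * INR n) by field. rewrite sin_PI_INR. ring. }
  assert (Hsum : Rabs (fourier_err1 N x + b x) <= / m ^ 2 * / k).
  { replace (fourier_err1 N x + b x) with ((fourier_err1 N x + b x) - (fourier_err1 N (1/2) + b (1/2))) by lra.
    assert (Hxx : Rabs (x - 1 / 2) <= 1) by (apply Rabs_le; lra).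
    eapply Rle_trans.
    - apply (bounded_variation (fun y => fourier_err1 N y + b y)
        (fun y => cos (c * y) * cos (PI * y) / (k * (sin (PI * y)) ^ 2)) (/ m ^ 2 * / k) (1/2) x).
      intros y Hy. assert (d <= y <= 1 - d).
      { assert (Rabs (x - 1/2) <= 1/2 - d) by (apply Rabs_le; lra).
        assert (Hy' : Rabs (y - 1/2) <= 1/2 - d) by lra. apply Rabs_le_between in Hy'. lra. }
      split; [now apply Hd1|now apply Hbound].
    - assert (0 < / m ^ 2 * / k) by (apply Rmult_lt_0_compat; apply Rinv_0_lt_compat; lra).
      pose proof (Rabs_pos (x - 1/2)). nra. }
  assert (Hb : Rabs (b x) <= / m * / k).
  { unfold b, Rdiv. rewrite Rabs_mult, Rabs_Ropp. specialize (Hms x Hx).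
    assert (Rabs (cos (c * x)) <= 1) by (apply Rabs_le, COS_bound).
    rewrite (Rabs_pos_eq (/ (c * _))) by (left; apply Rinv_0_lt_compat; nra).
    replace (/ m * / k) with (1 * / (k * m)) by (field; split; lra).
    apply Rmult_le_compat; [apply Rabs_pos|left; apply Rinv_0_lt_compat; nra|easy|].
    apply Rinv_le_contravar; [nra|].
    assert (k <= c). { unfold c. pose proof PI2_3_2. unfold PI in *. nra. }
    apply Rmult_le_compat; lra. }
  replace (fourier_err1 N x) with ((fourier_err1 N x + b x) + - b x) by ring.
  eapply Rle_trans; [apply Rabs_triang|]. rewrite Rabs_Ropp. lra.
Qed.

Lemma fejer_term_ge0 x n : 0 <= fejer_term x n.
Proof.
  unfold fejer_term. unfold Rdiv. apply Rmult_le_pos; [apply pow2_ge_0|].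
  destruct (Req_dec ((PI * INR n) ^ 2) 0) as [h|h].
  - rewrite h, Rinv_0. lra.
  - left. apply Rinv_0_lt_compat. pose proof (pow2_ge_0 (PI * INR n)). lra.
Qed.

Lemma PI_gt_1 : 1 < PI.
Proof. pose proof PI2_3_2. unfold PI2 in *. lra. Qed.

Lemma fejer_term_le x n : (1 <= n)%nat -> fejer_term x n <= Rpower (INR n) (- (1) - 1).
Proof.
  intros Hn. assert (Hp : 0 < INR n) by (apply lt_0_INR; lia). pose proof PI_gt_1.
  unfold fejer_term. replace (- (1) - 1) with (- INR 2) by (simpl; ring).
  rewrite Rpower_Ropp, Rpower_pow by easy.
  replace (/ INR n ^ 2) with (1 / INR n ^ 2) by (field; lra).
  unfold Rdiv. apply Rmult_le_compat.
  - apply pow2_ge_0.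
  - left. apply Rinv_0_lt_compat, pow_lt. nra.
  - pose proof (SIN_bound (PI * INR n * x)). nra.
  - apply Rinv_le_contravar; [apply pow_lt; easy|]. apply pow_incr. nra.
Qed.

Lemma abs_sin_le x : 0 <= x -> Rabs (sin x) <= x.
Proof.
  intros Hx. destruct (Req_dec x 0) as [->|Hx0]; [rewrite sin_0, Rabs_R0; lra|].
  pose proof PI_gt_1. pose proof (SIN_bound x). pose proof (sin_lt_x x ltac:(lra)).
  apply Rabs_le. split; [|lra].
  destruct (Rle_dec x 1); [|lra]. pose proof (sin_ge_0 x ltac:(lra) ltac:(lra)). lra.
Qed.

Lemma sin2_le_sqrt y : 0 <= y -> (sin y) ^ 2 <= sqrt y.
Proof.
  intros Hy. destruct (Rle_dec y 1) as [h|h].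
  - pose proof (abs_sin_le y Hy).
    assert (Hs : y <= sqrt y).
    { rewrite <- (sqrt_square y) at 1 by easy. apply sqrt_le_1_alt. nra. }
    rewrite <- (pow2_abs (sin y)). pose proof (Rabs_pos (sin y)). nra.
  - assert (1 <= sqrt y) by (rewrite <- sqrt_1; apply sqrt_le_1_alt; lra).
    pose proof (SIN_bound y). nra.
Qed.

(** The square root is a compromise: it is small for small [x] and still leaves the summable power
    [n^(-3/2)]. This makes the series small near [0], where [fourier_err1_bound] breaks down. *)
Lemma fejer_term_le_sqrt x n : 0 < x -> (1 <= n)%nat ->
  fejer_term x n <= sqrt x * Rpower (INR n) (- (1 / 2) - 1).
Proof.
  intros Hx Hn. assert (Hp : 0 < INR n) by (apply lt_0_INR; lia). pose proof PI_gt_1.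
  assert (Hpn : 0 < PI * INR n) by nra.
  unfold fejer_term.
  apply Rle_trans with (sqrt (PI * INR n * x) / (PI * INR n) ^ 2).
  - unfold Rdiv. apply Rmult_le_compat_r; [left; apply Rinv_0_lt_compat, pow_lt; easy|].
    apply sin2_le_sqrt. nra.
  - rewrite sqrt_mult by lra.
    replace (sqrt (PI * INR n) * sqrt x / (PI * INR n) ^ 2) with (sqrt x * Rpower (PI * INR n) (- (1 / 2) - 1)).
    + apply Rmult_le_compat_l; [apply sqrt_pos|]. unfold Rpower. apply exp_le_compat.
      assert (ln (INR n) <= ln (PI * INR n)) by (apply ln_le; nra). lra.
    + replace (- (1 / 2) - 1) with (/ 2 + - INR 2) by (simpl; field).
      rewrite Rpower_plus, Rpower_Ropp, Rpower_pow, Rpower_sqrt by easy. unfold Rdiv. ring.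
Qed.

Lemma fejer_series_ex x : exists l : R, is_lim_seq (rsum (fejer_term x)) l.
Proof.
  destruct (ex_lim_seq_rsum_bounded (fejer_term x) (1 + / 1)) as (l & Hl & _).
  - intros; apply fejer_term_ge0.
  - intros N. eapply Rle_trans; [|apply (rsum_Rpower_le 1 N); lra].
    apply rsum_le. intros n Hn. apply fejer_term_le. lia.
  - now exists l.
Qed.

(** At the ends all terms vanish. Inside, the errors at [x] and at a small [d] differ by a quantity
    tending to zero, and the limiting error at [d] is [O(sqrt d)]; so the limiting error at [x] is
    below every [eps]. *)
Lemma fejer_series_unit x : 0 <= x <= 1 -> is_lim_seq (rsum (fejer_term x)) (x / 2 - x ^ 2 / 2).
Proof.
  intros Hx.
  destruct (Req_dec x 0) as [->|Hx0]; [|destruct (Req_dec x 1) as [->|Hx1]].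
  1,2: apply (is_lim_seq_ext (fun _ => 0)); [intros N; symmetry; apply rsum_zero; intros n Hn; unfold fejer_term;
      rewrite ?Rmult_0_r, ?Rmult_1_r, ?sin_0, ?sin_PI_INR; unfold Rdiv; ring|];
    match goal with |- is_lim_seq _ (Finite ?e) => replace e with 0 by field end; apply is_lim_seq_const.
  destruct (fejer_series_ex x) as [l Hl].
  assert (HE : forall y, 0 <= y <= 1 -> forall ly : R, is_lim_seq (rsum (fejer_term y)) ly ->
     is_lim_seq (fun N => fourier_err N y) (y / 2 - y ^ 2 / 2 - ly)).
  { intros y Hy ly Hly. apply is_lim_seq_minus'; [apply is_lim_seq_const|easy]. }
  assert (Hzero : forall eps, 0 < eps -> Rabs (x / 2 - x ^ 2 / 2 - l) <= eps).
  { intros eps Heps.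
    (* The first two entries place [x] in [[d, 1 - d]]; the last gives [3 * sqrt d <= 3/5 * eps],
       with [3 = 1 + 1/(1/2)] from the sum of [n^(-3/2)]. *)
    set (d := Rmin (Rmin x (1 - x)) (Rmin (1/2) ((eps / 5) ^ 2))).
    assert (Hd1 : d <= Rmin x (1 - x)) by apply Rmin_l.
    assert (Hd2 : d <= Rmin (1/2) ((eps/5) ^ 2)) by apply Rmin_r.
    assert (Hd3 := Rmin_l x (1 - x)). assert (Hd4 := Rmin_r x (1 - x)).
    assert (Hd5 := Rmin_l (1/2) ((eps/5)^2)). assert (Hd6 := Rmin_r (1/2) ((eps/5)^2)).
    assert (Hd : 0 < d).
    { unfold d. assert (0 < (eps / 5) ^ 2) by (apply pow_lt; lra).
      repeat apply Rmin_glb_lt; lra. }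
    destruct (fejer_series_ex d) as [ld Hld].
    assert (Hsd : sqrt d <= eps / 5).
    { rewrite <- (sqrt_pow2 (eps / 5)) by lra. apply sqrt_le_1_alt. lra. }
    assert (Hsd1 : d <= sqrt d).
    { rewrite <- (sqrt_square d) at 1 by lra. apply sqrt_le_1_alt. nra. }
    assert (Hld0 : 0 <= ld <= 3 * sqrt d).
    { split.
      - apply (is_lim_seq_le (fun _ => 0) (rsum (fejer_term d)) 0 ld); [|apply is_lim_seq_const|easy].
        intros N. apply rsum_ge0. intros; apply fejer_term_ge0.
      - apply (is_lim_seq_le (rsum (fejer_term d)) (fun _ => 3 * sqrt d) ld (3 * sqrt d)); [|easy|apply is_lim_seq_const].
        intros N. apply Rle_trans with (rsum (fun n => sqrt d * Rpower (INR n) (- (1/2) - 1)) N).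
        + apply rsum_le. intros n Hn. apply fejer_term_le_sqrt; [easy|lia].
        + rewrite rsum_scal. pose proof (rsum_Rpower_le (1/2) N ltac:(lra)).
          pose proof (sqrt_pos d). nra. }
    assert (Hlim : is_lim_seq (fun N => fourier_err N x - fourier_err N d)
       ((x / 2 - x ^ 2 / 2 - l) - (d / 2 - d ^ 2 / 2 - ld))).
    { apply is_lim_seq_minus'; apply HE; [easy|easy|lra|easy]. }
    set (Cd := / (sin (PI * d)) ^ 2 + / sin (PI * d)).
    assert (Hlim0 : is_lim_seq (fun N => fourier_err N x - fourier_err N d) 0).
    { apply is_lim_seq_abs_0.
      apply (is_lim_seq_le_le_loc (fun _ => 0) _ (fun N => Cd * / INR N)).
      - exists 1%nat. intros N HN. split; [apply Rabs_pos|].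
        assert (HNp : 0 < INR N) by (apply lt_0_INR; lia).
        assert (HC : 0 <= Cd).
        { assert (0 < sin (PI * d)) by (apply sin_gt_0; pose proof PI_RGT_0; nra).
          unfold Cd. assert (0 < / sin (PI * d)) by (apply Rinv_0_lt_compat; easy).
          assert (0 < / sin (PI * d) ^ 2) by (apply Rinv_0_lt_compat, pow_lt; easy). lra. }
        eapply Rle_trans.
        + apply (derive_bound (fourier_err N) (fourier_err1 N) (Cd * / (2 * INR N + 1)) d x); [lra|].
          intros y Hy. split; [apply is_derive_fourier_err|].
          apply fourier_err1_bound; lra.
        + apply Rle_trans with (Cd * / (2 * INR N + 1) * 1).
          * apply Rmult_le_compat_l; [|lra].
            apply Rmult_le_pos; [easy|]. left. apply Rinv_0_lt_compat. lra.
          * rewrite Rmult_1_r. apply Rmult_le_compat_l; [easy|]. apply Rinv_le_contravar; lra.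
      - apply is_lim_seq_const.
      - apply is_lim_seq_inv_INR. }
    apply is_lim_seq_unique in Hlim. apply is_lim_seq_unique in Hlim0.
    rewrite Hlim in Hlim0. injection Hlim0 as Heq.
    apply Rabs_le. nra. }
  assert (Heq : l = x / 2 - x ^ 2 / 2).
  { destruct (Req_dec (x / 2 - x ^ 2 / 2 - l) 0) as [h|h]; [lra|].
    apply Rabs_pos_lt in h. specialize (Hzero (Rabs (x / 2 - x ^ 2 / 2 - l) / 2) ltac:(lra)). lra. }
  rewrite <- Heq. easy.
Qed.

(** * Complex powers, sums and primitives *)

Lemma derive_compare (f df g dg : R -> R) (a b : R) : a <= b ->
  (forall t, a <= t <= b -> is_derive f t (df t) /\ is_derive g t (dg t) /\ Rabs (df t) <= dg t) ->
  Rabs (f b - f a) <= g b - g a.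
Proof.
  intros Hab H.
  assert (Hc : forall e : R, Rabs e = 1 -> 0 <= (g b - g a) + e * (f b - f a)).
  { intros e He.
    destruct (MVT_is_derive (fun t => g t + e * f t) (fun t => dg t + e * df t) a b Hab) as (c & Hc & Hce).
    - intros y Hy. destruct (H y Hy) as (H1 & H2 & _).
      apply (is_derive_plus g (fun t => e * f t)); [easy|]. now apply (is_derive_scal f).
    - destruct (H c Hc) as (_ & _ & H3).
      assert (Rabs (e * df c) <= dg c) by (rewrite Rabs_mult, He, Rmult_1_l; easy).
      apply Rabs_le_between in H0.
      assert (0 <= (dg c + e * df c) * (b - a)) by (apply Rmult_le_pos; lra). lra. }
  pose proof (Hc 1 Rabs_R1). pose proof (Hc (-1) ltac:(rewrite Rabs_m1; easy)).
  apply Rabs_le. lra.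
Qed.

(** The substitution [y = exp u] moves the half-line to all of [R], where a continuous integrand has
    a primitive without any restriction on the end points. *)
Lemma ex_primitive_pos (f : R -> R) : (forall y, 0 < y -> continuous f y) ->
  exists F : R -> R, forall y, 0 < y -> is_derive F y (f y).
Proof.
  intros Hf. set (h := fun u => f (exp u) * exp u).
  assert (Hh : forall u, continuous h u).
  { intros u. apply (continuous_mult (fun u => f (exp u)) exp).
    - apply (continuous_comp exp f); [|apply Hf, exp_pos].
      apply (ex_derive_continuous exp). eexists. apply is_derive_exp.
    - apply (ex_derive_continuous exp). eexists. apply is_derive_exp. }
  set (G := fun u => RInt h 0 u).
  assert (HG : forall u, is_derive G u (h u)).
  { intros u. apply (is_derive_RInt h G 0).
    - apply filter_forall. intros x. apply (RInt_correct h).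
      apply (ex_RInt_continuous h). intros; apply Hh.
    - apply Hh. }
  exists (fun y => G (ln y)). intros y Hy.
  replace (f y) with (/ y * h (ln y)).
  - apply (is_derive_comp G ln); [apply HG|]. apply is_derive_Reals, derivable_pt_lim_ln. easy.
  - unfold h. rewrite exp_ln by easy. field. lra.
Qed.

(** [F y] stands for the improper integral of [f] over [[y, +oo)]. A primitive [G] is compared with
    the primitive [- y^(-e) / e] of the majorant, hence is Cauchy along the integers, and [F] is its
    limit minus [G]. *)
Lemma ex_tail_primitive (f : R -> R) (e : R) : 0 < e -> (forall y, 0 < y -> continuous f y) ->
  (forall y, 0 < y -> Rabs (f y) <= Rpower y (- e - 1)) ->
  exists F : R -> R, forall y, 0 < y -> is_derive F y (- f y) /\ Rabs (F y) <= / e * Rpower y (- e).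
Proof.
  intros He Hc Hb. destruct (ex_primitive_pos f Hc) as [G HG].
  set (q := fun y => - / e * Rpower y (- e)).
  assert (Hq : forall y, 0 < y -> is_derive q y (Rpower y (- e - 1))).
  { intros y Hy. replace (Rpower y (- e - 1)) with (- / e * (- e * Rpower y (- e - 1))) by (field; lra).
    apply (is_derive_scal (fun y => Rpower y (- e))). now apply is_derive_Rpower. }
  assert (Hcomp : forall a b, 0 < a <= b -> Rabs (G b - G a) <= q b - q a).
  { intros a b Hab. apply (derive_compare G f q (fun y => Rpower y (- e - 1))); [lra|].
    intros t Ht. split; [apply HG; lra|split; [apply Hq; lra|apply Hb; lra]]. }
  assert (Hie : 0 < / e) by (apply Rinv_0_lt_compat; easy).
  assert (Hq0 : forall y, q y <= 0).
  { intros y. unfold q. pose proof (Rpower_pos y (- e)) as Hp. nra. }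
  assert (Hlq : is_lim_seq (fun n => q (INR (S n))) 0).
  { apply is_lim_seq_scal_0. now apply is_lim_seq_Rpower_neg. }
  assert (Hex : exists l : R, is_lim_seq (fun n => G (INR (S n))) l).
  { assert (HCau : ex_lim_seq_cauchy (fun n => G (INR (S n)))).
    { intros eps. apply is_lim_seq_spec in Hlq. destruct (Hlq eps) as [N0 HN0].
      exists N0.
      assert (Hmain : forall n m, (N0 <= n)%nat -> (n <= m)%nat -> Rabs (G (INR (S n)) - G (INR (S m))) < eps).
      { intros n m Hn Hm. rewrite Rabs_minus_sym.
        pose proof (Hcomp (INR (S n)) (INR (S m))) as H1.
        assert (INR (S n) <= INR (S m)) by (apply le_INR; lia).
        pose proof (INR_S_pos n).
        specialize (H1 ltac:(lra)). pose proof (Hq0 (INR (S m))).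
        specialize (HN0 n Hn). rewrite Rminus_0_r in HN0. apply Rabs_def2 in HN0. lra. }
      intros n m Hn Hm. destruct (le_lt_dec n m); [now apply Hmain|].
      rewrite Rabs_minus_sym. apply Hmain; [easy|lia]. }
    apply ex_lim_seq_cauchy_corr in HCau. destruct HCau as [l Hl]. now exists l. }
  destruct Hex as [l Hl].
  exists (fun y => l - G y). intros y Hy. split.
  - replace (- f y) with (0 - f y) by ring.
    apply (is_derive_minus (fun _ => l) G); [|now apply HG].
    exact (is_derive_const (K := R_AbsRing) (V := R_NormedModule) l y).
  - assert (H1 : is_lim_seq (fun n => Rabs (G (INR (S n)) - G y)) (Rabs (l - G y))).
    { apply (is_lim_seq_abs _ (Finite _)). apply is_lim_seq_minus'; [easy|apply is_lim_seq_const]. }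
    apply (is_lim_seq_upper _ _ _ H1).
    destruct (nfloor_ex y ltac:(lra)) as [n0 [_ Hn0]].
    exists n0. intros n Hn. assert (INR n0 + 1 <= INR (S n)) by (rewrite S_INR; apply le_INR in Hn; lra).
    pose proof (Hcomp y (INR (S n)) ltac:(lra)). pose proof (Hq0 (INR (S n))). unfold q in *. lra.
Qed.

Lemma Cmod_le_abs (z : C) : Cmod z <= Rabs (Re z) + Rabs (Im z).
Proof.
  replace z with (RtoC (Re z) + RtoC (Im z) * Ci)%C at 1.
  - eapply Rle_trans; [apply Cmod_triangle|]. rewrite Cmod_mult, Cmod_Ci, !Cmod_R. lra.
  - destruct z as [x y]. unfold RtoC, Ci, Cplus, Cmult; simpl. f_equal; ring.
Qed.

Lemma im_le_Cmod (z : C) : Rabs (Im z) <= Cmod z.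
Proof. eapply Rle_trans; [apply Rmax_r|apply Rmax_Cmod]. Qed.

Lemma Cmod_minus_sym (x y : C) : Cmod (x - y) = Cmod (y - x).
Proof. rewrite <- Cmod_opp. f_equal. ring. Qed.

Definition cderiv (f : R -> C) (x : R) (l : C) : Prop :=
  is_derive (fun t => Re (f t)) x (Re l) /\ is_derive (fun t => Im (f t)) x (Im l).

Lemma cderiv_plus f g x l m : cderiv f x l -> cderiv g x m -> cderiv (fun t => f t + g t)%C x (l + m)%C.
Proof.
  intros [H1 H2] [H3 H4]. split.
  - exact (is_derive_plus _ _ _ _ _ H1 H3).
  - exact (is_derive_plus _ _ _ _ _ H2 H4).
Qed.

Lemma cderiv_scal (c : C) f x l : cderiv f x l -> cderiv (fun t => c * f t)%C x (c * l)%C.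
Proof.
  intros [H1 H2]. split; simpl.
  - apply (is_derive_minus (fun t => fst c * Re (f t)) (fun t => snd c * Im (f t)));
      [now apply (is_derive_scal (fun t => Re (f t)))|now apply (is_derive_scal (fun t => Im (f t)))].
  - apply (is_derive_plus (fun t => fst c * Im (f t)) (fun t => snd c * Re (f t)));
      [now apply (is_derive_scal (fun t => Im (f t)))|now apply (is_derive_scal (fun t => Re (f t)))].
Qed.

Lemma cderiv_minus f g x l m : cderiv f x l -> cderiv g x m -> cderiv (fun t => f t - g t)%C x (l - m)%C.
Proof.
  intros [H1 H2] [H3 H4]. split.
  - exact (is_derive_minus _ _ _ _ _ H1 H3).
  - exact (is_derive_minus _ _ _ _ _ H2 H4).
Qed.

Lemma cderiv_RtoC f x l : is_derive f x l -> cderiv (fun t => RtoC (f t)) x (RtoC l).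
Proof.
  intros H. split; simpl; [exact H|].
  exact (is_derive_const (K := R_AbsRing) (V := R_NormedModule) 0 x).
Qed.

Lemma cderiv_comp_scal f c x l : cderiv f (c * x) l -> cderiv (fun t => f (c * t)) x (RtoC c * l)%C.
Proof.
  intros [H1 H2]. destruct l as [l1 l2].
  assert (Hs : is_derive (fun t => c * t) x c) by (auto_derive; [easy|ring]).
  split; simpl in *.
  - replace (c * l1 - 0 * l2) with (c * l1) by ring.
    exact (is_derive_comp (fun t => Re (f t)) (fun t => c * t) x _ _ H1 Hs).
  - replace (c * l2 + 0 * l1) with (c * l2) by ring.
    exact (is_derive_comp (fun t => Im (f t)) (fun t => c * t) x _ _ H2 Hs).
Qed.

(** The mean value theorem is applied to real and imaginary parts separately, whence the factor [2];
    it reappears in the later constants. *)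
Lemma cderiv_bound (f df : R -> C) (D a b : R) : a <= b ->
  (forall t, a <= t <= b -> cderiv f t (df t) /\ Cmod (df t) <= D) ->
  Cmod (f b - f a) <= 2 * D * (b - a).
Proof.
  intros Hab H.
  assert (H1 : Rabs (Re (f b) - Re (f a)) <= D * (b - a)).
  { apply (derive_bound (fun t => Re (f t)) (fun t => Re (df t))); [easy|].
    intros t Ht. destruct (H t Ht) as [[Hd _] HD]. split; [easy|].
    eapply Rle_trans; [apply re_le_Cmod|easy]. }
  assert (H2 : Rabs (Im (f b) - Im (f a)) <= D * (b - a)).
  { apply (derive_bound (fun t => Im (f t)) (fun t => Im (df t))); [easy|].
    intros t Ht. destruct (H t Ht) as [[_ Hd] HD]. split; [easy|].
    eapply Rle_trans; [apply im_le_Cmod|easy]. }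
  eapply Rle_trans; [apply Cmod_le_abs|].
  change (Re (f b - f a)) with (Re (f b) - Re (f a)).
  change (Im (f b - f a)) with (Im (f b) - Im (f a)). lra.
Qed.

Lemma cpow_mult_base x y z : 0 < x -> 0 < y -> cpow (x * y) z = (cpow x z * cpow y z)%C.
Proof.
  intros Hx Hy. unfold cpow, Cmult; simpl. rewrite ln_mult by easy.
  rewrite !Rmult_plus_distr_l, exp_plus, cos_plus, sin_plus. f_equal; ring.
Qed.

Lemma cpow_plus x (z1 z2 : C) : cpow x (z1 + z2)%C = (cpow x z1 * cpow x z2)%C.
Proof.
  destruct z1 as [a1 b1], z2 as [a2 b2]. unfold cpow, Cmult, Cplus, Re, Im; simpl.
  rewrite !Rmult_plus_distr_r, exp_plus, cos_plus, sin_plus. f_equal; ring.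
Qed.

Lemma cpow_Cmod x z : Cmod (cpow x z) = Rpower x (Re z).
Proof.
  unfold cpow, Cmod, Rpower. cbn [fst snd].
  set (a := exp (Re z * ln x)). set (t := Im z * ln x).
  replace ((a * cos t) ^ 2 + (a * sin t) ^ 2)
    with (a * a * (Rsqr (sin t) + Rsqr (cos t))) by (unfold Rsqr; ring).
  rewrite sin2_cos2, Rmult_1_r. apply sqrt_square. left; apply exp_pos.
Qed.

Lemma cpow_RtoC x a : cpow x (RtoC a) = RtoC (Rpower x a).
Proof. unfold cpow, RtoC, Rpower; simpl. rewrite Rmult_0_l, cos_0, sin_0. f_equal; ring. Qed.

Lemma cpow_0 x : cpow x 0 = 1%C.
Proof. rewrite cpow_RtoC. unfold Rpower. rewrite Rmult_0_l, exp_0. easy. Qed.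

Lemma cpow_base_1 z : cpow 1 z = 1%C.
Proof. unfold cpow. rewrite ln_1, !Rmult_0_r, exp_0, cos_0, sin_0. unfold RtoC; f_equal; ring. Qed.

Lemma cpow_neq0 x z : cpow x z <> 0%C.
Proof. apply Cmod_gt_0. rewrite cpow_Cmod. apply exp_pos. Qed.

Lemma cpow_1 x : 0 < x -> cpow x 1 = RtoC x.
Proof. intros H. rewrite cpow_RtoC, Rpower_1; easy. Qed.

Lemma cpow_opp x (z : C) : cpow x (- z)%C = (/ cpow x z)%C.
Proof.
  assert (H : (cpow x (- z)%C * cpow x z = 1)%C).
  { rewrite <- cpow_plus. replace (- z + z)%C with (RtoC 0) by ring. apply cpow_0. }
  replace (cpow x (- z)%C) with (cpow x (- z)%C * cpow x z * / cpow x z)%C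
    by (field; apply cpow_neq0).
  rewrite H. ring.
Qed.

Lemma cderiv_cpow z x : 0 < x -> cderiv (fun t => cpow t z) x (z * cpow x (z - 1)%C)%C.
Proof.
  intros Hx.
  assert (E : (z * cpow x (z - 1)%C = RtoC (/ x) * (z * cpow x z))%C).
  { unfold Cminus. rewrite cpow_plus, cpow_opp, cpow_1 by easy. rewrite RtoC_inv by lra. ring. }
  rewrite E. destruct z as [a b]. unfold cpow. split; simpl.
  - auto_derive; [lra|]. field. lra.
  - auto_derive; [lra|]. field. lra.
Qed.

Lemma Rpower_anti x y e : 0 < x <= y -> e <= 0 -> Rpower y e <= Rpower x e.
Proof.
  intros H He. unfold Rpower. apply exp_le_compat.
  assert (ln x <= ln y) by (apply ln_le; lra). nra.
Qed.

Lemma cpow_diff_bound z x y : 0 < x <= y -> Re z <= 1 ->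
  Cmod (cpow y z - cpow x z) <= 2 * Cmod z * Rpower x (Re z - 1) * (y - x).
Proof.
  intros H Hz. replace (2 * Cmod z * Rpower x (Re z - 1)) with (2 * (Cmod z * Rpower x (Re z - 1))) by ring.
  apply (cderiv_bound (fun t => cpow t z) (fun t => z * cpow t (z - 1)%C)%C); [lra|].
  intros t Ht. split; [apply cderiv_cpow; lra|].
  rewrite Cmod_mult, cpow_Cmod. apply Rmult_le_compat_l; [apply Cmod_ge_0|].
  replace (Re (z - 1)) with (Re z - 1) by (destruct z; unfold Re; simpl; ring).
  apply Rpower_anti; lra.
Qed.

Fixpoint csum (f : nat -> C) (N : nat) : C :=
  match N with O => 0%C | S n => (csum f n + f (S n))%C end.

Lemma csum_ext f g N : (forall n, (1 <= n <= N)%nat -> f n = g n) -> csum f N = csum g N.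
Proof.
  induction N as [|N IH]; intros H; cbn [csum]; [easy|].
  rewrite IH, H; [easy|lia|]. intros; apply H; lia.
Qed.

Lemma csum_Cmod f N : Cmod (csum f N) <= rsum (fun n => Cmod (f n)) N.
Proof.
  induction N as [|N IH]; cbn [csum rsum]; [rewrite Cmod_0; lra|].
  eapply Rle_trans; [apply Cmod_triangle|]. lra.
Qed.

Lemma csum_plus f g N : csum (fun n => f n + g n)%C N = (csum f N + csum g N)%C.
Proof. induction N as [|N IH]; cbn [csum]; [ring|]. rewrite IH. ring. Qed.

Lemma csum_scal c f N : csum (fun n => c * f n)%C N = (c * csum f N)%C.
Proof. induction N as [|N IH]; cbn [csum]; [ring|]. rewrite IH. ring. Qed.

Lemma csum_abel f w N :
  csum (fun n => f n * w n)%C N =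
  (csum f N * w (S N) + csum (fun n => csum f n * (w n - w (S n))) N)%C.
Proof. induction N as [|N IH]; cbn [csum]; [ring|]. rewrite IH. ring. Qed.

Lemma csum_telescope w N : csum (fun n => w n - w (S n))%C N = (w 1%nat - w (S N))%C.
Proof. induction N as [|N IH]; cbn [csum]; [ring|]. rewrite IH. ring. Qed.

Lemma csum_Re f N : Re (csum f N) = rsum (fun n => Re (f n)) N.
Proof. induction N as [|N IH]; cbn [csum rsum]; [easy|]. rewrite <- IH. easy. Qed.

Lemma csum_Im f N : Im (csum f N) = rsum (fun n => Im (f n)) N.
Proof. induction N as [|N IH]; cbn [csum rsum]; [easy|]. rewrite <- IH. easy. Qed.

Definition clim (u : nat -> C) (l : C) : Prop := is_lim_seq (fun n => Cmod (u n - l)) 0.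

Lemma clim_squeeze u l (b : nat -> R) : is_lim_seq b 0 ->
  (forall n, (1 <= n)%nat -> Cmod (u n - l) <= b n) -> clim u l.
Proof.
  intros Hb H. apply (is_lim_seq_le_le_loc (fun _ => 0) _ b); [|apply is_lim_seq_const|easy].
  exists 1%nat. intros n Hn. split; [apply Cmod_ge_0|now apply H].
Qed.

Lemma clim_plus u v l m : clim u l -> clim v m -> clim (fun n => u n + v n)%C (l + m)%C.
Proof.
  intros Hu Hv. apply (clim_squeeze _ _ (fun n => Cmod (u n - l) + Cmod (v n - m))).
  - replace (Finite 0) with (Finite (0 + 0)) by (f_equal; ring). now apply is_lim_seq_plus'.
  - intros n _. replace (u n + v n - (l + m))%C with ((u n - l) + (v n - m))%C by ring.
    apply Cmod_triangle.
Qed.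

Lemma clim_scal c u l : clim u l -> clim (fun n => c * u n)%C (c * l)%C.
Proof.
  intros Hu. apply (clim_squeeze _ _ (fun n => Cmod c * Cmod (u n - l))).
  - now apply is_lim_seq_scal_0.
  - intros n _. replace (c * u n - c * l)%C with (c * (u n - l))%C by ring.
    rewrite Cmod_mult. lra.
Qed.

Lemma clim_const l : clim (fun _ => l) l.
Proof.
  apply (clim_squeeze _ _ (fun _ => 0)); [apply is_lim_seq_const|].
  intros n _. replace (l - l)%C with (RtoC 0) by ring. rewrite Cmod_0. lra.
Qed.

Lemma clim_ext u v l : (forall n, (1 <= n)%nat -> u n = v n) -> clim u l -> clim v l.
Proof.
  intros H Hu. apply (clim_squeeze _ _ (fun n => Cmod (u n - l))); [easy|].
  intros n Hn. rewrite H by easy. lra.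
Qed.

Lemma clim_unique u l m : clim u l -> clim u m -> l = m.
Proof.
  intros Hl Hm.
  assert (H : is_lim_seq (fun n => Cmod (u n - l) + Cmod (u n - m)) (0 + 0)) by now apply is_lim_seq_plus'.
  assert (Hle : Rbar_le (Cmod (m - l)) (0 + 0)).
  { apply (is_lim_seq_le (fun _ => Cmod (m - l)) (fun n => Cmod (u n - l) + Cmod (u n - m)));
      [|apply is_lim_seq_const|easy].
    intros n. rewrite (Cmod_minus_sym (u n) m).
    replace (m - l)%C with ((u n - l) + (m - u n))%C by ring. apply Cmod_triangle. }
  simpl in Hle. pose proof (Cmod_ge_0 (m - l)).
  assert (Hz : Cmod (m - l) = 0) by lra. apply Cmod_eq_0 in Hz.
  replace l with (m - (m - l))%C by ring. rewrite Hz. ring.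
Qed.

Lemma clim_incr u l : clim u l -> clim (fun n => u (S n)) l.
Proof. intros H. unfold clim in *. now apply (is_lim_seq_incr_1 (fun n => Cmod (u n - l))) in H. Qed.

Definition cseries (f : nat -> C) : C :=
  (Series (fun n => Re (f (S n))), Series (fun n => Im (f (S n)))).

Lemma rsum_series_tail (f : nat -> R) B d : 0 < d ->
  (forall n, (1 <= n)%nat -> Rabs (f n) <= B * Rpower (INR n) (- d - 1)) ->
  forall N, (1 <= N)%nat -> Rabs (Series (fun n => f (S n)) - rsum f N) <= B * (/ d * Rpower (INR N) (- d)).
Proof.
  intros Hd Hf N HN.
  assert (HB : 0 <= B).
  { specialize (Hf 1%nat ltac:(lia)). change (INR 1) with 1 in Hf. rewrite Rpower_base_1 in Hf.
    pose proof (Rabs_pos (f 1%nat)). lra. }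
  assert (Hex : ex_series (fun n => f (S n))).
  { apply (ex_series_le (fun n => f (S n)) (fun n => B * Rpower (INR (S n)) (- d - 1))).
    - intros n. apply Hf. lia.
    - apply (ex_series_scal_l B (fun n => Rpower (INR (S n)) (- d - 1))). apply ex_series_Rpower. lra. }
  apply Series_correct, is_series_rsum in Hex.
  assert (Hl : is_lim_seq (fun M => Rabs (rsum f M - rsum f N)) (Rabs (Series (fun n => f (S n)) - rsum f N))).
  { apply (is_lim_seq_abs _ (Finite _)). apply is_lim_seq_minus'; [easy|apply is_lim_seq_const]. }
  apply (is_lim_seq_upper _ _ _ Hl).
  exists N. intros M HM.
  eapply Rle_trans; [apply (rsum_diff_Rabs f (fun n => B * Rpower (INR n) (- d - 1)) N M HM); intros; apply Hf; lia|].
  rewrite !rsum_scal, <- Rmult_minus_distr_l. apply Rmult_le_compat_l; [easy|].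
  eapply Rle_trans; [apply rsum_Rpower_bound; [easy|lia]|].
  apply Rmult_le_compat_l; [left; apply Rinv_0_lt_compat; easy|].
  pose proof (Rpower_pos (INR M) (- d)) as Hp. lra.
Qed.

Lemma cseries_tail (f : nat -> C) B d : 0 < d ->
  (forall n, (1 <= n)%nat -> Cmod (f n) <= B * Rpower (INR n) (- d - 1)) ->
  forall N, (1 <= N)%nat -> Cmod (cseries f - csum f N) <= 2 * B * (/ d * Rpower (INR N) (- d)).
Proof.
  intros Hd Hf N HN.
  eapply Rle_trans; [apply Cmod_le_abs|].
  change (Re (cseries f - csum f N)) with (Series (fun n => Re (f (S n))) - Re (csum f N)).
  change (Im (cseries f - csum f N)) with (Series (fun n => Im (f (S n))) - Im (csum f N)).
  rewrite csum_Re, csum_Im.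
  assert (H1 := rsum_series_tail (fun n => Re (f n)) B d Hd).
  assert (H2 := rsum_series_tail (fun n => Im (f n)) B d Hd).
  specialize (H1 ltac:(intros n Hn; eapply Rle_trans; [apply re_le_Cmod|now apply Hf]) N HN).
  specialize (H2 ltac:(intros n Hn; eapply Rle_trans; [apply im_le_Cmod|now apply Hf]) N HN).
  simpl in *. lra.
Qed.

(** * Symmetry of the zeros *)

(* [(s - 1)] times the partial sums of [zeta(s)], regularised by the integral of the tail. *)
Definition zeta_partial (s : C) (N : nat) : C :=
  ((s - 1) * csum (fun n => cpow (INR n) (- s)%C) N + cpow (INR (S N)) (1 - s)%C)%C.

(** In the strip the partial sums of [n^(-s)] diverge, but [zeta_partial s] still converges, to
    [(s - 1) zeta(s)]. Both halves of the argument use vanishing in this form. *)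
Definition zeta_zero (s : C) : Prop := clim (zeta_partial s) 0%C.

Lemma Re_minus (z1 z2 : C) : Re (z1 - z2) = Re z1 - Re z2.
Proof. destruct z1, z2; unfold Re; simpl; ring. Qed.
Lemma Re_plus (z1 z2 : C) : Re (z1 + z2) = Re z1 + Re z2.
Proof. destruct z1, z2; unfold Re; simpl; ring. Qed.
Lemma Re_opp (z : C) : Re (- z) = - Re z.
Proof. destruct z; unfold Re; simpl; ring. Qed.
Lemma Re_RtoC (x : R) : Re (RtoC x) = x.
Proof. reflexivity. Qed.

Lemma C2_two : RtoC 2 = (1 + 1)%C.
Proof. rewrite <- RtoC_plus. f_equal. Qed.

Lemma C2_neq0 : RtoC 2 <> 0%C.
Proof. intros H. apply RtoC_inj in H. lra. Qed.

Lemma Re_neq0 (z : C) : Re z <> 0 -> z <> 0%C.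
Proof. intros H E. apply H. rewrite E. reflexivity. Qed.

Lemma strip_neq0 (w : C) : 0 < Re w < 1 -> w <> 0%C /\ (w + 1)%C <> 0%C /\ (1 - w)%C <> 0%C.
Proof.
  intros Hw. repeat split; apply Re_neq0; rewrite ?Re_plus, ?Re_minus, ?Re_RtoC; lra.
Qed.

Lemma zeta_partial_step w n : (1 <= n)%nat -> 0 < Re w < 1 ->
  Cmod (cpow (INR (S n)) w - cpow (INR n) w - w * cpow (INR n) (w - 1)%C)
   <= 4 * Cmod w * Cmod (w - 1)%C * Rpower (INR n) (- (1 - Re w) - 1).
Proof.
  intros Hn Hw. assert (Hp : 0 < INR n) by (apply lt_0_INR; lia).
  set (f := fun x => (cpow x w - w * cpow (INR n) (w - 1)%C * RtoC x)%C).
  replace (cpow (INR (S n)) w - cpow (INR n) w - w * cpow (INR n) (w - 1)%C)%C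
    with (f (INR n + 1)%R - f (INR n))%C.
  2:{ unfold f. rewrite S_INR, RtoC_plus. ring. }
  replace (4 * Cmod w * Cmod (w - 1)%C * Rpower (INR n) (- (1 - Re w) - 1)) with
    (2 * (Cmod w * (2 * Cmod (w - 1)%C * Rpower (INR n) (Re (w - 1)%C - 1) * 1)) * (INR n + 1 - INR n)).
  2:{ rewrite Re_minus, Re_RtoC. replace (- (1 - Re w) - 1) with (Re w - 1 - 1) by ring. ring. }
  apply (cderiv_bound f (fun x => w * (cpow x (w - 1)%C - cpow (INR n) (w - 1)%C))%C); [lra|].
  intros t Ht. split.
  - unfold f. replace (w * (cpow t (w - 1)%C - cpow (INR n) (w - 1)%C))%C
      with (w * cpow t (w - 1)%C - w * cpow (INR n) (w - 1)%C * RtoC 1)%C by ring.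
    apply cderiv_minus; [apply cderiv_cpow; lra|].
    apply cderiv_scal. apply cderiv_RtoC. apply (is_derive_id (K := R_AbsRing)).
  - rewrite Cmod_mult. apply Rmult_le_compat_l; [apply Cmod_ge_0|].
    eapply Rle_trans; [apply cpow_diff_bound; [lra|rewrite Re_minus, Re_RtoC; lra]|].
    apply Rmult_le_compat_l; [|lra].
    apply Rmult_le_pos; [|left; apply exp_pos]. pose proof (Cmod_ge_0 (w - 1)). lra.
Qed.

Lemma zeta_partial_w w N : zeta_partial (1 - w) N =
  (cpow (INR (S N)) w - w * csum (fun n => cpow (INR n) (w - 1)%C) N)%C.
Proof.
  unfold zeta_partial. replace (- (1 - w))%C with (w - 1)%C by ring.
  replace (1 - (1 - w))%C with w by ring. ring.
Qed.

(** In general the partial sums of [n^(w-1)] are [N^w / w] plus a constant [zeta(1 - w)] plus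
    [O(N^(Re w - 1))]. The hypothesis removes the constant; it enters the reflection only here. *)
Lemma zeta_zero_rate w : 0 < Re w < 1 -> zeta_zero (1 - w) ->
  exists c, 0 < c /\ forall N, (1 <= N)%nat ->
   Cmod (csum (fun n => cpow (INR n) (w - 1)%C) N - cpow (INR N) w / w) <= c * Rpower (INR N) (Re w - 1).
Proof.
  intros Hw Hz.
  set (B := 4 * Cmod w * Cmod (w - 1)%C).
  set (d := 1 - Re w). assert (Hd : 0 < d) by (unfold d; lra).
  assert (Hw0 : w <> 0%C) by (apply Re_neq0; lra).
  assert (Hcw : 0 < Cmod w) by now apply Cmod_gt_0.
  assert (HB : 0 <= B).
  { unfold B. pose proof (Cmod_ge_0 (w - 1)). apply Rmult_le_pos; lra. }
  assert (Hstep : forall N M, (1 <= N <= M)%nat ->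
    Cmod (zeta_partial (1 - w) M - zeta_partial (1 - w) N) <= B *
      (rsum (fun n => Rpower (INR n) (- d - 1)) M - rsum (fun n => Rpower (INR n) (- d - 1)) N)).
  { intros N M [HN HM]. induction HM as [|M HM IH].
    - replace (zeta_partial (1 - w) N - zeta_partial (1 - w) N)%C with (RtoC 0) by ring.
      rewrite Cmod_0. lra.
    - cbn [rsum].
      replace (zeta_partial (1 - w) (S M) - zeta_partial (1 - w) N)%C with
        ((zeta_partial (1 - w) M - zeta_partial (1 - w) N) +
         (cpow (INR (S (S M))) w - cpow (INR (S M)) w - w * cpow (INR (S M)) (w - 1)%C))%C.
      2:{ rewrite !zeta_partial_w. cbn [csum]. ring. }
      eapply Rle_trans; [apply Cmod_triangle|].
      pose proof (zeta_partial_step w (S M) ltac:(lia) Hw) as Hs. fold B d in Hs. lra. }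
  assert (Hrate : forall N, (1 <= N)%nat -> Cmod (zeta_partial (1 - w) N) <= B * (/ d * Rpower (INR N) (- d))).
  { intros N HN.
    assert (Hl : is_lim_seq (fun M => Cmod (zeta_partial (1 - w) M - 0) + B * (/ d * Rpower (INR N) (- d)))
       (0 + B * (/ d * Rpower (INR N) (- d)))).
    { apply is_lim_seq_plus'; [exact Hz|apply is_lim_seq_const]. }
    apply (is_lim_seq_le_loc (fun _ => Cmod (zeta_partial (1 - w) N)) _ (Cmod (zeta_partial (1 - w) N)) _) in Hl;
      [simpl in Hl; lra| |apply is_lim_seq_const].
    exists N. intros M HM.
    replace (zeta_partial (1 - w) N) with ((zeta_partial (1 - w) M - 0) + (zeta_partial (1 - w) N - zeta_partial (1 - w) M))%C at 1 by ring.
    eapply Rle_trans; [apply Cmod_triangle|]. apply Rplus_le_compat_l.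
    rewrite Cmod_minus_sym. eapply Rle_trans; [apply Hstep; lia|].
    apply Rmult_le_compat_l; [easy|].
    eapply Rle_trans; [apply rsum_Rpower_bound; [easy|lia]|].
    apply Rmult_le_compat_l; [left; apply Rinv_0_lt_compat; easy|].
    pose proof (Rpower_pos (INR M) (- d)) as Hp. lra. }
  exists ((B * / d + 2 * Cmod w) * / Cmod w). split.
  { apply Rmult_lt_0_compat; [|apply Rinv_0_lt_compat; easy].
    assert (0 <= B * / d) by (apply Rmult_le_pos; [easy|left; apply Rinv_0_lt_compat; easy]). lra. }
  intros N HN. assert (Hp : 0 < INR N) by (apply lt_0_INR; lia).
  replace (csum (fun n => cpow (INR n) (w - 1)%C) N - cpow (INR N) w / w)%C
    with ((- zeta_partial (1 - w) N + (cpow (INR (S N)) w - cpow (INR N) w)) / w)%C.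
  2:{ rewrite zeta_partial_w. field. easy. }
  rewrite Cmod_div by easy. unfold Rdiv.
  replace ((B * / d + 2 * Cmod w) * / Cmod w * Rpower (INR N) (Re w - 1))
    with ((B * / d * Rpower (INR N) (Re w - 1) + 2 * Cmod w * Rpower (INR N) (Re w - 1)) * / Cmod w) by ring.
  apply Rmult_le_compat_r; [left; apply Rinv_0_lt_compat; easy|].
  eapply Rle_trans; [apply Cmod_triangle|]. rewrite Cmod_opp.
  apply Rplus_le_compat.
  - rewrite Rmult_assoc. replace (Re w - 1) with (- d) by (unfold d; ring). now apply Hrate.
  - eapply Rle_trans; [apply cpow_diff_bound; [rewrite S_INR; lra|lra]|].
    rewrite S_INR. right. ring.
Qed.

(** Substituting [y = n x] turns the integral of [(sin (PI n x) / (PI n))^2 x^(-w-2)] into [n^(w-1)]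
    times an integral of [kern w]; the powers [n^(w-1)] bring in the series at [1 - w]. *)
Definition kern (w : C) (y : R) : C := (RtoC ((sin (PI * y)) ^ 2 / PI ^ 2) * cpow y (- w - 2)%C)%C.

(* [Phi y] is the integral of [kern w] over [[y, +oo)]. *)
Definition is_tail_kernel (w : C) (Phi : R -> C) : Prop :=
  forall y, 0 < y -> cderiv Phi y (- kern w y)%C /\ Cmod (Phi y) <= 2 * Rpower y (- (1 + Re w)).

Lemma sin2_PI2_bound y : 0 <= (sin (PI * y)) ^ 2 / PI ^ 2 <= 1.
Proof.
  pose proof PI_gt_1 as HPI. assert (HP2 : 1 < PI ^ 2) by nra.
  pose proof (SIN_bound (PI * y)) as Hs. split.
  - apply Rdiv_le_0_compat; [apply pow2_ge_0|lra].
  - apply Rle_div_l; [lra|]. nra.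
Qed.

Lemma kern_Cmod w y : Cmod (kern w y) = (sin (PI * y)) ^ 2 / PI ^ 2 * Rpower y (- Re w - 2).
Proof.
  unfold kern. rewrite Cmod_mult, cpow_Cmod, Cmod_R, Rabs_pos_eq by apply sin2_PI2_bound.
  rewrite Re_minus, Re_opp, Re_RtoC. reflexivity.
Qed.

Lemma kern_Cmod_le w y : Cmod (kern w y) <= Rpower y (- Re w - 2).
Proof.
  rewrite kern_Cmod. rewrite <- (Rmult_1_l (Rpower y (- Re w - 2))) at 2.
  apply Rmult_le_compat_r; [left; apply exp_pos|apply sin2_PI2_bound].
Qed.

(** Near [0] the sine gains two powers of [y], and for [y >= 1] the exponent may be raised. A small
    positive [d] will give summability in [n] at almost no cost in the scale. *)
Lemma kern_Cmod_small w y d : 0 < y -> 0 <= d <= 2 -> Cmod (kern w y) <= Rpower y (- Re w - d).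
Proof.
  intros Hy Hd. destruct (Rle_dec y 1) as [h|h].
  - rewrite kern_Cmod.
    assert (Hs : (sin (PI * y)) ^ 2 / PI ^ 2 <= Rpower y 2).
    { replace (Rpower y 2) with (y ^ 2) by (rewrite <- (Rpower_pow 2 y) by easy; f_equal; simpl; ring).
      pose proof PI_RGT_0.
      assert (Hsin : Rabs (sin (PI * y)) <= PI * y) by (apply abs_sin_le; nra).
      apply Rle_div_l; [apply pow_lt; easy|]. rewrite <- (pow2_abs (sin (PI * y))).
      replace (y ^ 2 * PI ^ 2) with ((PI * y) ^ 2) by ring.
      apply pow_incr. split; [apply Rabs_pos|easy]. }
    apply Rle_trans with (Rpower y 2 * Rpower y (- Re w - 2)).
    + apply Rmult_le_compat_r; [left; apply exp_pos|easy].
    + rewrite <- Rpower_plus. unfold Rpower. apply exp_le_compat.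
      assert (ln y <= 0) by (rewrite <- ln_1; apply ln_le; lra). nra.
  - eapply Rle_trans; [apply kern_Cmod_le|]. apply Rle_Rpower; lra.
Qed.

Lemma kern_continuous w y : 0 < y ->
  continuous (fun y => Re (kern w y)) y /\ continuous (fun y => Im (kern w y)) y.
Proof.
  intros Hy. pose proof PI_RGT_0. destruct w as [a b]. split.
  - apply (ex_derive_continuous (fun y => Re (kern (a, b) y))). unfold kern, cpow; simpl.
    auto_derive. split; [easy|]. split; easy.
  - apply (ex_derive_continuous (fun y => Im (kern (a, b) y))). unfold kern, cpow; simpl.
    auto_derive. split; [easy|]. split; easy.
Qed.

Lemma ex_tail_kernel w : 0 < Re w -> exists Phi, is_tail_kernel w Phi.
Proof.
  intros Hw. set (e := 1 + Re w).
  assert (Hb : forall y, Cmod (kern w y) <= Rpower y (- e - 1)).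
  { intros y. replace (- e - 1) with (- Re w - 2) by (unfold e; ring). apply kern_Cmod_le. }
  destruct (ex_tail_primitive (fun y => Re (kern w y)) e) as [F1 H1]; [unfold e; lra| | |].
  { intros y Hy. exact (proj1 (kern_continuous w y Hy)). }
  { intros y Hy. eapply Rle_trans; [apply re_le_Cmod|apply Hb]. }
  destruct (ex_tail_primitive (fun y => Im (kern w y)) e) as [F2 H2]; [unfold e; lra| | |].
  { intros y Hy. exact (proj2 (kern_continuous w y Hy)). }
  { intros y Hy. eapply Rle_trans; [apply im_le_Cmod|apply Hb]. }
  exists (fun y => (F1 y, F2 y)). intros y Hy.
  destruct (H1 y Hy) as [D1 B1]. destruct (H2 y Hy) as [D2 B2]. split.
  - split; [exact D1|exact D2].
  - eapply Rle_trans; [apply Cmod_le_abs|]. simpl.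
    assert (Hi : / e <= 1) by (rewrite <- Rinv_1; apply Rinv_le_contravar; unfold e; lra).
    pose proof (Rpower_pos y (- e)) as Hp. fold e. unfold Re, Im; simpl.
    assert (/ e * Rpower y (- e) <= 1 * Rpower y (- e)) by (apply Rmult_le_compat_r; lra). lra.
Qed.

Lemma ex_tail_fejer : exists H : R -> R, forall y, 0 < y ->
  is_derive H y (- ((sin (PI * y)) ^ 2 / PI ^ 2 * Rpower y (-2))) /\ Rabs (H y) <= / y.
Proof.
  destruct (ex_tail_primitive (fun y => (sin (PI * y)) ^ 2 / PI ^ 2 * Rpower y (-2)) 1) as [F HF].
  - lra.
  - intros y Hy. apply (ex_derive_continuous (fun y => (sin (PI * y)) ^ 2 / PI ^ 2 * Rpower y (-2))).
    unfold Rpower. auto_derive. repeat split; easy.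
  - intros y Hy. replace (- (1) - 1) with (-2) by ring.
    rewrite Rabs_mult, Rabs_pos_eq by apply sin2_PI2_bound.
    rewrite Rabs_pos_eq by (left; apply exp_pos).
    rewrite <- (Rmult_1_l (Rpower y (-2))) at 2.
    apply Rmult_le_compat_r; [left; apply exp_pos|apply sin2_PI2_bound].
  - exists F. intros y Hy. destruct (HF y Hy) as [D B]. split; [easy|].
    rewrite Rinv_1, Rmult_1_l, Rpower_Ropp, Rpower_1 in B by easy. easy.
Qed.

Definition theta_term (w : C) (Phi : R -> C) (x : R) (n : nat) : C :=
  (cpow (INR n) (w - 1)%C * Phi (INR n * x)%R)%C.

(** The term [x^(-w) / (2 w)] is the tail integral of the linear part [x / 2] of [U]. *)
Definition theta_partial (w : C) (Phi : R -> C) (N : nat) (x : R) : C :=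
  (/ (2 * w) * cpow x (- w)%C - csum (theta_term w Phi x) N)%C.

(* The integral of [U(x) x^(-w-2)] over [[x, +oo)], expanded with the Fourier series of [U]. *)
Definition theta_fun (w : C) (Phi : R -> C) (x : R) : C :=
  (/ (2 * w) * cpow x (- w)%C - cseries (theta_term w Phi x))%C.

Lemma theta_term_bound w Phi x n : is_tail_kernel w Phi -> 0 < x -> (1 <= n)%nat ->
  Cmod (theta_term w Phi x n) <= 2 * Rpower x (- (1 + Re w)) * Rpower (INR n) (- (1) - 1).
Proof.
  intros HP Hx Hn. assert (Hp : 0 < INR n) by (apply lt_0_INR; lia).
  unfold theta_term. rewrite Cmod_mult, cpow_Cmod.
  destruct (HP (INR n * x)) as [_ HB]; [nra|].
  rewrite Rpower_mult_distr in HB || rewrite <- Rpower_mult_distr in HB by easy.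
  replace (- (1) - 1) with ((Re w - 1) + - (1 + Re w)) by ring.
  rewrite Rpower_plus, Re_minus, Re_RtoC.
  apply Rle_trans with (Rpower (INR n) (Re w - 1) * (2 * (Rpower (INR n) (- (1 + Re w)) * Rpower x (- (1 + Re w))))).
  - apply Rmult_le_compat_l; [left; apply exp_pos|easy].
  - right. ring.
Qed.

Lemma theta_fun_approx w Phi x N : is_tail_kernel w Phi -> 0 < x -> (1 <= N)%nat ->
  Cmod (theta_fun w Phi x - theta_partial w Phi N x) <= 4 * Rpower x (- (1 + Re w)) * / INR N.
Proof.
  intros HP Hx HN. assert (Hp : 0 < INR N) by (apply lt_0_INR; lia).
  unfold theta_fun, theta_partial.
  match goal with |- Cmod ?e <= _ => replace e with (- (cseries (theta_term w Phi x) - csum (theta_term w Phi x) N))%C by ring end.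
  rewrite Cmod_opp.
  eapply Rle_trans; [apply (cseries_tail _ (2 * Rpower x (- (1 + Re w))) 1); [lra| |easy]|].
  - intros n Hn. now apply theta_term_bound.
  - rewrite Rinv_1, (Rpower_Ropp _ 1), Rpower_1 by easy. right. ring.
Qed.

Lemma cderiv_csum (f df : nat -> R -> C) N x :
  (forall n, (1 <= n <= N)%nat -> cderiv (f n) x (df n x)) ->
  cderiv (fun x => csum (fun n => f n x) N) x (csum (fun n => df n x) N).
Proof.
  induction N as [|N IH]; intros H.
  - cbn [csum]. apply (cderiv_RtoC (fun _ => 0)).
    exact (is_derive_const (K := R_AbsRing) (V := R_NormedModule) 0 x).
  - cbn [csum]. apply (cderiv_plus (fun x => csum (fun n => f n x) N) (f (S N))).
    + apply IH. intros; apply H; lia.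
    + apply H. lia.
Qed.

Lemma csum_RtoC f N : csum (fun n => RtoC (f n)) N = RtoC (rsum f N).
Proof. induction N as [|N IH]; cbn [csum rsum]; [easy|]. now rewrite IH, RtoC_plus. Qed.

Lemma csum_opp f N : csum (fun n => - f n)%C N = (- csum f N)%C.
Proof. induction N as [|N IH]; cbn [csum]; [ring|]. rewrite IH. ring. Qed.

Lemma cderiv_theta_partial w Phi N x : is_tail_kernel w Phi -> w <> 0%C -> 0 < x ->
  cderiv (theta_partial w Phi N) x
    (cpow x (- w - 2)%C * RtoC (rsum (fejer_term x) N - x / 2))%C.
Proof.
  intros HP Hw Hx.
  replace (cpow x (- w - 2)%C * RtoC (rsum (fejer_term x) N - x / 2))%C with
    (/ (2 * w) * (- w * cpow x (- w - 1)%C) - csum (fun n => - (cpow x (- w - 2)%C * RtoC (fejer_term x n)))%C N)%C.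
  - apply cderiv_minus.
    + apply cderiv_scal. now apply cderiv_cpow.
    + apply (cderiv_csum (fun n x => theta_term w Phi x n)
         (fun n x => - (cpow x (- w - 2)%C * RtoC (fejer_term x n)))%C).
      intros n Hn. assert (Hp : 0 < INR n) by (apply lt_0_INR; lia).
      unfold theta_term.
      destruct (HP (INR n * x)) as [HD _]; [nra|].
      replace (- (cpow x (- w - 2)%C * RtoC (fejer_term x n)))%C
        with (cpow (INR n) (w - 1)%C * (RtoC (INR n) * - kern w (INR n * x)%R))%C.
      * apply cderiv_scal. now apply (cderiv_comp_scal Phi).
      * unfold kern. rewrite cpow_mult_base by easy.
        replace (RtoC (fejer_term x n)) with
          (RtoC (sin (PI * (INR n * x)) ^ 2 / PI ^ 2)%R * (cpow (INR n) (w - 1)%C * cpow (INR n) 1%C * cpow (INR n) (- w - 2)%C))%C.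
        { rewrite cpow_1 by easy. ring. }
        rewrite <- !cpow_plus. replace (w - 1 + 1 + (- w - 2))%C with (RtoC (- INR 2)).
        2:{ rewrite RtoC_opp. change (RtoC (INR 2)) with (RtoC (1 + 1)). rewrite RtoC_plus, C2_two. ring. }
        rewrite cpow_RtoC, Rpower_Ropp, Rpower_pow by easy. rewrite <- RtoC_mult. f_equal.
        unfold fejer_term. replace (PI * (INR n * x)) with (PI * INR n * x) by ring.
        pose proof PI_RGT_0. field. lra.
  - rewrite csum_opp, csum_scal, csum_RtoC, RtoC_minus.
    replace (- w - 1)%C with ((- w - 2) + 1)%C by (rewrite C2_two; ring).
    rewrite cpow_plus, cpow_1 by easy.
    replace (RtoC (x / 2)) with (RtoC x / 2)%C by (now rewrite <- RtoC_div).
    field. repeat split; first [exact Hw|apply C2_neq0].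
Qed.

(* Primitive of [U(x) x^(-w-2)] on [[j, j + 1]], where [U(x) = j / 2 + (x - j)^2 / 2]. *)
Definition saw_prim (w : C) (j x : R) : C :=
  (/ (2 * (1 - w)) * cpow x (1 - w)%C + RtoC j / w * cpow x (- w)%C
   - RtoC (j * (j + 1) / 2) / (w + 1) * cpow x (- w - 1)%C)%C.

Lemma cderiv_saw_prim w j x : 0 < Re w < 1 -> 0 < x ->
  cderiv (saw_prim w j) x (cpow x (- w - 2)%C * RtoC (x ^ 2 / 2 - j * x + j * (j + 1) / 2))%C.
Proof.
  intros Hw Hx.
  destruct (strip_neq0 w Hw) as (W0 & W1 & W2).
  replace (cpow x (- w - 2)%C * RtoC (x ^ 2 / 2 - j * x + j * (j + 1) / 2))%C with
    (/ (2 * (1 - w)) * ((1 - w) * cpow x (1 - w - 1)%C) + RtoC j / w * (- w * cpow x (- w - 1)%C)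
     - RtoC (j * (j + 1) / 2) / (w + 1) * ((- w - 1) * cpow x (- w - 1 - 1)%C))%C.
  - unfold saw_prim. apply cderiv_minus; [apply cderiv_plus|]; apply cderiv_scal; now apply cderiv_cpow.
  - replace (1 - w - 1)%C with ((- w - 2) + 1 + 1)%C by (rewrite C2_two; ring).
    replace (- w - 1 - 1)%C with (- w - 2)%C by (rewrite C2_two; ring).
    replace (- w - 1)%C with ((- w - 2) + 1)%C at 1 by (rewrite C2_two; ring).
    rewrite !cpow_plus, cpow_1 by easy.
    rewrite RtoC_plus, RtoC_minus, RtoC_mult.
    replace (RtoC (x ^ 2 / 2)) with (RtoC x * RtoC x / 2)%C.
    2:{ rewrite <- RtoC_mult, <- RtoC_div; [f_equal; field|lra]. }
    field. repeat split; (easy || apply C2_neq0).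
Qed.

Lemma fejer_term_periodic x j n : fejer_term (x - INR j) n = fejer_term x n.
Proof.
  unfold fejer_term. f_equal.
  replace (PI * INR n * (x - INR j)) with (PI * INR n * x - PI * INR (n * j)) by (rewrite mult_INR; ring).
  rewrite sin_minus, sin_PI_INR.
  assert (Hc : cos (PI * INR (n * j)) ^ 2 = 1).
  { pose proof (sin2_cos2 (PI * INR (n * j))) as H. rewrite sin_PI_INR in H. unfold Rsqr in H. simpl. lra. }
  rewrite Rmult_0_r, Rminus_0_r, Rpow_mult_distr, Hc. ring.
Qed.

Lemma fejer_rsum_approx x j N : INR j <= x <= INR j + 1 -> (1 <= N)%nat ->
  Rabs ((x ^ 2 / 2 - INR j * x + INR j * (INR j + 1) / 2) - (x / 2 - rsum (fejer_term x) N)) <= / INR N.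
Proof.
  intros Hx HN. assert (Hp : 0 < INR N) by (apply lt_0_INR; lia).
  pose proof (fejer_series_unit (x - INR j) ltac:(lra)) as Hl.
  assert (Hl2 : is_lim_seq (rsum (fejer_term x)) ((x - INR j) / 2 - (x - INR j) ^ 2 / 2)).
  { eapply is_lim_seq_ext; [|exact Hl]. intros M. apply rsum_ext. intros n _. apply fejer_term_periodic. }
  apply is_series_rsum, is_series_unique in Hl2.
  pose proof (rsum_series_tail (fejer_term x) 1 1 ltac:(lra)) as Ht.
  specialize (Ht ltac:(intros n Hn; rewrite Rmult_1_l, Rabs_pos_eq by apply fejer_term_ge0; now apply fejer_term_le) N HN).
  rewrite Hl2, Rmult_1_l, Rinv_1, Rmult_1_l, (Rpower_Ropp _ 1), Rpower_1 in Ht by easy.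
  rewrite <- Rabs_Ropp.
  match goal with |- Rabs ?e <= _ => replace e with ((x - INR j) / 2 - (x - INR j) ^ 2 / 2 - rsum (fejer_term x) N) by field end.
  easy.
Qed.

Lemma Cmod_small_eq (z : C) K : (forall N, (1 <= N)%nat -> Cmod z <= K * / INR N) -> z = 0%C.
Proof.
  intros H. apply Cmod_eq_0.
  assert (Hl : Rbar_le (Cmod z) 0).
  { apply (is_lim_seq_le_loc (fun _ => Cmod z) (fun n => K * / INR n));
      [|apply is_lim_seq_const|apply is_lim_seq_inv_INR].
    exists 1%nat. exact H. }
  simpl in Hl. pose proof (Cmod_ge_0 z). lra.
Qed.

(** [theta_fun + saw_prim] is constant between consecutive integers. The series is never
    differentiated: for its partial sum the derivative is [O(1/N)], truncation costs another
    [O(1/N)], and [N] is arbitrary. *)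
Lemma theta_fun_increment w Phi j a b : is_tail_kernel w Phi -> 0 < Re w < 1 ->
  0 < a <= b -> INR j <= a -> b <= INR j + 1 ->
  (theta_fun w Phi b - theta_fun w Phi a = saw_prim w (INR j) a - saw_prim w (INR j) b)%C.
Proof.
  intros HP Hw Hab Ha Hb.
  assert (W0 : w <> 0%C) by (apply Re_neq0; lra).
  set (D := Rpower a (- Re w - 2)).
  enough (E : ((theta_fun w Phi b - theta_fun w Phi a) - (saw_prim w (INR j) a - saw_prim w (INR j) b))%C = 0%C).
  { replace (theta_fun w Phi b - theta_fun w Phi a)%C with
     (((theta_fun w Phi b - theta_fun w Phi a) - (saw_prim w (INR j) a - saw_prim w (INR j) b)) +
       (saw_prim w (INR j) a - saw_prim w (INR j) b))%C by ring.
    rewrite E. ring. }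
  apply (Cmod_small_eq _ (4 * Rpower a (- (1 + Re w)) + 4 * Rpower b (- (1 + Re w)) + 2 * D * (b - a))).
  intros N HN.
  set (f := fun x => (theta_partial w Phi N x + saw_prim w (INR j) x)%C).
  assert (Hf : Cmod (f b - f a) <= 2 * (D * / INR N) * (b - a)).
  { apply (cderiv_bound f (fun x => cpow x (- w - 2)%C * RtoC (rsum (fejer_term x) N - x / 2) +
        cpow x (- w - 2)%C * RtoC (x ^ 2 / 2 - INR j * x + INR j * (INR j + 1) / 2))%C); [lra|].
    intros t Ht. split.
    - apply cderiv_plus; [apply cderiv_theta_partial; (easy || lra)|apply cderiv_saw_prim; (easy || lra)].
    - rewrite <- Cmult_plus_distr_l, <- RtoC_plus, Cmod_mult, cpow_Cmod, Cmod_R.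
      rewrite Re_minus, Re_opp, Re_RtoC.
      apply Rmult_le_compat; [left; apply exp_pos|apply Rabs_pos|apply Rpower_anti; lra|].
      pose proof (fejer_rsum_approx t j N ltac:(lra) HN) as Hr.
      match type of Hr with Rabs ?e <= _ => match goal with |- Rabs ?e' <= _ => replace e' with e by ring end end.
      easy. }
  pose proof (theta_fun_approx w Phi a N HP ltac:(lra) HN) as Aa.
  pose proof (theta_fun_approx w Phi b N HP ltac:(lra) HN) as Ab.
  match goal with |- Cmod ?e <= _ => replace e with
    ((theta_fun w Phi b - theta_partial w Phi N b) + (- (theta_fun w Phi a - theta_partial w Phi N a) + (f b - f a)))%C end.
  2:{ unfold f. ring. }
  eapply Rle_trans; [apply Cmod_triangle|].
  eapply Rle_trans; [apply Rplus_le_compat_l, Cmod_triangle|]. rewrite Cmod_opp. lra.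
Qed.

(** [U] is continuous, but its primitives on neighbouring intervals differ at the common integer.
    Each such jump releases one term of the Dirichlet series at [w]. *)
Lemma saw_prim_jump w M : 0 < Re w < 1 ->
  (saw_prim w (INR (S M)) (INR (S M)) - saw_prim w (INR M) (INR (S M)) =
   cpow (INR (S M)) (- w)%C / (w * (w + 1)))%C.
Proof.
  intros Hw.
  destruct (strip_neq0 w Hw) as (W0 & W1 & W2).
  unfold saw_prim. pose proof (INR_S_pos M) as Hp. set (X := INR (S M)) in *.
  replace (INR M) with (X - 1) by (unfold X; rewrite S_INR; ring).
  replace (cpow X (- w)%C) with (cpow X (- w - 1)%C * RtoC X)%C.
  2:{ replace (- w)%C with ((- w - 1) + 1)%C at 2 by ring. now rewrite cpow_plus, cpow_1. }
  replace (RtoC (X * (X + 1) / 2)) with (RtoC X * (RtoC X + 1) / 2)%C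
    by (rewrite <- RtoC_plus, <- RtoC_mult, <- RtoC_div; [easy|lra]).
  replace (RtoC ((X - 1) * (X - 1 + 1) / 2)) with ((RtoC X - 1) * RtoC X / 2)%C.
  2:{ rewrite <- RtoC_minus, <- RtoC_mult, <- RtoC_div; [f_equal; field|lra]. }
  rewrite RtoC_minus. rewrite C2_two. field.
  repeat split; try easy; rewrite <- C2_two; apply C2_neq0.
Qed.

Definition saw_acc (w : C) (M : nat) : C :=
  (saw_prim w (INR M) (INR (S M)) - csum (fun n => cpow (INR n) (- w)%C) M / (w * (w + 1)))%C.

Lemma theta_fun_at_integers w Phi m M : is_tail_kernel w Phi -> 0 < Re w < 1 -> (1 <= m)%nat ->
  (theta_fun w Phi (INR (S M)) - theta_fun w Phi (/ INR m) = saw_prim w 0 (/ INR m) - saw_acc w M)%C.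
Proof.
  intros HP Hw Hm.
  assert (W0 : w <> 0%C) by (apply Re_neq0; lra).
  assert (W1 : (w + 1)%C <> 0%C) by (apply Re_neq0; rewrite Re_plus, Re_RtoC; lra).
  assert (Hm1 : 1 <= INR m) by now apply INR_ge1.
  induction M as [|M IH].
  - assert (0 < / INR m <= 1).
    { split; [apply Rinv_0_lt_compat; lra|]. rewrite <- Rinv_1. apply Rinv_le_contravar; lra. }
    rewrite (theta_fun_increment w Phi 0); try easy.
    + unfold saw_acc. cbn [csum]. simpl INR. field. split; easy.
    + simpl; lra.
    + simpl; lra.
  - pose proof (theta_fun_increment w Phi (S M) (INR (S M)) (INR (S (S M))) HP Hw) as H.
    rewrite (S_INR (S M)) in H at 2 3. pose proof (INR_S_pos M).
    specialize (H ltac:(rewrite !S_INR in *; lra) ltac:(lra) ltac:(rewrite !S_INR; lra)).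
    rewrite <- (S_INR (S M)) in H.
    pose proof (saw_prim_jump w M Hw) as HJ.
    replace (theta_fun w Phi (INR (S (S M))) - theta_fun w Phi (/ INR m))%C with
      ((theta_fun w Phi (INR (S (S M))) - theta_fun w Phi (INR (S M))) +
       (theta_fun w Phi (INR (S M)) - theta_fun w Phi (/ INR m)))%C by ring.
    rewrite H, IH. unfold saw_acc. cbn [csum].
    replace (saw_prim w (INR (S M)) (INR (S M))) with
      (cpow (INR (S M)) (- w)%C / (w * (w + 1)) + saw_prim w (INR M) (INR (S M)))%C by (rewrite <- HJ; ring).
    field. split; easy.
Qed.

(** Since the extra power tends to zero, [zeta_zero w] reduces to the convergence of [saw_acc w] to
    [0]. *)
Lemma saw_acc_zeta_partial w M : 0 < Re w < 1 ->
  (zeta_partial w M = - ((w - 1) * w * (w + 1)) *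
     (saw_acc w M + (/ w - / (2 * (w + 1))) * cpow (INR (S M)) (- w)%C))%C.
Proof.
  intros Hw.
  destruct (strip_neq0 w Hw) as (W0 & W1 & W2).
  unfold saw_acc, zeta_partial, saw_prim. pose proof (INR_S_pos M) as Hp. set (X := INR (S M)) in *.
  replace (INR M) with (X - 1) by (unfold X; rewrite S_INR; ring).
  replace (cpow X (1 - w)%C) with (cpow X (- w - 1)%C * RtoC X * RtoC X)%C.
  2:{ replace (1 - w)%C with ((- w - 1) + 1 + 1)%C by ring. now rewrite !cpow_plus, cpow_1. }
  replace (cpow X (- w)%C) with (cpow X (- w - 1)%C * RtoC X)%C.
  2:{ replace (- w)%C with ((- w - 1) + 1)%C at 2 by ring. now rewrite cpow_plus, cpow_1. }
  replace (RtoC ((X - 1) * (X - 1 + 1) / 2)) with ((RtoC X - 1) * RtoC X / 2)%C.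
  2:{ rewrite <- RtoC_minus, <- RtoC_mult, <- RtoC_div; [f_equal; field|lra]. }
  rewrite RtoC_minus, C2_two. field.
  repeat split; try easy; rewrite <- C2_two; apply C2_neq0.
Qed.

Lemma theta_fun_bound w Phi x : is_tail_kernel w Phi -> 0 < Re w -> 1 <= x ->
  Cmod (theta_fun w Phi x) <= (Cmod (/ (2 * w)) + 6) * Rpower x (- Re w).
Proof.
  intros HP Hw Hx. unfold theta_fun, Cminus.
  eapply Rle_trans; [apply Cmod_triangle|]. rewrite Cmod_opp, Cmod_mult, cpow_Cmod, Re_opp.
  rewrite Rmult_plus_distr_r. apply Rplus_le_compat_l.
  assert (Hmono : Rpower x (- (1 + Re w)) <= Rpower x (- Re w)) by (apply Rle_Rpower; lra).
  pose proof (cseries_tail (theta_term w Phi x) (2 * Rpower x (- (1 + Re w))) 1 ltac:(lra)) as Ht.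
  specialize (Ht ltac:(intros n Hn; apply theta_term_bound; (easy || lra)) 1%nat ltac:(lia)).
  change (INR 1) with 1 in Ht. rewrite Rpower_base_1, Rinv_1 in Ht.
  pose proof (theta_term_bound w Phi x 1 HP ltac:(lra) ltac:(lia)) as H1.
  change (INR 1) with 1 in H1. rewrite Rpower_base_1 in H1.
  replace (cseries (theta_term w Phi x)) with
    ((cseries (theta_term w Phi x) - csum (theta_term w Phi x) 1) + theta_term w Phi x 1)%C
    by (cbn [csum]; ring).
  eapply Rle_trans; [apply Cmod_triangle|]. lra.
Qed.

Lemma clim_cpow_neg w : 0 < Re w -> clim (fun M => cpow (INR (S M)) (- w)%C) 0%C.
Proof.
  intros Hw. apply (clim_squeeze _ _ (fun M => Rpower (INR (S M)) (- Re w))).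
  - now apply is_lim_seq_Rpower_neg.
  - intros n _. replace (cpow (INR (S n)) (- w)%C - 0)%C with (cpow (INR (S n)) (- w)%C) by ring.
    rewrite cpow_Cmod, Re_opp. lra.
Qed.

(** [theta_fun] vanishes at infinity. As [saw_prim w 0] at [1/m] is the integral over [[0, 1/m]],
    the limit is the integral of [U(x) x^(-w-2)] over the half-line, merely split at [1/m]. *)
Lemma saw_acc_lim w Phi m : is_tail_kernel w Phi -> 0 < Re w < 1 -> (1 <= m)%nat ->
  clim (saw_acc w) (saw_prim w 0 (/ INR m) + theta_fun w Phi (/ INR m))%C.
Proof.
  intros HP Hw Hm.
  apply (clim_ext (fun M => (saw_prim w 0 (/ INR m) + theta_fun w Phi (/ INR m)) + -1 * theta_fun w Phi (INR (S M)))%C).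
  - intros M _. pose proof (theta_fun_at_integers w Phi m M HP Hw Hm) as H.
    replace (saw_acc w M) with (saw_prim w 0 (/ INR m) - (saw_prim w 0 (/ INR m) - saw_acc w M))%C by ring.
    rewrite <- H. replace (RtoC (-1)) with (- (1))%C by (rewrite <- RtoC_opp; easy). ring.
  - set (K0 := (saw_prim w 0 (/ INR m) + theta_fun w Phi (/ INR m))%C).
    enough (Hlim : clim (fun M => K0 + -1 * theta_fun w Phi (INR (S M)))%C (K0 + -1 * 0)%C).
    { replace (K0 + -1 * 0)%C with K0 in Hlim by ring. exact Hlim. }
    apply clim_plus; [apply clim_const|]. apply clim_scal.
    apply (clim_squeeze _ _ (fun M => (Cmod (/ (2 * w)) + 6) * Rpower (INR (S M)) (- Re w))).
    + apply is_lim_seq_scal_0. now apply is_lim_seq_Rpower_neg.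
    + intros n _. replace (theta_fun w Phi (INR (S n)) - 0)%C with (theta_fun w Phi (INR (S n))) by ring.
      apply theta_fun_bound; [easy|lra|apply INR_S_ge1].
Qed.

(** * Behaviour of [theta_fun] near [0] *)

Definition fejer_kernel (y : R) : R := (sin (PI * y)) ^ 2 / PI ^ 2 * Rpower y (-2).

Lemma le_of_inv_INR x y K : (forall N, (1 <= N)%nat -> x <= y + K * / INR N) -> x <= y.
Proof.
  intros H.
  assert (Hl : is_lim_seq (fun N => y + K * / INR N) (y + 0)).
  { apply is_lim_seq_plus'; [apply is_lim_seq_const|apply is_lim_seq_inv_INR]. }
  assert (Hle : Rbar_le x (y + 0)).
  { apply (is_lim_seq_le_loc (fun _ => x) (fun N => y + K * / INR N)); [|apply is_lim_seq_const|easy].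
    exists 1%nat. exact H. }
  simpl in Hle. lra.
Qed.

Lemma Phi_increment_bound w Phi a n d : is_tail_kernel w Phi -> 0 < Re w < 1 -> 0 < a -> (1 <= n)%nat ->
  0 <= d <= 2 ->
  Cmod (Phi (INR n * a)%R - Phi (INR (S n) * a)%R) <= 2 * Rpower (INR n * a) (- Re w - d) * a.
Proof.
  intros HP Hw Ha Hn Hd. assert (Hp : 0 < INR n) by (apply lt_0_INR; lia).
  rewrite Cmod_minus_sym.
  replace (2 * Rpower (INR n * a) (- Re w - d) * a) with
    (2 * Rpower (INR n * a) (- Re w - d) * (INR (S n) * a - INR n * a)) by (rewrite S_INR; ring).
  apply (cderiv_bound Phi (fun y => - kern w y)%C); [rewrite S_INR; nra|].
  intros t Ht. assert (0 < INR n * a) by nra. split; [apply HP; lra|].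
  rewrite Cmod_opp. eapply Rle_trans; [apply kern_Cmod_small; [lra|exact Hd]|].
  apply Rpower_anti; lra.
Qed.

Lemma kern_fejer w y : 0 < y -> (cpow y w * kern w y = RtoC (fejer_kernel y))%C.
Proof.
  intros Hy. unfold kern, fejer_kernel.
  replace (cpow y w * (RtoC (sin (PI * y) ^ 2 / PI ^ 2) * cpow y (- w - 2)%C))%C
    with (RtoC (sin (PI * y) ^ 2 / PI ^ 2) * (cpow y w * cpow y (- w - 2)%C))%C by ring.
  rewrite <- cpow_plus. replace (w + (- w - 2))%C with (RtoC (-2)).
  - now rewrite cpow_RtoC, RtoC_mult.
  - replace (-2) with (- (2)) by ring. rewrite RtoC_opp. ring.
Qed.

(** Between [n a] and [(n+1) a] the factor [(n a)^w] is nearly [y^w], and [y^w * kern w y] no longer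
    depends on [w]. So the weighted increments of [Phi] become increments of [H], which
    telescope. *)
Lemma Phi_fejer_increment_bound w Phi (H : R -> R) a n d : is_tail_kernel w Phi ->
  (forall y, 0 < y -> is_derive H y (- fejer_kernel y)) ->
  0 < Re w < 1 -> 0 < a -> (1 <= n)%nat -> 0 <= d <= 2 ->
  Cmod (cpow (INR n) w * (Phi (INR n * a)%R - Phi (INR (S n) * a)%R)
    - cpow a (- w)%C * RtoC (H (INR n * a) - H (INR (S n) * a))%R)
  <= 4 * Cmod w * Rpower a (1 - Re w - d) * Rpower (INR n) (- d - 1).
Proof.
  intros HP HH Hw Ha Hn Hd. assert (Hp : 0 < INR n) by (apply lt_0_INR; lia).
  set (x := INR n * a). assert (Hx : 0 < x) by (unfold x; nra).
  set (f := fun y => (cpow x w * Phi y - RtoC (H y))%C).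
  assert (Hy : INR (S n) * a = x + a) by (unfold x; rewrite S_INR; ring).
  rewrite Hy.
  replace (cpow (INR n) w * (Phi x - Phi (x + a)%R) - cpow a (- w)%C * RtoC (H x - H (x + a))%R)%C
    with (- cpow a (- w)%C * (f (x + a)%R - f x))%C.
  2:{ unfold f. replace (cpow x w) with (cpow (INR n) w * cpow a w)%C by (unfold x; now rewrite cpow_mult_base).
      rewrite cpow_opp, RtoC_minus. field. apply cpow_neq0. }
  rewrite Cmod_mult, Cmod_opp, cpow_Cmod, Re_opp.
  assert (Hf : Cmod (f (x + a)%R - f x) <= 2 * (2 * Cmod w * Rpower x (Re w - 1) * a * Rpower x (- Re w - d)) * (x + a - x)).
  { apply (cderiv_bound f (fun y => (cpow y w - cpow x w) * kern w y)%C); [lra|].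
    intros t Ht. split.
    - replace ((cpow t w - cpow x w) * kern w t)%C with (cpow x w * - kern w t - RtoC (- fejer_kernel t))%C.
      + apply cderiv_minus; [apply cderiv_scal, HP; lra|]. apply cderiv_RtoC, HH. lra.
      + rewrite RtoC_opp, <- (kern_fejer w) by lra. ring.
    - rewrite Cmod_mult. apply Rmult_le_compat; [apply Cmod_ge_0|apply Cmod_ge_0| |].
      + eapply Rle_trans; [apply cpow_diff_bound; lra|].
        apply Rmult_le_compat_l; [|lra].
        apply Rmult_le_pos; [|left; apply exp_pos]. pose proof (Cmod_ge_0 w). lra.
      + eapply Rle_trans; [apply kern_Cmod_small; [lra|exact Hd]|]. apply Rpower_anti; lra. }
  eapply Rle_trans; [apply Rmult_le_compat_l; [left; apply exp_pos|exact Hf]|].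
  replace (Rpower a (1 - Re w - d)) with (Rpower a (- Re w) * a * a * Rpower a (- d - 1)).
  2:{ rewrite <- (Rpower_1 a Ha) at 2 3. rewrite <- !Rpower_plus. f_equal. ring. }
  replace (2 * (2 * Cmod w * Rpower x (Re w - 1) * a * Rpower x (- Re w - d)) * (x + a - x))
    with (4 * Cmod w * a * a * (Rpower x (Re w - 1) * Rpower x (- Re w - d))) by ring.
  rewrite <- Rpower_plus. replace (Re w - 1 + (- Re w - d)) with (- d - 1) by ring.
  unfold x. rewrite <- Rpower_mult_distr by easy. right. ring.
Qed.

(** The theta series is summed by parts against the sums controlled by [zeta_zero_rate]. Its main
    part is [a^(-w) / w * H a]; the constant [2 c] comes from the error in those sums and [4] from
    the replacement of [y^w]. *)
Lemma theta_fun_near_zero w Phi (H : R -> R) a c d : is_tail_kernel w Phi ->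
  (forall y, 0 < y -> is_derive H y (- fejer_kernel y) /\ Rabs (H y) <= / y) ->
  0 < Re w < 1 -> 0 < d <= 2 -> 0 < a -> 0 < c ->
  (forall N, (1 <= N)%nat ->
     Cmod (csum (fun n => cpow (INR n) (w - 1)%C) N - cpow (INR N) w / w) <= c * Rpower (INR N) (Re w - 1)) ->
  Cmod (theta_fun w Phi a - cpow a (- w)%C / w * RtoC (1 / 2 - H a))
    <= (2 * c + 4) * (1 + / d) * Rpower a (1 - Re w - d).
Proof.
  intros HP HH Hw Hd Ha Hc HS.
  assert (W0 : w <> 0%C) by (apply Re_neq0; lra).
  assert (Hcw : 0 < Cmod w) by now apply Cmod_gt_0.
  assert (Hicw : 0 < / Cmod w) by now apply Rinv_0_lt_compat.
  set (S := fun n => csum (fun n => cpow (INR n) (w - 1)%C) n) in *.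
  set (P := fun n => Phi (INR n * a)).
  set (h := fun n => H (INR n * a)).
  set (e1 := (fun n => (S n - cpow (INR n) w / w) * (P n - P (Datatypes.S n)))%C).
  set (e2 := (fun n => cpow (INR n) w * (P n - P (Datatypes.S n)) - cpow a (- w)%C * RtoC (h n - h (Datatypes.S n)))%C).
  set (E := Rpower a (1 - Re w - d)).
  assert (HE : 0 < E) by apply exp_pos.
  (* The three terms in [1/N] are the truncation of [theta_fun], the boundary term of the summation
     by parts, and [H] at [(N+1) a]. *)
  apply (le_of_inv_INR _ _ (4 * Rpower a (- (1 + Re w)) + 2 * (/ Cmod w + c) * Rpower a (- (1 + Re w))
      + Rpower a (- Re w) * / Cmod w * / a)).
  intros N HN. assert (Hp : 0 < INR N) by (apply lt_0_INR; lia).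
  assert (HN1 : 1 <= INR N) by now apply INR_ge1.
  assert (Hsplit : csum (theta_term w Phi a) N =
    (S N * P (Datatypes.S N) + csum e1 N
     + / w * csum e2 N
     + cpow a (- w)%C / w * RtoC (h 1%nat - h (Datatypes.S N)))%C).
  { unfold theta_term. fold P. rewrite (csum_abel (fun n => cpow (INR n) (w - 1)%C) P). fold S.
    replace (RtoC (h 1%nat - h (Datatypes.S N))) with (csum (fun n => RtoC (h n) - RtoC (h (Datatypes.S n)))%C N).
    2:{ rewrite (csum_telescope (fun n => RtoC (h n))), RtoC_minus. easy. }
    rewrite <- !Cplus_assoc. f_equal.
    rewrite <- !csum_scal, <- !csum_plus. apply csum_ext. intros n Hn.
    change (csum (fun n0 => cpow (INR n0) (w - 1)%C) n) with (S n).
    unfold e1, e2. rewrite RtoC_minus. field. easy. }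
  assert (B1 : Cmod (S N * P (Datatypes.S N)) <= 2 * (/ Cmod w + c) * Rpower a (- (1 + Re w)) * / INR N).
  { rewrite Cmod_mult.
    assert (HSN : Cmod (S N) <= (/ Cmod w + c) * Rpower (INR N) (Re w)).
    { replace (S N) with ((S N - cpow (INR N) w / w) + cpow (INR N) w / w)%C by ring.
      eapply Rle_trans; [apply Cmod_triangle|].
      rewrite Cmod_div, cpow_Cmod by easy. specialize (HS N HN).
      assert (Rpower (INR N) (Re w - 1) <= Rpower (INR N) (Re w)) by (apply Rle_Rpower; lra).
      unfold Rdiv. nra. }
    assert (HPN : Cmod (P (Datatypes.S N)) <= 2 * (Rpower (INR N) (- (1 + Re w)) * Rpower a (- (1 + Re w)))).
    { unfold P. rewrite S_INR. destruct (HP ((INR N + 1) * a)) as [_ HB]; [nra|].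
      eapply Rle_trans; [exact HB|]. apply Rmult_le_compat_l; [lra|].
      rewrite Rpower_mult_distr by easy. apply Rpower_anti; [nra|lra]. }
    eapply Rle_trans; [apply Rmult_le_compat; [apply Cmod_ge_0|apply Cmod_ge_0|exact HSN|exact HPN]|].
    replace (/ INR N) with (Rpower (INR N) (Re w) * Rpower (INR N) (- (1 + Re w))).
    - right. ring.
    - rewrite <- Rpower_plus. replace (Re w + - (1 + Re w)) with (- (1)) by ring.
      now rewrite Rpower_Ropp, Rpower_1. }
  assert (B2 : Cmod (csum e1 N) <= 2 * c * E * (1 + / d)).
  { eapply Rle_trans; [apply csum_Cmod|].
    apply Rle_trans with (rsum (fun n => 2 * c * E * Rpower (INR n) (- d - 1)) N).
    - apply rsum_le. intros n Hn. assert (Hpn : 0 < INR n) by (apply lt_0_INR; lia).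
      unfold e1. rewrite Cmod_mult.
      pose proof (Phi_increment_bound w Phi a n d HP Hw Ha ltac:(lia) ltac:(lra)) as HI.
      eapply Rle_trans; [apply Rmult_le_compat; [apply Cmod_ge_0|apply Cmod_ge_0|apply HS; lia|exact HI]|].
      rewrite <- Rpower_mult_distr by easy.
      replace E with (Rpower a (- Re w - d) * a).
      2:{ unfold E. rewrite <- (Rpower_1 a Ha) at 2. rewrite <- Rpower_plus. f_equal. ring. }
      replace (Rpower (INR n) (- d - 1)) with (Rpower (INR n) (Re w - 1) * Rpower (INR n) (- Re w - d)).
      2:{ rewrite <- Rpower_plus. f_equal. ring. }
      right. ring.
    - rewrite rsum_scal. apply Rmult_le_compat_l; [|apply rsum_Rpower_le; lra].
      apply Rmult_le_pos; lra. }
  assert (B3 : Cmod (/ w * csum e2 N)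
     <= 4 * E * (1 + / d)).
  { rewrite Cmod_mult, Cmod_inv by easy.
    apply Rle_trans with (/ Cmod w * (4 * Cmod w * E * (1 + / d))); [|right; field; lra].
    apply Rmult_le_compat_l; [lra|].
    eapply Rle_trans; [apply csum_Cmod|].
    apply Rle_trans with (rsum (fun n => 4 * Cmod w * E * Rpower (INR n) (- d - 1)) N).
    - apply rsum_le. intros n Hn. apply (Phi_fejer_increment_bound w Phi H); [exact HP| |exact Hw|exact Ha|lia|lra].
      intros y Hy. now apply HH.
    - rewrite rsum_scal. apply Rmult_le_compat_l; [|apply rsum_Rpower_le; lra].
      apply Rmult_le_pos; lra. }
  assert (B4 : Cmod (cpow a (- w)%C / w * RtoC (h (Datatypes.S N))) <= Rpower a (- Re w) * / Cmod w * / a * / INR N).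
  { rewrite Cmod_mult, Cmod_div, cpow_Cmod, Cmod_R, Re_opp by easy. unfold Rdiv.
    rewrite (Rmult_assoc _ (/ a)).
    apply Rmult_le_compat_l; [apply Rmult_le_pos; [left; apply exp_pos|lra]|].
    unfold h. rewrite S_INR. destruct (HH ((INR N + 1) * a)) as [_ HB]; [nra|].
    eapply Rle_trans; [exact HB|]. rewrite <- Rinv_mult. apply Rinv_le_contravar; nra. }
  pose proof (theta_fun_approx w Phi a N HP Ha HN) as B5.
  match goal with |- Cmod ?e <= _ => replace e with
    ((theta_fun w Phi a - theta_partial w Phi N a) +
     (- (S N * P (Datatypes.S N)) + (- csum e1 N +
      (- (/ w * csum e2 N)
       + cpow a (- w)%C / w * RtoC (h (Datatypes.S N))))))%C end.
  2:{ unfold theta_partial. rewrite Hsplit.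
      replace (h 1%nat) with (H a) by (unfold h; f_equal; change (INR 1) with 1; ring).
      rewrite !(RtoC_minus _ (h (Datatypes.S N))), !(RtoC_minus (1 / 2)).
      replace (RtoC (1 / 2)) with (/ 2)%C by (unfold Rdiv; now rewrite Rmult_1_l, RtoC_inv by lra).
      field. repeat split; first [exact W0|apply C2_neq0]. }
  eapply Rle_trans; [apply Cmod_triangle|].
  eapply Rle_trans; [apply Rplus_le_compat_l, Cmod_triangle|].
  eapply Rle_trans; [apply Rplus_le_compat_l, Rplus_le_compat_l, Cmod_triangle|].
  eapply Rle_trans; [apply Rplus_le_compat_l, Rplus_le_compat_l, Rplus_le_compat_l, Cmod_triangle|].
  rewrite !Cmod_opp. lra.
Qed.

Lemma fejer_kernel_bound y : 0 < y -> Rabs (- fejer_kernel y) <= 1.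
Proof.
  intros Hy. pose proof PI_RGT_0. rewrite Rabs_Ropp. unfold fejer_kernel.
  replace (-2) with (- INR 2) by (simpl; ring). rewrite Rpower_Ropp, Rpower_pow by easy.
  assert (Hpos : 0 <= sin (PI * y) ^ 2 / PI ^ 2 * / y ^ 2).
  { apply Rmult_le_pos; [apply sin2_PI2_bound|]. left. apply Rinv_0_lt_compat, pow_lt; easy. }
  rewrite Rabs_pos_eq by easy.
  replace (sin (PI * y) ^ 2 / PI ^ 2 * / y ^ 2) with (sin (PI * y) ^ 2 / (PI * y) ^ 2) by (field; lra).
  assert (0 < PI * y) by nra.
  apply Rle_div_l; [apply pow_lt; easy|]. rewrite Rmult_1_l, <- (pow2_abs (sin (PI * y))).
  apply pow_incr. split; [apply Rabs_pos|]. apply abs_sin_le. lra.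
Qed.

(* The functional equation enters only through this symmetry of the zeros. *)
Lemma zeta_zero_reflect w : 0 < Re w < 1 -> zeta_zero (1 - w) -> zeta_zero w.
Proof.
  intros Hw Hz.
  assert (W0 : w <> 0%C) by (apply Re_neq0; lra).
  assert (Hcw : 0 < Cmod w) by now apply Cmod_gt_0.
  assert (Hicw : 0 < / Cmod w) by now apply Rinv_0_lt_compat.
  destruct (zeta_zero_rate w Hw Hz) as (c & Hc & HS).
  destruct (ex_tail_kernel w ltac:(lra)) as [Phi HP].
  destruct ex_tail_fejer as [H HH].
  (* With this choice the error exponent [1 - Re w - d] equals [d] and is positive, so the error
     vanishes at [0]. *)
  set (d := (1 - Re w) / 2). assert (Hd : 0 < d <= 2) by (unfold d; lra).
  set (A := (saw_prim w 0 (/ INR 1) + theta_fun w Phi (/ INR 1))%C).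
  assert (HA : clim (saw_acc w) A) by (apply saw_acc_lim; (easy || lia)).
  set (c0 := Cmod (/ (2 * (1 - w)))).
  assert (Hc0 : 0 <= c0) by apply Cmod_ge_0.
  set (C1 := (2 * c + 4) * (1 + / d)).
  assert (Hid : 0 < / d) by (apply Rinv_0_lt_compat; lra).
  assert (HC1 : 0 < C1) by (unfold C1; nra).
  assert (Hsaw : forall m, Cmod (saw_prim w 0 (/ INR (S m))) <= c0 * Rpower (INR (S m)) (- (1 - Re w))).
  { intros m. pose proof (INR_S_pos m). unfold saw_prim.
    replace (/ (2 * (1 - w)) * cpow (/ INR (S m)) (1 - w)%C + RtoC 0 / w * cpow (/ INR (S m)) (- w)%C -
       RtoC (0 * (0 + 1) / 2) / (w + 1) * cpow (/ INR (S m)) (- w - 1)%C)%C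
      with (/ (2 * (1 - w)) * cpow (/ INR (S m)) (1 - w)%C)%C.
    - rewrite Cmod_mult, cpow_Cmod, Re_minus, Re_RtoC. fold c0.
      right. f_equal. unfold Rpower. rewrite ln_Rinv by easy. f_equal. ring.
    - replace (0 * (0 + 1) / 2) with 0 by field. unfold Cdiv. ring. }
  (* The limit of [saw_acc w] does not depend on the splitting point, so [A] can be evaluated by
     letting that point tend to [0]. *)
  assert (Hth : forall m, (saw_prim w 0 (/ INR (S m)) + theta_fun w Phi (/ INR (S m)))%C = A).
  { intros m. apply (clim_unique (saw_acc w)); [apply saw_acc_lim; (easy || lia)|easy]. }
  set (u := fun m => 1 / 2 - H (/ INR (S m))).
  set (v := fun m => (cpow (/ INR (S m)) (- w)%C / w * RtoC (u m))%C).
  assert (Hnear : forall m, Cmod (theta_fun w Phi (/ INR (S m)) - v m)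
     <= C1 * Rpower (INR (S m)) (- d)).
  { intros m. pose proof (INR_S_pos m) as Hp.
    pose proof (theta_fun_near_zero w Phi H (/ INR (S m)) c d HP HH Hw Hd ltac:(now apply Rinv_0_lt_compat) Hc HS) as Hn.
    fold C1 in Hn. fold (u m) in Hn. eapply Rle_trans; [exact Hn|]. right. f_equal.
    unfold Rpower. rewrite ln_Rinv by easy. f_equal. unfold d. field. }
  assert (Hpow : forall m, Cmod (v m) = Rpower (INR (S m)) (Re w) * / Cmod w * Rabs (u m)).
  { intros m. pose proof (INR_S_pos m) as Hp.
    unfold v. rewrite Cmod_mult, Cmod_div, cpow_Cmod, Cmod_R, Re_opp by easy. unfold Rdiv. f_equal. f_equal.
    unfold Rpower. rewrite ln_Rinv by easy. f_equal. ring. }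
  assert (HAle : forall m, Cmod (A - v m) <=
      c0 * Rpower (INR (S m)) (- (1 - Re w)) + C1 * Rpower (INR (S m)) (- d)).
  { intros m. rewrite <- (Hth m).
    match goal with |- Cmod ?e <= _ => replace e with
      (saw_prim w 0 (/ INR (S m)) + (theta_fun w Phi (/ INR (S m)) - v m))%C by ring end.
    eapply Rle_trans; [apply Cmod_triangle|]. apply Rplus_le_compat; [apply Hsaw|apply Hnear]. }
  assert (Hle1 : forall m e, e <= 0 -> Rpower (INR (S m)) e <= 1).
  { intros m e He. rewrite <- (Rpower_O (INR (S m))) by apply INR_S_pos.
    apply Rle_Rpower; [apply INR_S_ge1|easy]. }
  (* Boundedness of [theta_fun] near 0 forces the total mass of the Fejer kernel to be 1/2. *)
  set (B := Cmod w * (Cmod A + c0 + C1)).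
  assert (Hu0 : is_lim_seq u 0).
  { apply is_lim_seq_abs_0.
    apply (is_lim_seq_le_le (fun _ => 0) _ (fun m => B * Rpower (INR (S m)) (- Re w))).
    - intros m. split; [apply Rabs_pos|].
      assert (Hb : Rpower (INR (S m)) (Re w) * / Cmod w * Rabs (u m) <= Cmod A + c0 + C1).
      { rewrite <- Hpow.
        replace (v m) with
          (A + - (A - v m))%C by ring.
        eapply Rle_trans; [apply Cmod_triangle|]. rewrite Cmod_opp.
        pose proof (HAle m). pose proof (Hle1 m (- (1 - Re w)) ltac:(lra)). pose proof (Hle1 m (- d) ltac:(lra)).
        pose proof (exp_pos (- (1 - Re w) * ln (INR (S m)))). pose proof (exp_pos (- d * ln (INR (S m)))).
        assert (c0 * Rpower (INR (S m)) (- (1 - Re w)) <= c0 * 1) by (apply Rmult_le_compat_l; lra).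
        assert (C1 * Rpower (INR (S m)) (- d) <= C1 * 1) by (apply Rmult_le_compat_l; lra). lra. }
      pose proof (Rpower_pos (INR (S m)) (Re w)) as Hpp.
      rewrite Rpower_Ropp. unfold B.
      apply Rmult_le_reg_l with (Rpower (INR (S m)) (Re w) * / Cmod w); [nra|].
      eapply Rle_trans; [exact Hb|]. right. field. lra.
    - apply is_lim_seq_const.
    - apply is_lim_seq_scal_0. apply is_lim_seq_Rpower_neg. lra. }
  (* [fejer_kernel] is at most [1], so [H] is Lipschitz; with the limit [0] already known, [u] is
     bounded by the distance to [0]. *)
  assert (Hum : forall m, Rabs (u m) <= / INR (S m)).
  { intros m. pose proof (INR_S_pos m) as Hp.
    assert (Hl : is_lim_seq (fun k => Rabs (u m - u k)) (Rabs (u m - 0))).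
    { apply (is_lim_seq_abs _ (Finite _)). apply is_lim_seq_minus'; [apply is_lim_seq_const|easy]. }
    rewrite Rminus_0_r in Hl.
    apply (is_lim_seq_upper _ _ _ Hl).
    exists m. intros k Hk. pose proof (INR_S_pos k) as Hpk.
    assert (Hik : 0 < / INR (S k)) by now apply Rinv_0_lt_compat.
    assert (Hle : / INR (S k) <= / INR (S m)) by (apply Rinv_le_contravar; [easy|apply le_INR; lia]).
    unfold u. replace (1 / 2 - H (/ INR (S m)) - (1 / 2 - H (/ INR (S k)))) with (- (H (/ INR (S m)) - H (/ INR (S k)))) by ring.
    rewrite Rabs_Ropp.
    eapply Rle_trans; [apply (derive_bound H (fun y => - fejer_kernel y) 1); [easy|]|lra].
    intros t Ht. split; [apply HH; lra|apply fejer_kernel_bound; lra]. }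
  (* With [a = 1/(m+1)], the bound on [u] makes [v m] of size [a^(1 - Re w)], like the integral over
     [[0, a]]; the rest is [O(a^d)]. All three tend to zero. *)
  assert (HA0 : A = 0%C).
  { apply Cmod_eq_0.
    assert (Hl : is_lim_seq (fun m => (c0 + / Cmod w) * Rpower (INR (S m)) (- (1 - Re w)) + C1 * Rpower (INR (S m)) (- d))
       ((c0 + / Cmod w) * 0 + C1 * 0)).
    { apply is_lim_seq_plus'; (apply is_lim_seq_mult'; [apply is_lim_seq_const|]);
        apply is_lim_seq_Rpower_neg; lra. }
    assert (Hle : Rbar_le (Cmod A) ((c0 + / Cmod w) * 0 + C1 * 0)).
    { apply (is_lim_seq_le (fun _ => Cmod A) (fun m => (c0 + / Cmod w) * Rpower (INR (S m)) (- (1 - Re w)) + C1 * Rpower (INR (S m)) (- d)));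
        [|apply is_lim_seq_const|easy].
      intros m. pose proof (INR_S_pos m) as Hp.
      replace A with ((A - v m) + v m)%C by ring.
      eapply Rle_trans; [apply Cmod_triangle|]. rewrite Hpow.
      pose proof (HAle m).
      assert (Rpower (INR (S m)) (Re w) * / Cmod w * Rabs (u m) <= / Cmod w * Rpower (INR (S m)) (- (1 - Re w))).
      { replace (- (1 - Re w)) with (Re w + - (1)) by ring. rewrite Rpower_plus, Rpower_Ropp, Rpower_1 by easy.
        replace (/ Cmod w * (Rpower (INR (S m)) (Re w) * / INR (S m))) with
          (Rpower (INR (S m)) (Re w) * / Cmod w * / INR (S m)) by ring.
        apply Rmult_le_compat_l; [|apply Hum]. apply Rmult_le_pos; [left; apply exp_pos|lra]. }
      lra. }
    simpl in Hle. pose proof (Cmod_ge_0 A). lra. }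
  rewrite HA0 in HA. unfold zeta_zero.
  apply (clim_ext (fun M => - ((w - 1) * w * (w + 1)) *
     (saw_acc w M + (/ w - / (2 * (w + 1))) * cpow (INR (S M)) (- w)%C))%C).
  - intros M _. symmetry. now apply saw_acc_zeta_partial.
  - replace (RtoC 0) with (- ((w - 1) * w * (w + 1)) * (0 + (/ w - / (2 * (w + 1))) * 0))%C by ring.
    apply clim_scal. apply clim_plus; [easy|]. apply clim_scal. apply clim_cpow_neg. lra.
Qed.

(** * Zeros of the eta series *)

Definition eta_term (s : C) (n : nat) : C := (RtoC ((-1) ^ (pred n)) * cpow (INR n) (- s)%C)%C.

Lemma is_series_clim (f : nat -> C) (l : C) :
  is_series (K := C_AbsRing) (V := C_NormedModule) (fun n => f (S n)) l -> clim (csum f) l.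
Proof.
  intros H.
  assert (Hs : forall N, sum_n (G := C_AbelianMonoid) (fun n => f (S n)) N = csum f (S N)).
  { induction N as [|N IH].
    - rewrite sum_O. cbn [csum]. change (f 1%nat = 0 + f 1%nat)%C. ring.
    - rewrite sum_Sn, IH. reflexivity. }
  unfold clim. apply (is_lim_seq_incr_1 (fun n => Cmod (csum f n - l))).
  apply is_lim_seq_spec. intros eps.
  unfold is_series in H.
  pose proof (proj1 (filterlim_locally_ball_norm _ _) H eps) as [N0 HN0].
  exists N0. intros n Hn. specialize (HN0 n Hn). unfold ball_norm in HN0.
  rewrite Hs in HN0. rewrite Rminus_0_r, Rabs_pos_eq by apply Cmod_ge_0. exact HN0.
Qed.

(** Changing the sign of the even terms subtracts twice the sum of [(2 n)^(-s)], which is [2^(1-s)]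
    times a sum of half the length. *)
Lemma eta_csum_even s N :
  csum (eta_term s) (2 * N) =
  (csum (fun n => cpow (INR n) (- s)%C) (2 * N) - cpow 2 (1 - s)%C * csum (fun n => cpow (INR n) (- s)%C) N)%C.
Proof.
  induction N as [|N IH]; [cbn; ring|].
  replace (2 * S N)%nat with (S (S (2 * N))) by lia.
  cbn [csum]. rewrite IH.
  assert (E1 : eta_term s (S (2 * N)) = cpow (INR (S (2 * N))) (- s)%C).
  { unfold eta_term. cbn [pred]. rewrite pow_1_even. ring. }
  assert (E2 : eta_term s (S (S (2 * N))) = (- cpow (INR (S (S (2 * N)))) (- s)%C)%C).
  { unfold eta_term. cbn [pred]. rewrite pow_1_odd. replace (RtoC (-1)) with (- (1))%C by (rewrite <- RtoC_opp; easy). ring. }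
  rewrite E1, E2.
  assert (E3 : cpow (INR (S (S (2 * N)))) (- s)%C = (cpow 2 (- s)%C * cpow (INR (S N)) (- s)%C)%C).
  { rewrite <- cpow_mult_base by (lra || apply INR_S_pos). f_equal.
    replace (S (S (2 * N))) with (2 * S N)%nat by lia. rewrite mult_INR. reflexivity. }
  assert (E4 : cpow 2 (1 - s)%C = (2 * cpow 2 (- s)%C)%C).
  { replace (1 - s)%C with (1 + - s)%C by ring. rewrite cpow_plus, cpow_1 by lra. easy. }
  rewrite E3, E4, C2_two. ring.
Qed.

Lemma zeta_partial_lim w : 0 < Re w < 1 -> exists Z, clim (zeta_partial (1 - w)) Z.
Proof.
  intros Hw.
  set (b := fun n => (cpow (INR (S n)) w - cpow (INR n) w - w * cpow (INR n) (w - 1)%C)%C).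
  assert (Hb : forall N, zeta_partial (1 - w) N = (1 + csum b N)%C).
  { induction N as [|N IH].
    - rewrite zeta_partial_w. cbn [csum]. change (INR 1) with 1. rewrite cpow_base_1. ring.
    - cbn [csum]. replace (1 + (csum b N + b (S N)))%C with (zeta_partial (1 - w) N + b (S N))%C by (rewrite IH; ring).
      rewrite !zeta_partial_w. unfold b. cbn [csum]. ring. }
  exists (1 + cseries b)%C.
  set (B := 4 * Cmod w * Cmod (w - 1)%C). set (d := 1 - Re w).
  apply (clim_squeeze _ _ (fun N => 2 * B * (/ d) * Rpower (INR (pred N + 1)) (- d))).
  - apply is_lim_seq_scal_0.
    apply is_lim_seq_incr_1. apply (is_lim_seq_ext (fun n => Rpower (INR (S n)) (- d))).
    + intros n. cbn [pred]. now rewrite Nat.add_1_r.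
    + apply is_lim_seq_Rpower_neg. unfold d. lra.
  - intros N HN. rewrite Hb, Cmod_minus_sym.
    replace (1 + cseries b - (1 + csum b N))%C with (cseries b - csum b N)%C by ring.
    replace (pred N + 1)%nat with N by lia.
    eapply Rle_trans; [apply (cseries_tail b B d); [unfold d; lra| |easy]|right; ring].
    intros n Hn. now apply zeta_partial_step.
Qed.

Lemma clim_double u l : clim u l -> clim (fun n => u (2 * n)%nat) l.
Proof.
  intros H. unfold clim in *.
  apply (is_lim_seq_subseq (fun n => Cmod (u n - l)) 0 (fun n => (2 * n)%nat)); [|exact H].
  apply eventually_subseq. intros n. lia.
Qed.

Lemma one_minus_cpow2_neq0 (w : C) : 0 < Re w -> (1 - cpow 2 w)%C <> 0%C.
Proof.
  intros Hw H.
  assert (Hq : cpow 2 w = 1%C) by (replace (cpow 2 w) with (1 - (1 - cpow 2 w))%C by ring; rewrite H; ring).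
  assert (Hm : Cmod (cpow 2 w) = 1) by (rewrite Hq; apply Cmod_1).
  rewrite cpow_Cmod in Hm.
  assert (Hlt : Rpower 2 0 < Rpower 2 (Re w)) by (apply Rpower_lt; lra).
  rewrite Rpower_O in Hlt by lra. lra.
Qed.

(** [zeta_partial s] has a limit [Z], reached along both [N] and [2 N]; comparison with
    [eta_csum_even] gives [(1 - 2^(1-s)) * Z = 0], where [|2^(1-s)| > 1]. *)
Lemma eta_zero_zeta_zero s : 0 < Re s < 1 -> clim (csum (eta_term s)) 0%C -> zeta_zero s.
Proof.
  intros Hs He. set (w := (1 - s)%C).
  assert (Hw : 0 < Re w < 1) by (unfold w; rewrite Re_minus, Re_RtoC; lra).
  assert (Es : s = (1 - w)%C) by (unfold w; ring).
  destruct (zeta_partial_lim w Hw) as [Z HZ]. rewrite <- Es in HZ.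
  set (q := cpow 2 w).
  assert (Hid : forall N, ((s - 1) * csum (eta_term s) (2 * N) =
     zeta_partial s (2 * N) + - q * zeta_partial s N
       + (cpow (INR (S (S (2 * N)))) w - cpow (INR (S (2 * N))) w))%C).
  { intros N. rewrite eta_csum_even. unfold zeta_partial. fold w. fold q.
    replace (cpow (INR (S (S (2 * N)))) w) with (q * cpow (INR (S N)) w)%C.
    - ring.
    - unfold q. rewrite <- cpow_mult_base by (lra || apply INR_S_pos). f_equal.
      replace (S (S (2 * N))) with (2 * S N)%nat by lia. rewrite mult_INR. reflexivity. }
  assert (H1 : clim (fun N => (s - 1) * csum (eta_term s) (2 * N))%C ((s - 1) * 0)%C).
  { apply clim_scal. now apply (clim_double (csum (eta_term s))). }
  assert (H2 : clim (fun N => (s - 1) * csum (eta_term s) (2 * N))%C (Z + - q * Z + 0)%C).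
  { apply (clim_ext (fun N => zeta_partial s (2 * N) + - q * zeta_partial s N
       + (cpow (INR (S (S (2 * N)))) w - cpow (INR (S (2 * N))) w))%C); [intros; now rewrite Hid|].
    apply clim_plus; [apply clim_plus|].
    - now apply clim_double.
    - now apply clim_scal.
    - apply (clim_double (fun M => cpow (INR (S (S M))) w - cpow (INR (S M)) w)%C).
      apply (clim_squeeze _ _ (fun M => 2 * Cmod w * Rpower (INR (S M)) (- (1 - Re w)))).
      + apply is_lim_seq_scal_0. apply is_lim_seq_Rpower_neg. lra.
      + intros M _. replace (cpow (INR (S (S M))) w - cpow (INR (S M)) w - 0)%C
          with (cpow (INR (S (S M))) w - cpow (INR (S M)) w)%C by ring.
        pose proof (INR_S_pos M). rewrite (S_INR (S M)).
        eapply Rle_trans; [apply cpow_diff_bound; lra|].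
        right. replace (- (1 - Re w)) with (Re w - 1) by ring. ring. }
  pose proof (clim_unique _ _ _ H1 H2) as E.
  assert (Hq : (1 - q)%C <> 0%C) by (apply one_minus_cpow2_neq0; lra).
  assert (HZ0 : Z = 0%C).
  { replace Z with ((Z + - q * Z + 0) / (1 - q))%C by (field; easy).
    rewrite <- E. field. easy. }
  rewrite HZ0 in HZ. exact HZ.
Qed.

(** For real [s] the terms alternate and decrease in size, so the even partial sums increase and
    stay above [1 - 2^(-s) > 0]. *)
Lemma eta_real_nonzero s : 0 < Re s < 1 -> Im s = 0 -> clim (csum (eta_term s)) 0%C -> False.
Proof.
  intros Hs Hi He. set (x := Re s) in *.
  assert (Ht : forall n, Re (eta_term s n) = (-1) ^ (pred n) * Rpower (INR n) (- x)).
  { intros n. unfold eta_term, cpow. rewrite Re_opp. fold x.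
    replace (Im (- s)) with 0 by (destruct s; unfold Im in *; simpl in *; lra).
    rewrite !Rmult_0_l, cos_0, sin_0. unfold Rpower, Cmult, RtoC, Re. cbn [fst snd]. ring. }
  set (r := fun N => rsum (fun n => (-1) ^ (pred n) * Rpower (INR n) (- x)) (2 * N)).
  assert (Hanti : forall n, Rpower (INR (S (S n))) (- x) < Rpower (INR (S n)) (- x)).
  { intros n. unfold Rpower. apply exp_increasing.
    assert (ln (INR (S n)) < ln (INR (S (S n)))).
    { apply ln_increasing; [apply INR_S_pos|apply lt_INR; lia]. } nra. }
  assert (Hstep : forall N, r (S N) = r N + (Rpower (INR (S (2 * N))) (- x) - Rpower (INR (S (S (2 * N)))) (- x))).
  { intros N. unfold r. replace (2 * S N)%nat with (S (S (2 * N))) by lia.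
    cbn [rsum pred]. rewrite pow_1_odd, pow_1_even. ring. }
  set (c := Rpower (INR 1) (- x) - Rpower (INR 2) (- x)).
  assert (Hc : 0 < c) by (unfold c; pose proof (Hanti 0%nat); lra).
  assert (Hr : forall N, c <= r (S N)).
  { induction N as [|N IH].
    - rewrite Hstep. unfold r, c. simpl (2 * 0)%nat. cbn [rsum]. lra.
    - rewrite Hstep. pose proof (Hanti (2 * S N)%nat). lra. }
  apply clim_double, clim_incr in He.
  assert (Hle : Rbar_le c 0).
  { apply (is_lim_seq_le (fun _ => c) (fun n => Cmod (csum (eta_term s) (2 * S n) - 0))); [|apply is_lim_seq_const|exact He].
    intros n. eapply Rle_trans; [apply (Hr n)|].
    replace (csum (eta_term s) (2 * S n) - 0)%C with (csum (eta_term s) (2 * S n)) by ring.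
    eapply Rle_trans; [|apply re_le_Cmod]. eapply Rle_trans; [|apply Rle_abs].
    rewrite csum_Re. right. apply rsum_ext. intros m _. now rewrite Ht. }
  simpl in Hle. lra.
Qed.

Lemma clim_Re_Im u : clim u 0%C -> is_lim_seq (fun n => Re (u n)) 0 /\ is_lim_seq (fun n => Im (u n)) 0.
Proof.
  intros H. split; apply is_lim_seq_abs_0;
    (apply (is_lim_seq_le_le (fun _ => 0) _ (fun n => Cmod (u n - 0))); [|apply is_lim_seq_const|exact H]);
    intros n; (split; [apply Rabs_pos|]); replace (u n - 0)%C with (u n) by ring;
    [apply re_le_Cmod|apply im_le_Cmod].
Qed.

Lemma cpow_wave (a g x : R) :
  cpow x (- (a, g))%C = (wave a g 0 (ln x), wave a g (PI / 2) (ln x)).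
Proof.
  unfold cpow, wave, Re, Im; simpl. rewrite cos_quarter_turn, Rplus_0_r.
  replace (- g * ln x) with (- (g * ln x)) by ring. now rewrite cos_neg, sin_neg.
Qed.

Lemma zeta_partial_components t g N :
  zeta_partial (6 - t, g) N = (1 + rsum (zeta_term (5 - t) g 0) N, rsum (zeta_term (5 - t) g (PI / 2)) N).
Proof.
  unfold zeta_partial.
  assert (E1 : csum (fun n => cpow (INR n) (- (6 - t, g)%R)%C) N =
    (rsum (fun n => wave (5 - t + 1) g 0 (ln (INR n))) N, rsum (fun n => wave (5 - t + 1) g (PI / 2) (ln (INR n))) N)).
  { replace (5 - t + 1) with (6 - t) by ring. induction N as [|N IH]; [easy|].
    cbn [csum rsum]. rewrite IH, cpow_wave. easy. }
  rewrite E1.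
  replace (1 - (6 - t, g)%R)%C with (- (5 - t, g)%R)%C.
  2:{ unfold RtoC, Cminus, Cplus, Copp; simpl. f_equal; ring. }
  rewrite cpow_wave, !rsum_zeta_term, cos_0, cos_PI2.
  assert (E2 : rsum (fun n => wave (5 - t + 1) g (PI / 2 + PI / 2) (ln (INR n))) N =
     - rsum (fun n => wave (5 - t + 1) g 0 (ln (INR n))) N).
  { transitivity (-1 * rsum (fun n => wave (5 - t + 1) g 0 (ln (INR n))) N); [|ring].
    rewrite <- rsum_scal. apply rsum_ext. intros n _.
    unfold wave. replace (PI / 2 + PI / 2) with PI by field. rewrite neg_cos, Rplus_0_r. ring. }
  rewrite E2. replace (0 + PI / 2) with (PI / 2) by ring.
  unfold RtoC, Cminus, Cplus, Copp, Cmult; simpl. f_equal; ring.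
Qed.

(** The partial sums of the series for [xi], together with its constant [1], are exactly
    [zeta_partial]; thus the two descriptions of [(s - 1) zeta(s)] agree in the strip too. *)
Lemma zeta_zero_xi_c t g : zeta_zero (6 - t, g) -> xi_c g 0 t = 0 /\ xi_c g (PI / 2) t = 0.
Proof.
  intros H. apply clim_Re_Im in H. destruct H as [H1 H2].
  assert (S1 : is_lim_seq (rsum (zeta_term (5 - t) g 0)) (0 - 1)).
  { apply (is_lim_seq_ext (fun n => Re (zeta_partial (6 - t, g) n) - 1)).
    - intros n. rewrite zeta_partial_components. unfold Re; simpl. ring.
    - apply is_lim_seq_minus'; [easy|apply is_lim_seq_const]. }
  assert (S2 : is_lim_seq (rsum (zeta_term (5 - t) g (PI / 2))) 0).
  { apply (is_lim_seq_ext (fun n => Im (zeta_partial (6 - t, g) n))); [|easy].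
    intros n. rewrite zeta_partial_components. reflexivity. }
  apply is_series_rsum, is_series_unique in S1. apply is_series_rsum, is_series_unique in S2.
  unfold xi_c. rewrite S1, S2, cos_0, cos_PI2. lra.
Qed.

Lemma no_zeta_zero_right (s : C) :
  (forall theta, 1/2 < theta -> exists K, Epsi_bounded K theta) ->
  1/2 < Re s < 1 -> Im s <> 0 -> zeta_zero s -> False.
Proof.
  intros HE Hs Hi Hz.
  set (theta := (1/2 + Re s) / 2).
  destruct (HE theta ltac:(unfold theta; lra)) as (K & HK).
  assert (Es : s = (6 - (6 - Re s), Im s)).
  { destruct s as [a b]. unfold Re, Im; simpl. f_equal. ring. }
  rewrite Es in Hz. apply zeta_zero_xi_c in Hz. destruct Hz as [Z1 Z2].
  apply (xi_c_nonvanishing (Im s) (6 - Re s) K theta); try easy; unfold theta; lra.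
Qed.

Theorem theorem5p1 :
  (exists C : R, 0 < C /\ exists X0 : R, forall X : R, X0 <= X ->
     Rbar_le (Etilde X)
       (Rbar_plus (Rbar_mult (Finite (5 / 6)) (Etilde (Rpower X (3 / 4))))
                  (Finite (C * sqrt X * ln X)))) ->
  forall s : C, nontrivial_zeta_zero s -> Re s = 1 / 2.
Proof.
  intros (C0 & HC0 & X0 & HX0) s [Hs (_ & _ & eta & Heta & Hz)].
  assert (HE : forall theta, 1/2 < theta -> exists K, Epsi_bounded K theta).
  { intros theta Ht. now apply (Epsi_bound C0 X0). }
  assert (Hq : (1 - cpow 2 (1 - s)%C)%C <> 0%C).
  { apply one_minus_cpow2_neq0. rewrite Re_minus, Re_RtoC. lra. }
  assert (Heta0 : eta = 0%C).
  { replace eta with (eta / (1 - cpow 2 (1 - s)%C) * (1 - cpow 2 (1 - s)%C))%C by (field; easy).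
    rewrite <- Hz. ring. }
  rewrite Heta0 in Heta.
  apply (is_series_clim (eta_term s)) in Heta.
  (* Real zeros go first, since the differential equation degenerates on the line through the
     pole. *)
  destruct (Req_dec (Im s) 0) as [Hi|Hi]; [exfalso; now apply (eta_real_nonzero s)|].
  pose proof (eta_zero_zeta_zero s Hs Heta) as Hzero.
  destruct (Rtotal_order (Re s) (1 / 2)) as [Hlt|[Heq|Hgt]]; [exfalso|easy|exfalso].
  - apply (no_zeta_zero_right (1 - s)%C HE).
    + rewrite Re_minus, Re_RtoC. lra.
    + destruct s as [a b]. unfold Im in *; simpl in *. lra.
    + apply zeta_zero_reflect; [rewrite Re_minus, Re_RtoC; lra|].
      replace (1 - (1 - s))%C with s by ring. easy.
  - apply (no_zeta_zero_right s HE); [lra|easy|easy].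
Qed.
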